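(* There is no nontrivial fractional interest rate model with deterministic volatility which is consistent with the Nelson–Siegel family. That is, let $\mathcal M=\{F(\cdot,y):y\in\mathcal Y\}$ with $$F(x,y)=y_1+y_2e^{-y_4x}+y_3xe^{-y_4x}\ (x\ge0),\qquad \mathcal Y=\{y=(y_1,\dots,y_4)\in\mathbb R^4:\ y_4\ne0\},$$ and let $r^{x_0}$ be the forward rate process solving $$dr(t)=(Ar(t)+\mathcal S_H\sigma(t))\,dt+\sum_{j=1}^d\sigma^j\,d\beta^j(t),\qquad r(0)=x_0\in E,\quad t\in[0,T],$$ with deterministic $\sigma\in\mathcal L(U,E)$, $\sigma^j=\sigma e_j$. If $\mathbb P(r^{x_0}(t)\in\mathcal M\ \forall t\in[0,T])=1$ for every $x_0\in\mathcal M\cap E$, then $\sigma=0$.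
   Context: Fix $0<T<\infty$ and $1/2<H<1$. $\beta=(\beta^1,\dots,\beta^d)$ is a $d$-dimensional fractional Brownian motion with Hurst parameter $H$ on a probability space $(\Omega,\mathcal F,\mathbb P)$ (centered, continuous, Gaussian, $\beta_0=0$, $\mathbb E(\beta^i_t-\beta^i_s)(\beta^j_t-\beta^j_s)=\delta_{ij}|t-s|^{2H}$), and $\phi_H(u)=H(2H-1)|u|^{2H-2}$. Fix a nondecreasing $C^1$ function $w:\mathbb R_+\to[1,\infty)$ with $w^{-1/3}\in L^1(\mathbb R_+)$. $E$ is the separable Hilbert space of $h\in L^1_{loc}(\mathbb R_+)$ with weak derivative $h'\in L^1_{loc}(\mathbb R_+)$ and $\|h\|_E^2=|h(0)|^2+\int_0^\infty|h'(x)|^2w(x)\,dx<\infty$. The right shifts $S(t)g(x)=g(t+x)$ form a $C_0$-semigroup on $E$ with generator $A=d/dx$. $U$ is a $d$-dimensional Euclidean space with orthonormal basis $(e_j)_{j=1}^d$. For $t\ge 0$, $\mathcal S_H\sigma(t)$ is the function $$\mathcal S_H\sigma(t)(x)=\sum_{j=1}^d\Big\{\sigma^j(x)\int_0^t\Big(\int_0^{x+t-\theta}\sigma^j(y)\,dy\Big)\phi_H(t-\theta)\,d\theta+\int_0^x\sigma^j(y)\,dy\int_0^t\sigma^j(x+t-\theta)\phi_H(t-\theta)\,d\theta\Big\},\quad x\ge0.$$ Standing assumption: $\sigma$ is regular enough that $\mathcal S_H\sigma(t)\in E$ and $\int_0^{T}\|\mathcal S_H\sigma(t)\|_E\,dt<\infty$.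 Solutions are continuous mild solutions: $r^{x_0}(t)=S(t)x_0+\int_0^tS(t-s)\mathcal S_H\sigma(s)\,ds+\sum_j\int_0^tS(t-s)\sigma^j\,d\beta^j(s)$, with the stochastic integral the Paley–Wiener integral (isometric extension from step functions with $\mathbb E\langle\int f\,d\beta^j,\int g\,d\beta^j\rangle=\int\int\langle f(u),g(v)\rangle\phi_H(u-v)\,du\,dv$). An interest rate model is *consistent* with a family $\mathcal M$ of forward curves if all forward curves it produces stay in $\mathcal M$ whenever the initial curve is in $\mathcal M$. The model is *nontrivial* if $\sigma\neq0$. *)

(* Defs.v *)
From HB Require Import structures.
From mathcomp Require Import all_boot all_order all_algebra.
From mathcomp Require Import all_classical all_reals all_analysis.

Set Implicit Arguments.
Unset Strict Implicit.
Unset Printing Implicit Defensive.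

Import Order.TTheory GRing.Theory Num.Theory.
Import numFieldNormedType.Exports.

Local Open Scope classical_set_scope.
Local Open Scope ring_scope.

(* Functions on the half line [0, +oo[ are represented by total functions
   R -> R of which only the values at x >= 0 matter: every definition below
   ignores the values at negative arguments. *)

Definition admissible_weight (R : realType) (w : R -> R) : Prop :=
  [/\ forall x : R, 0 <= x -> 1 <= w x,
      forall x y : R, 0 <= x -> x <= y -> w x <= w y,
      {within `[0, +oo[, continuous w},
      (* C^1 up to the boundary point 0 *)
      exists w' : R -> R, {within `[0, +oo[, continuous w'} /\
        forall x : R, 0 < x -> is_derive x 1 w (w' x)
    & (@lebesgue_measure R).-integrable `[0, +oo[
        (fun x => (w x `^ (- 3^-1))%:E)].

Definition L1loc (R : realType) (h : R -> R) : Prop :=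
  forall b : R, 0 <= b ->
    (@lebesgue_measure R).-integrable `[0, b] (fun x => (h x)%:E).

(* C^1 regularity of the test functions is the usual convention for Sobolev
   spaces on an interval. *)
Definition test_function (R : realType) (phi : R -> R) : Prop :=
  [/\ forall x, derivable phi x 1,
      continuous (derive1 phi)
    & exists a b : R, 0 < a /\ forall x, x \notin `[a, b] -> phi x = 0].

Definition is_weak_derivative (R : realType) (h g : R -> R) : Prop :=
  L1loc g /\
  forall phi : R -> R, test_function phi ->
    \int[@lebesgue_measure R]_(x in `]0, +oo[) (h x * derive1 phi x) =
    - \int[@lebesgue_measure R]_(x in `]0, +oo[) (g x * phi x).

(* The weak derivative is unique up to a null set; one is chosen. *)
Definition wderiv (R : realType) (h : R -> R) : R -> R :=
  xget (fun=> 0) [set g | is_weak_derivative h g].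

(* A class in L^1_loc with a weak derivative in L^1_loc has exactly one
   representative that is continuous on [0, +oo[; it is the one that gives a
   meaning to h(0), and the one by which the class is represented here. *)
Definition spaceE (R : realType) (w : R -> R) : set (R -> R) :=
  [set h : R -> R | [/\ L1loc h,
      {within `[0, +oo[, continuous h},
      exists g, is_weak_derivative h g
    & (((h 0) ^+ 2)%:E +
       \int[@lebesgue_measure R]_(x in [set` (`[0%R, +oo[)%R])
          (`|wderiv h x| ^+ 2 * w x)%:E < +oo)%E]].

Definition dotE (R : realType) (w h g : R -> R) : R :=
  h 0 * g 0 +
  \int[@lebesgue_measure R]_(x in `[0, +oo[) (wderiv h x * wderiv g x * w x).

Definition normE (R : realType) (w h : R -> R) : R := Num.sqrt (dotE w h h).

Definition openE (R : realType) (w : R -> R) (G : set (R -> R)) : Prop :=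
  forall h, spaceE w h -> G h ->
    exists2 eps : R, 0 < eps &
      forall g, spaceE w g -> normE w (g \- h) < eps -> G g.

Definition measurableE (R : realType) (w : R -> R) (disp : measure_display)
    (X : measurableType disp) (D : set X) (f : X -> R -> R) : Prop :=
  (forall a, D a -> spaceE w (f a)) /\
  (forall G, openE w G -> measurable (D `&` f @^-1` G)).

Definition right_shift (R : realType) (t : R) (g : R -> R) : R -> R :=
  fun x => g (t + x).

(* a list of pairs (A, h) stands for the simple function sum of 1_A h *)
Definition simple_fun (R : realType) (s : seq (set R * (R -> R))) :
    R -> R -> R :=
  fun u x => \sum_(p <- s) \1_(p.1) u * p.2 x.

Definition simple_integral (R : realType) (t : R)
    (s : seq (set R * (R -> R))) : R -> R :=
  fun x => \sum_(p <- s)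
    fine (@lebesgue_measure R (p.1 `&` `[0, t])) * p.2 x.

Definition is_bochner_integral (R : realType) (w : R -> R) (t : R)
    (f : R -> R -> R) (I : R -> R) : Prop :=
  [/\ @measurableE R w _ R `[0, t] f,
      spaceE w I
    & exists s : nat -> seq (set R * (R -> R)),
      [/\ forall n, {in s n, forall p, measurable p.1 /\ spaceE w p.2},
          forall n, (@lebesgue_measure R).-integrable `[0, t]
            (fun u => (normE w (f u \- simple_fun (s n) u))%:E),
          (fun n => \int[@lebesgue_measure R]_(u in `[0, t])
             normE w (f u \- simple_fun (s n) u)) @ \oo --> (0 : R)
        & (fun n => normE w (I \- simple_integral t (s n))) @ \oo
             --> (0 : R)]].

Definition phiH (R : realType) (H u : R) : R :=
  H * (2 * H - 1) * `|u| `^ (2 * H - 2).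

(* [normal_prob 0 s] is a normal law only for [s != 0]; the Dirac mass at 0 is
   the degenerate centered Gaussian law. *)
Definition centered_gaussian (R : realType) (disp : measure_display)
    (Omega : measurableType disp) (P : probability Omega R) (X : Omega -> R) :
    Prop :=
  measurable_fun setT X /\
  ((exists2 s : R, s != 0 & forall A : set R, measurable A ->
      P (X @^-1` A) = normal_prob 0 s A) \/
   (forall A : set R, measurable A -> P (X @^-1` A) = \d_(0 : R) A)).

Definition is_fbm (R : realType) (disp : measure_display)
    (Omega : measurableType disp) (P : probability Omega R) (T H : R) (d : nat)
    (beta : 'I_d -> R -> Omega -> R) : Prop :=
  [/\ forall (n : nat) (c : 'I_n -> R) (j : 'I_n -> 'I_d) (t : 'I_n -> R),
        (forall k, t k \in `[0, T]) ->
        centered_gaussian P (fun om => \sum_(k < n) c k * beta (j k) (t k) om),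
      \forall om \ae P, forall j,
        {within `[0, T], continuous (fun t => beta j t om)},
      \forall om \ae P, forall j, beta j 0 om = 0
    & forall (i j : 'I_d) (s t : R), s \in `[0, T] -> t \in `[0, T] ->
        expectation P (fun om => (beta i t om - beta i s om) *
                                 (beta j t om - beta j s om)) =
        ((i == j)%:R * `|t - s| `^ (2 * H))%:E].

(* a list of triples (a, b, h) stands for the sum of 1_]a, b] h *)
Definition step_fun (R : realType) (s : seq (R * R * (R -> R))) : R -> R -> R :=
  fun u x => \sum_(p <- s) \1_(`]p.1.1, p.1.2]%classic) u * p.2 x.

Definition is_step (R : realType) (w : R -> R) (t : R)
    (s : seq (R * R * (R -> R))) : Prop :=
  {in s, forall p,
    [/\ 0 <= p.1.1, p.1.1 <= p.1.2, p.1.2 <= t & spaceE w p.2]}.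

Definition step_integral (R : realType) (Omega : Type)
    (b : R -> Omega -> R) (s : seq (R * R * (R -> R))) : Omega -> R -> R :=
  fun om x => \sum_(p <- s) (b p.1.2 om - b p.1.1 om) * p.2 x.

Definition pw_normsq (R : realType) (w : R -> R) (H t : R)
    (f : R -> R -> R) : R :=
  \int[(@lebesgue_measure R \x @lebesgue_measure R)%E]_(p in `[0, t] `*` `[0, t])
    (dotE w (f p.1) (f p.2) * phiH H (p.1 - p.2)).

(* The Paley-Wiener integral over [0, t] of the deterministic integrand f with
   respect to the scalar process b: an L^2 limit of elementary integrals along
   step functions that converge to f in the seminorm of the isometry. *)
Definition is_pw_integral (R : realType) (disp : measure_display)
    (Omega : measurableType disp) (P : probability Omega R) (w : R -> R)
    (H t : R) (b : R -> Omega -> R) (f : R -> R -> R) (Y : Omega -> R -> R) :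
    Prop :=
  [/\ @measurableE R w _ R `[0, t] f,
      (@lebesgue_measure R \x @lebesgue_measure R)%E.-integrable
        (`[0, t] `*` `[0, t])
        (fun p => (normE w (f p.1) * normE w (f p.2) *
                   phiH H (p.1 - p.2))%:E),
      measurableE w setT Y
    & exists s : nat -> seq (R * R * (R -> R)),
      [/\ forall n, is_step w t (s n),
          (fun n => pw_normsq w H t (fun u => f u \- step_fun (s n) u)) @ \oo
             --> (0 : R)
        & (fun n => expectation P (fun om =>
               normE w (Y om \- step_integral b (s n) om) ^+ 2)) @ \oo
             --> 0%E]].

Definition orthonormal_basis (R : realType) (U : vectType R)
    (dotU : {dot U for (@idfun R)}) (d : nat) (e : 'I_d -> U) : Prop :=
  (forall i j, dotU (e i) (e j) = (i == j)%:R) /\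
  <<[seq e j | j : 'I_d]>>%VS = fullv.

Definition bounded_operator (R : realType) (w : R -> R) (U : vectType R)
    (dotU : {dot U for (@idfun R)}) (sigma : U -> R -> R) : Prop :=
  [/\ forall u, spaceE w (sigma u),
      forall (a : R) (u v : U) (x : R), 0 <= x ->
        sigma (a *: u + v) x = a * sigma u x + sigma v x
    & exists C : R, forall u,
        normE w (sigma u) <= C * Num.sqrt (dotU u u)].

(* the no-arbitrage drift S_H sigma(t), with sg j = sigma e_j *)
Definition drift (R : realType) (H : R) (d : nat) (sg : 'I_d -> R -> R)
    (t x : R) : R :=
  \sum_(j < d)
    (sg j x *
       \int[@lebesgue_measure R]_(th in `[0, t])
         ((\int[@lebesgue_measure R]_(y in `[0, x + t - th]) sg j y) *
          phiH H (t - th)) +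
     (\int[@lebesgue_measure R]_(y in `[0, x]) sg j y) *
       \int[@lebesgue_measure R]_(th in `[0, t])
         (sg j (x + t - th) * phiH H (t - th))).

Definition regular_volatility (R : realType) (w : R -> R) (T H : R) (d : nat)
    (sg : 'I_d -> R -> R) : Prop :=
  (forall t, t \in `[0, T] -> spaceE w (drift H sg t)) /\
  (@lebesgue_measure R).-integrable `[0, T]
    (fun t => (normE w (drift H sg t))%:E).

Definition is_mild_solution (R : realType) (disp : measure_display)
    (Omega : measurableType disp) (P : probability Omega R) (w : R -> R)
    (T H : R) (d : nat) (beta : 'I_d -> R -> Omega -> R)
    (sg : 'I_d -> R -> R) (x0 : R -> R) (r : R -> Omega -> R -> R) : Prop :=
  [/\ forall t, t \in `[0, T] -> measurableE w setT (r t),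
      \forall om \ae P, forall t, t \in `[0, T] ->
        (fun s => normE w (r s om \- r t om)) @ within `[0, T] (nbhs t)
          --> (0 : R)
    & forall t, t \in `[0, T] ->
      exists (I : R -> R) (Y : 'I_d -> Omega -> R -> R),
      [/\ is_bochner_integral w t (fun s => right_shift (t - s) (drift H sg s)) I,
          forall j, is_pw_integral P w H t (beta j)
                      (fun s => right_shift (t - s) (sg j)) (Y j)
        & \forall om \ae P, forall x, 0 <= x ->
            r t om x = right_shift t x0 x + I x + \sum_(j < d) Y j om x]].

Definition NScurve (R : realType) (y1 y2 y3 y4 x : R) : R :=
  y1 + y2 * expR (- y4 * x) + y3 * x * expR (- y4 * x).

Definition nelson_siegel (R : realType) : set (R -> R) :=
  [set h : R -> R | exists y1 y2 y3 y4 : R,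
     y4 != 0 /\ forall x, 0 <= x -> h x = NScurve y1 y2 y3 y4 x].

(* [r x0] is the forward curve process started at x0 *)
Definition consistent (R : realType) (disp : measure_display)
    (Omega : measurableType disp) (P : probability Omega R) (w : R -> R)
    (T : R) (r : (R -> R) -> R -> Omega -> R -> R) (M : set (R -> R)) : Prop :=
  forall x0, M x0 -> spaceE w x0 ->
    \forall om \ae P, forall t, t \in `[0, T] -> M (r x0 t om).

(* Main.v *)
(* Start the model at the zero curve and look at a small time t.  Tilting the
   Gaussian law of beta_t / t^H produces, with positive probability, a
   Nelson-Siegel curve equal to t^H sum_j z_j sigma^j + t^{2H} D + small error on
   any given finite set of points, where the vector z is confined to a ball of
   fixed radius around an arbitrary centre and D = sum_j sigma^j int_0^. sigma^j
   comes from the drift.  Since the curves grow at most like sqrt x, they have the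
   form a + (b + c x) q^x with 0 < q < 1.  Letting t -> 0 with a large centre,
   every combination of the sigma^j is a limit of such curves, hence is one
   itself; so all sigma^j share one exponent q.  If they are not all constant,
   the curves are t^H (s + t^H D + ...) with s of exponent q and bounded away from
   the constants, so their exponents tend to q.  Applying on the integers the
   difference operators that annihilate both s and the curve leaves in the limit
   an order 5 recurrence with characteristic roots 1 and q for D; the q^{2x} part
   of D must vanish, and it contains -(sum_j (c^j)^2) / |ln q| and then
   -(sum_j (b^j)^2) / |ln q|.  So the sigma^j are constant, the drift at time T is
   affine in x with slope proportional to sum_j (sigma^j)^2, and an affine function
   lies in E only if its slope is 0. *)

Require Import Defs.
From HB Require Import structures.
From mathcomp Require Import all_boot all_order all_algebra.
From mathcomp Require Import all_classical all_reals all_analysis.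
From mathcomp Require Import measurable_realfun.
From mathcomp Require Import ring lra zify.

Set Implicit Arguments.
Unset Strict Implicit.
Unset Printing Implicit Defensive.

Import Order.TTheory GRing.Theory Num.Theory.
Import numFieldNormedType.Exports.

Local Open Scope classical_set_scope.
Local Open Scope ring_scope.

(** * Integrals and elementary analysis *)

(** The stochastic integral is controlled only in mean square at finitely many points, and
    Nelson-Siegel curves do not form a closed set. So no parameter is followed along random curves:
    one outcome is selected for each small time, and recurrences in [x], which do not involve the
    coefficients, pass to the limit. Starting at the zero curve removes the shifted initial curve
    from the solution. Two rounds are forced by the size of the error. At a point [x] the stochastic
    integral is [sg j x] times [beta j t] up to [e * t ^ H], with [e] the oscillation of [sg j] on
    [[x, x + t]]. Continuity gives only [e = o(1)], which is enough at order [t ^ H]. The first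
    round shows that the volatilities are Nelson-Siegel curves, hence locally Lipschitz, so that
    [e = O(t)]; since [H < 1], the error [t ^ (1 + H)] is then negligible against [t ^ (2 * H)], the
    order at which the drift appears. The condition [H > 1/2] acts through the kernel [phiH], which
    is nonnegative and integrable: increments are positively correlated, and this alone gives the
    pointwise error bound. *)

Section integration_utilities.
Context d (T : measurableType d) (R : realType) (mu : {measure set T -> \bar R}).
Implicit Types (D E : set T) (f g h : T -> R).

Lemma integrable_measurable D f :
  mu.-integrable D (EFin \o f) -> measurable_fun D f.
Proof. by move=> /(measurable_int mu)/measurable_EFinP. Qed.

Lemma integrable_le D f g : measurable D -> measurable_fun D f ->
  (forall x, D x -> `|f x| <= g x) -> mu.-integrable D (EFin \o g) ->
  mu.-integrable D (EFin \o f).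
Proof.
move=> mD mf fg ig; apply: (le_integrable mD _ _ ig).
  exact/measurable_EFinP.
by move=> x Dx /=; rewrite lee_fin (le_trans (fg _ Dx))// ler_norm.
Qed.

Lemma integrable_mul_bounded D f g (M : R) : measurable D ->
  mu.-integrable D (EFin \o f) -> measurable_fun D g ->
  (forall x, D x -> `|g x| <= M) ->
  mu.-integrable D (EFin \o (fun x => f x * g x)).
Proof.
move=> mD fi mg gM; have mf := integrable_measurable fi.
apply: (@integrable_le _ _ (fun x => M * `|f x|)) => //.
- exact: measurable_funM.
- move=> x Dx; rewrite normrM mulrC ler_wpM2r//; exact: gM.
- have := integrableZl mD M (integrable_norm fi).
  by apply: eq_integrable => // x _; rewrite /= EFinM.
Qed.

Lemma integrable_scale D f (c : R) : measurable D ->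
  mu.-integrable D (EFin \o f) -> mu.-integrable D (EFin \o (fun x => c * f x)).
Proof.
move=> mD fi; have := integrableZl mD c fi.
by apply: eq_integrable => // x _; rewrite /= EFinM.
Qed.

Lemma integrable_add D f g : measurable D -> mu.-integrable D (EFin \o f) ->
  mu.-integrable D (EFin \o g) -> mu.-integrable D (EFin \o (fun x => f x + g x)).
Proof. by move=> mD fi gi; have := integrableD mD fi gi. Qed.

Lemma integrable_sub D f g : measurable D -> mu.-integrable D (EFin \o f) ->
  mu.-integrable D (EFin \o g) -> mu.-integrable D (EFin \o (fun x => f x - g x)).
Proof. by move=> mD fi gi; have := integrableB mD fi gi. Qed.

Lemma integrable_lin D f g (a b : R) : measurable D -> mu.-integrable D (EFin \o f) ->
  mu.-integrable D (EFin \o g) ->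
  mu.-integrable D (EFin \o (fun x => a * f x + b * g x)).
Proof. by move=> mD fi gi; apply: integrable_add => //; exact: integrable_scale. Qed.

Lemma Rintegral_lin D f g (a b : R) : measurable D -> mu.-integrable D (EFin \o f) ->
  mu.-integrable D (EFin \o g) ->
  (\int[mu]_(x in D) (a * f x + b * g x) =
   a * \int[mu]_(x in D) f x + b * \int[mu]_(x in D) g x)%R.
Proof.
move=> mD fi gi; rewrite RintegralD ?RintegralZl//; exact: integrable_scale.
Qed.

Lemma Rintegral_dominated D (f_ : nat -> T -> R) f g : measurable D ->
  (forall n, measurable_fun D (f_ n)) -> measurable_fun D f ->
  {ae mu, forall x, D x -> f_ ^~ x @ \oo --> f x} ->
  mu.-integrable D (EFin \o g) ->
  (forall n x, D x -> `|f_ n x| <= g x) ->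
  mu.-integrable D (EFin \o f) /\
  (fun n => \int[mu]_(x in D) f_ n x)%R @ \oo --> (\int[mu]_(x in D) f x)%R.
Proof.
move=> mD mf_ mf ff ig fg.
have [] := @dominated_convergence _ _ _ mu D mD (fun n => EFin \o f_ n) (EFin \o f)
   (EFin \o g) _ _ _ ig _.
- by move=> n; exact/measurable_EFinP.
- exact/measurable_EFinP.
- by apply: filterS ff => x H Dx; apply: cvg_EFin; [exact: nearW|exact: H].
- by apply: aeW => x n Dx /=; rewrite lee_fin fg.
move=> fi _ H; split => //.
apply: fine_cvg; rewrite fineK//; exact: integrable_fin_num.
Qed.

(* The integral of a nonnegative function is the supremum of the integrals of
   the simple functions below it, whether or not it is measurable. *)
Lemma ge0_le_integral_nonmeas D (f g : T -> \bar R) :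
  (forall x, D x -> 0 <= f x)%E -> (forall x, D x -> f x <= g x)%E ->
  (\int[mu]_(x in D) f x <= \int[mu]_(x in D) g x)%E.
Proof.
move=> f0 fg; rewrite integral_mkcond [leRHS]integral_mkcond.
have f0' x : (0 <= (f \_ D) x)%E.
  by rewrite /patch; case: ifPn => // /set_mem /f0.
have fg' x : ((f \_ D) x <= (g \_ D) x)%E.
  by rewrite /patch; case: ifPn => // /set_mem /fg.
rewrite !ge0_integralTE//; last by move=> x; exact: le_trans (fg' x).
apply: ge_ereal_sup => _ /= [h hf <-]; apply: ereal_sup_ubound; exists h => //= x.
exact: le_trans (hf x) (fg' x).
Qed.

End integration_utilities.

(** * Test functions and weak derivatives *)

Section calculus.
Context {R : realType}.
Implicit Types (a b e x : R) (f F h g : R -> R).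
Notation mu := (@lebesgue_measure R).

Lemma Rintegral_FTC2 f F a b : a <= b ->
  {within `[a, b], continuous f} -> {within `[a, b], continuous F} ->
  (forall x, a < x < b -> is_derive x 1 F (f x)) ->
  \int[mu]_(x in `[a, b]) f x = F b - F a.
Proof.
rewrite le_eqVlt => /predU1P[->|ab] cf cF dF.
  by rewrite set_itv1 Rintegral_set1 subrr.
rewrite /Rintegral (@continuous_FTC2 _ f F)//.
- move/continuous_within_itvP : (cF) => /(_ ab)[cF1 cFa cFb].
  split => // x; rewrite in_itv/= => /dF dFx; exact: ex_derive.
- move=> x; rewrite in_itv/= => /dF dFx; rewrite derive1E; exact: derive_val.
Qed.

Lemma is_derive_mul_norm x : is_derive x 1 (fun y : R => y * `|y|) (2 * `|x|).
Proof.
have [x0|x0|->] := ltgtP x 0.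
- rewrite ltr0_norm//.
  apply: (@near_eq_is_derive _ R R (fun y => - y ^+ 2)) => //.
  + near=> y; rewrite ltr0_norm ?mulrN ?expr2//.
    by near: y; exact: lt_nbhsl.
  + by apply: is_derive_eq; rewrite /GRing.scale/=; ring.
- rewrite gtr0_norm//.
  apply: (@near_eq_is_derive _ R R (fun y => y ^+ 2)) => //.
  + near=> y; rewrite gtr0_norm ?expr2//.
    by near: y; exact: lt_nbhsr.
  + by apply: is_derive_eq; rewrite /GRing.scale/=; ring.
- rewrite normr0 mulr0.
  have H : h^-1 *: (((fun y : R => y * `|y|) \o shift 0) (h *: 1) -
      0 * `|0 : R|) @[h --> (0 : R)^'] --> (0 : R).
    have H : (fun h : R => `|h|) @ (0:R)^' --> `|0 : R|.
      by apply: cvg_norm; exact: nbhs_dnbhs.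
    have n0 : `|0 : R| = 0 by exact: normr0.
    rewrite n0 in H; apply: cvg_trans H; apply: near_eq_cvg; near=> h.
    rewrite /= /GRing.scale/= mulr1 addr0 mul0r subr0 mulrA mulVf ?mul1r//.
    by near: h; exact: nbhs_dnbhs_neq.
  by apply: DeriveDef; [apply: cvgP H|exact: cvg_lim H].
Unshelve. all: by end_near. Qed.

(** A C^1 step from 0 to 1 across [[0, e]]. Since [y * |y|] has derivative [2 * |y|], a second
    difference of it is a primitive of the tent [hat e], of height [2 / e] and mass 1. Test
    functions only have to be C^1, so this piecewise quadratic does the work of a mollifier. *)
Definition smoothstep (e x : R) : R :=
  2^-1 + (x * `|x| - 2 * ((x - e / 2) * `|x - e / 2|) +
          (x - e) * `|x - e|) / e ^+ 2.

Definition hat (e x : R) : R :=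
  2 * (`|x| - 2 * `|x - e / 2| + `|x - e|) / e ^+ 2.

Lemma is_derive_smoothstep e x : is_derive x 1 (smoothstep e) (hat e x).
Proof.
rewrite /smoothstep.
have D c : is_derive x 1 (fun y => (y - c) * `|y - c|) (2 * `|x - c|).
  have := @is_derive1_comp R (fun y => y * `|y|) (fun y => y - c) x _ _
    (is_derive_mul_norm _) _.
  move=> /(_ 1)H; rewrite -[X in is_derive _ _ _ X]mulr1; apply: H.
  by apply: is_derive_eq; rewrite subr0.
have D0 := is_derive_mul_norm x.
have D1 := D (e / 2); have D2 := D e.
apply: is_derive_eq; rewrite /hat /GRing.scale/=; ring.
Qed.

Lemma continuous_hat e : continuous (hat e).
Proof.
move=> x; rewrite /hat.
have N c : (`|y - c|) @[y --> x] --> `|x - c|.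
  by apply: cvg_norm; apply: cvgB; [exact: cvg_id|exact: cvg_cst].
have N0 : (`|y|) @[y --> x] --> `|x| by apply: cvg_norm; exact: cvg_id.
apply: cvgM; last exact: cvg_cst.
apply: cvgM; first exact: cvg_cst.
apply: cvgD; last exact: N.
apply: cvgB; first exact: N0.
apply: cvgM; first exact: cvg_cst.
exact: N.
Qed.

Lemma continuous_shiftB f a : continuous f -> continuous (fun x => f (x - a)).
Proof.
move=> cf x; apply: (@continuous_comp _ _ _ (fun y => y - a) f); last exact: cf.
by apply: cvgB; [exact: cvg_id|exact: cvg_cst].
Qed.

Lemma hat_eq0 e x : 0 < e -> x \notin `[0, e] -> hat e x = 0.
Proof.
move=> e0; rewrite in_itv/= negb_and -!ltNge => /orP[x0|xe].
  by rewrite /hat !ltr0_norm; [field; rewrite gt_eqF|lra..].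
by rewrite /hat !gtr0_norm; [field; rewrite gt_eqF|lra..].
Qed.

Lemma hat_ge0 e x : 0 < e -> 0 <= hat e x.
Proof.
move=> e0; rewrite /hat divr_ge0 ?sqr_ge0// mulr_ge0// -addrAC subr_ge0.
have -> : 2 * `|x - e / 2| = `|x + (x - e)|.
  by rewrite -{1}(@ger0_norm _ 2)// -normrM; congr (`| _ |); field.
exact: ler_normD.
Qed.

Lemma smoothstep_le0 e x : 0 < e -> x <= 0 -> smoothstep e x = 0.
Proof.
by move=> e0 x0; rewrite /smoothstep !ler0_norm; [field; rewrite gt_eqF|lra..].
Qed.

Lemma smoothstep_ge1 e x : 0 < e -> e <= x -> smoothstep e x = 1.
Proof.
by move=> e0 x0; rewrite /smoothstep !ger0_norm; [field; rewrite gt_eqF|lra..].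
Qed.

Lemma smoothstep_itv e x : 0 < e -> 0 <= smoothstep e x <= 1.
Proof.
move=> e0; have [x0|x0] := leP x 0; first by rewrite smoothstep_le0// lexx ler01.
have [x1|x1] := leP e x; first by rewrite smoothstep_ge1// lexx ler01.
have e20 : 0 < e ^+ 2 by rewrite exprn_gt0.
rewrite /smoothstep (gtr0_norm x0) (ltr0_norm (_ : x - e < 0)); last by lra.
have [x2|x2] := leP x (e / 2).
  rewrite ler0_norm; last by lra.
  have -> : 2^-1 + (x * x - 2 * ((x - e / 2) * - (x - e / 2)) + (x - e) * - (x - e)) / e ^+ 2 = 2 * x ^+ 2 / e ^+ 2.
    by field; rewrite gt_eqF.
  apply/andP; split; first by rewrite divr_ge0 ?sqr_ge0// mulr_ge0 ?sqr_ge0.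
  rewrite ler_pdivrMr// mul1r; nra.
rewrite gtr0_norm; last by lra.
have -> : 2^-1 + (x * x - 2 * ((x - e / 2) * (x - e / 2)) + (x - e) * - (x - e)) / e ^+ 2 = 1 - 2 * (e - x) ^+ 2 / e ^+ 2.
  by field; rewrite gt_eqF.
have : 2 * (e - x) ^+ 2 / e ^+ 2 <= 1 by rewrite ler_pdivrMr// mul1r; nra.
have : 0 <= 2 * (e - x) ^+ 2 / e ^+ 2.
  by rewrite divr_ge0 ?sqr_ge0// mulr_ge0 ?sqr_ge0.
lra.
Qed.

Lemma derive1_shift_smoothstep e a x :
  is_derive x 1 (fun y => smoothstep e (y - a)) (hat e (x - a)).
Proof.
have := @is_derive1_comp R (smoothstep e) (fun y => y - a) x _ _
    (is_derive_smoothstep _ _) _.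
move=> /(_ 1)H; rewrite -[X in is_derive _ _ _ X]mulr1; apply: H.
by apply: is_derive_eq; rewrite subr0.
Qed.

(** Its derivative is a difference of two tents, that is, of two approximate Dirac masses at [a] and
    [b]; tested against it, a weak derivative yields an increment of the function. *)
Definition plateau (e a b x : R) : R :=
  smoothstep e (x - a) - smoothstep e (x - b).

Lemma is_derive_plateau e a b x :
  is_derive x 1 (plateau e a b) (hat e (x - a) - hat e (x - b)).
Proof.
have Da := derive1_shift_smoothstep e a x.
have Db := derive1_shift_smoothstep e b x.
by rewrite /plateau; apply: is_derive_eq.
Qed.

Lemma derive1_plateau e a b :
  derive1 (plateau e a b) = fun x => hat e (x - a) - hat e (x - b).
Proof.
apply/funext => x; rewrite derive1E; exact: (@derive_val _ _ _ _ _ _ _ (is_derive_plateau e a b x)).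
Qed.

Lemma plateau_eq0 e a b x : 0 < e -> a <= b ->
  x \notin `[a, b + e] -> plateau e a b x = 0.
Proof.
move=> e0 ab; rewrite in_itv/= negb_and -!ltNge /plateau => /orP[x0|xe].
  by rewrite !smoothstep_le0 ?subrr//; lra.
by rewrite !smoothstep_ge1 ?subrr//; lra.
Qed.

Lemma test_function_plateau e a b : 0 < e -> 0 < a -> a <= b ->
  test_function (plateau e a b).
Proof.
move=> e0 a0 ab; split.
- by move=> x; apply: (@ex_derive _ _ _ _ _ _ _ (is_derive_plateau e a b x)).
- rewrite derive1_plateau => x.
  by apply: cvgB; apply: (continuous_shiftB (@continuous_hat e)).
- exists a, (b + e); split => // x; exact: plateau_eq0.
Qed.

Lemma plateau_norm_le1 e a b x : 0 < e -> `|plateau e a b x| <= 1.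
Proof.
move=> e0; rewrite /plateau.
have := smoothstep_itv (x - a) e0; have := smoothstep_itv (x - b) e0.
by rewrite ler_norml; lra.
Qed.

Lemma plateau_eq1 e a b x : 0 < e -> a + e <= x -> x <= b -> plateau e a b x = 1.
Proof.
by move=> e0 ax xb; rewrite /plateau smoothstep_ge1 ?smoothstep_le0 ?subr0//; lra.
Qed.

Lemma Rintegral_hat e a : 0 < e ->
  \int[mu]_(x in `[a, a + e]) hat e (x - a) = 1.
Proof.
move=> e0.
rewrite (Rintegral_FTC2 (F := fun y => smoothstep e (y - a)) _ _ _ (fun x _ => derive1_shift_smoothstep e a x)).
- by rewrite smoothstep_ge1 ?smoothstep_le0 ?subr0//; lra.
- by rewrite lerDl ltW.
- apply: continuous_subspaceT; exact: (continuous_shiftB (@continuous_hat e)).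
- apply: continuous_subspaceT => x; apply: differentiable_continuous.
  apply/derivable1_diffP.
  exact: (@ex_derive _ _ _ _ _ _ _ (derive1_shift_smoothstep e a x)).
Qed.

End calculus.

Section weak_derivatives.
Context {R : realType}.
Implicit Types (a b e x : R) (h g : R -> R).
Notation mu := (@lebesgue_measure R).

Lemma Rintegral_restrict_sub (D E : set R) h : measurable D -> measurable E ->
  E `<=` D -> (forall x, D x -> ~ E x -> h x = 0) ->
  \int[mu]_(x in D) h x = \int[mu]_(x in E) h x.
Proof.
move=> mD mE ED h0; rewrite Rintegral_mkcond [RHS]Rintegral_mkcond.
apply: eq_Rintegral => x _; rewrite /patch.
case: ifPn => [/set_mem Dx|/negP Dx]; case: ifPn => [/set_mem Ex|/negP Ex] //.
  by apply: h0 => // Ex'; apply: Ex; rewrite inE.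
by exfalso; apply: Dx; rewrite inE; exact: ED.
Qed.

Lemma near_infty_natSinv_lt_pos e : 0 < e -> \forall n \near \oo, n.+1%:R^-1 < e.
Proof. by move=> e0; exact: near_infty_natSinv_lt (PosNum e0). Qed.

Lemma L1loc_integrable h a b : L1loc h -> 0 <= a ->
  mu.-integrable `[a, b] (EFin \o h).
Proof.
move=> Lh a0; have [ab|ab] := leP a b.
  apply: (@integrableS _ _ _ mu `[0, b]) => //.
    by apply: subset_itv; rewrite bnd_simp.
  by apply: Lh; exact: le_trans ab.
by rewrite set_itv_ge ?bnd_simp -?ltNge//; exact: integrable_set0.
Qed.

Lemma Rintegral_hat_cvg h a : 0 < a -> L1loc h -> {for a, continuous h} ->
  (fun n => \int[mu]_(x in `]0%R, +oo[) (h x * hat n.+1%:R^-1 (x - a))) @ \oo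
    --> h a.
Proof.
move=> a0 Lh ch; apply/cvgrPdist_le => eps eps0.
have /cvgrPdist_le/(_ _ eps0)[d /= d0 hd] := ch.
near=> n.
have ed' : n.+1%:R^-1 < d by near: n; exact: near_infty_natSinv_lt (PosNum d0).
set e : R := n.+1%:R^-1; have ed : e < d by exact: ed'.
have e0 : 0 < e by rewrite invr_gt0.
rewrite (@Rintegral_restrict_sub _ `[a, a + e])//; last first.
- move=> x _ /= xae; rewrite hat_eq0 ?mulr0//; apply/negP; rewrite in_itv/= => H.
  by apply: xae; rewrite in_itv/=; lra.
- by move=> x /=; rewrite !in_itv/= andbT; lra.
have ae : a <= a + e by rewrite lerDl ltW.
have chat : {within `[a, a + e], continuous (fun x => hat e (x - a))}.
  by apply: continuous_subspaceT; exact: (continuous_shiftB (@continuous_hat _ e)).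
have ihat : mu.-integrable `[a, a + e] (EFin \o (fun x => hat e (x - a))).
  by apply: continuous_compact_integrable => //; exact: segment_compact.
have [M hM] : exists M : R, forall x, x \in `[a, a + e] -> `|hat e (x - a)| <= M.
  have [c _ hc] := EVT_max ae chat; exists (hat e (c - a)) => x xa.
  by rewrite ger0_norm ?hat_ge0//; exact: hc.
have ih : mu.-integrable `[a, a + e] (EFin \o (fun x => h x * hat e (x - a))).
  apply: (@integrable_mul_bounded _ _ _ mu _ h _ M) => //.
  - by apply: L1loc_integrable => //; exact: ltW.
  - exact: integrable_measurable ihat.
rewrite -[X in X - _]mulr1 -(@Rintegral_hat _ e a e0) -RintegralZl// -RintegralB//; last first.
  exact: integrable_scale.
have idif : mu.-integrable `[a, a + e] (EFin \o (fun x => h a * hat e (x - a) - h x * hat e (x - a))).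
  by apply: integrable_sub => //; exact: integrable_scale.
apply: (le_trans (le_normr_Rintegral _ idif)) => //.
rewrite -[leRHS]mulr1 -(@Rintegral_hat _ e a e0) -RintegralZl//.
apply: le_Rintegral => //.
- exact: (@integrable_norm _ _ _ mu _ (fun x => _ - _)).
- exact: integrable_scale.
- move=> x /=; rewrite in_itv/= => /andP[ax xe].
  rewrite -mulrBl normrM (ger0_norm (hat_ge0 _ e0)) ler_wpM2r ?hat_ge0//.
  apply: hd; rewrite /ball_/= ler0_norm ?subr_le0// opprB ltrBlDl (le_lt_trans xe)// ltrD2l.
Unshelve. all: by end_near. Qed.

Lemma Rintegral_plateau_cvg g a b : 0 < a -> a <= b -> L1loc g ->
  (fun n => \int[mu]_(x in `]0%R, +oo[) (g x * plateau n.+1%:R^-1 a b x)) @ \oo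
    --> \int[mu]_(x in `[a, b]) g x.
Proof.
move=> a0 ab Lg.
have b0 : 0 < b by exact: lt_le_trans ab.
have D n : \int[mu]_(x in `]0%R, +oo[) (g x * plateau n.+1%:R^-1 a b x) =
    \int[mu]_(x in `[a, b + 1]) (g x * plateau n.+1%:R^-1 a b x).
  set e : R := n.+1%:R^-1; have e0 : 0 < e by rewrite invr_gt0.
  have e1 : e <= 1 by rewrite invf_le1// ler1n.
  rewrite (@Rintegral_restrict_sub _ `[a, b + 1])//.
  - by move=> x /=; rewrite !in_itv/= andbT; lra.
  - move=> x _ /= xae; rewrite plateau_eq0 ?mulr0//; apply/negP.
    by rewrite in_itv/= => H; apply: xae; rewrite /= in_itv/=; lra.
under eq_fun do rewrite D.
have -> : \int[mu]_(x in `[a, b]) g x = \int[mu]_(x in `[a, b + 1]) (g \_ `[a, b]) x.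
  rewrite -Rintegral_mkcondr; congr Rintegral.
  by rewrite setIidr// => x /=; rewrite !in_itv/=; lra.
have ig : mu.-integrable `[a, b + 1] (EFin \o g).
  by apply: L1loc_integrable => //; exact: ltW.
have mg : measurable_fun `[a, b + 1] g by exact: integrable_measurable ig.
have cp n : continuous (plateau n.+1%:R^-1 a b).
  move=> x; apply: differentiable_continuous; apply/derivable1_diffP.
  exact: (@ex_derive _ _ _ _ _ _ _ (is_derive_plateau _ a b x)).
apply: (proj2 (@Rintegral_dominated _ _ _ mu _ _ _ (fun x => `|g x|) _ _ _ _ _ _)) => //.
- move=> n; apply: measurable_funM => //.
  by apply: measurable_funTS; exact: continuous_measurable_fun.
- apply/measurable_restrict => //.
  by apply: measurable_funS mg => // x [].
(* At [x = a] every plateau is 0 while the indicator of [[a, b]] is 1; everywhere else the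
   convergence holds. *)
- exists [set a]; split; [exact: measurable_set1|exact: lebesgue_measure_set1|].
  move=> x /=; apply: contra_notP => /eqP xa; rewrite in_itv/= => /andP[ax xb1].
  have {}ax : a < x by rewrite lt_neqAle ax eq_sym xa.
  rewrite patchE; have [xb|xb] := leP x b.
    rewrite mem_set; last by rewrite /= in_itv/= (ltW ax) xb.
    rewrite -[X in _ --> X]mulr1; apply: cvgM; first exact: cvg_cst.
    apply: cvg_near_cst; near=> n; apply: plateau_eq1 => //.
    rewrite -lerBrDl ltW//.
    by near: n; apply: near_infty_natSinv_lt_pos; rewrite subr_gt0.
  rewrite memNset; last by rewrite /= in_itv/= (leNgt x b) xb andbF.
  rewrite -[point]/(0 : R) -[X in _ --> X](mulr0 (g x)); apply: cvgM; first exact: cvg_cst.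
  apply: cvg_near_cst; near=> n; apply: plateau_eq0 => //.
  rewrite in_itv/= negb_and -!ltNge; apply/orP; right.
  rewrite -ltrBrDl.
  by near: n; apply: near_infty_natSinv_lt_pos; rewrite subr_gt0.
- exact: (@integrable_norm _ _ _ mu _ g).
- move=> n x _; rewrite normrM ler_piMr//.
  by apply: plateau_norm_le1; rewrite invr_gt0.
Unshelve. all: by end_near. Qed.

(** Testing against ever steeper plateaus: the two tents concentrate at [a] and [b] and give
    [h a - h b] by continuity, while the plateaus tend to the indicator of [[a, b]]. Supports of
    test functions stay away from 0, hence the condition [0 < a]. *)
Lemma weak_derivative_FTC h g a b : L1loc h -> {within `[0, +oo[, continuous h} ->
  is_weak_derivative h g -> 0 < a -> a <= b ->
  h b - h a = \int[mu]_(x in `[a, b]) g x.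
Proof.
move=> Lh ch [Lg wg] a0 ab.
have b0 : 0 < b by exact: lt_le_trans ab.
have cc c : 0 < c -> {for c, continuous h}.
  move=> c0; move/continuous_within_itvcyP : ch => [ch _]; apply: ch.
  by rewrite in_itv/= c0.
have H1 := Rintegral_hat_cvg a0 Lh (cc _ a0).
have H2 := Rintegral_hat_cvg b0 Lh (cc _ b0).
have H3 := Rintegral_plateau_cvg a0 ab Lg.
have ihat n c : 0 < c -> mu.-integrable `]0, +oo[ (EFin \o (fun x => h x * hat n.+1%:R^-1 (x - c))).
  move=> c0; set e : R := n.+1%:R^-1; have e0 : 0 < e by rewrite invr_gt0.
  have -> : (fun x => h x * hat e (x - c)) = (fun x => h x * hat e (x - c)) \_ `[c, c + e].
    apply/funext => x; rewrite patchE; case: ifPn => // /negP; rewrite inE/= => xc.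
    rewrite hat_eq0 ?mulr0//; apply/negP; rewrite in_itv/= => H.
    by apply: xc; rewrite in_itv/=; lra.
  rewrite -restrict_EFin; apply/integrable_restrict => //.
  rewrite setIidr; last by move=> x /=; rewrite !in_itv/= andbT; lra.
  have ce : c <= c + e by rewrite lerDl ltW.
  have chat : {within `[c, c + e], continuous (fun x => hat e (x - c))}.
    by apply: continuous_subspaceT; exact: (continuous_shiftB (@continuous_hat _ e)).
  have [M hM] : exists M : R, forall x, x \in `[c, c + e] -> `|hat e (x - c)| <= M.
    have [y _ hy] := EVT_max ce chat; exists (hat e (y - c)) => x xa.
    by rewrite ger0_norm ?hat_ge0//; exact: hy.
  apply: (@integrable_mul_bounded _ _ _ mu _ h _ M) => //.
  - by apply: L1loc_integrable => //; exact: ltW.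
  - apply: (@integrable_measurable _ _ _ mu).
    by apply: continuous_compact_integrable => //; exact: segment_compact.
have E n : \int[mu]_(x in `]0%R, +oo[) (g x * plateau n.+1%:R^-1 a b x) =
    \int[mu]_(x in `]0%R, +oo[) (h x * hat n.+1%:R^-1 (x - b)) -
    \int[mu]_(x in `]0%R, +oo[) (h x * hat n.+1%:R^-1 (x - a)).
  have e0 : 0 < n.+1%:R^-1 :> R by rewrite invr_gt0.
  have := wg _ (test_function_plateau e0 a0 ab).
  rewrite derive1_plateau => /eqP; rewrite -eqr_oppLR => /eqP <-.
  under eq_Rintegral do rewrite mulrBr.
  rewrite RintegralB//; [ring|exact: ihat|exact: ihat].
have E' : (fun n => \int[mu]_(x in `]0%R, +oo[) (g x * plateau n.+1%:R^-1 a b x)) @ \oo --> h b - h a.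
  by under eq_fun do rewrite E; exact: cvgB.
exact: (cvg_unique _ E' H3).
Qed.

End weak_derivatives.

(** * Translations and local integrability *)

Definition translate {R : realType} (s x : measurableTypeR R) : measurableTypeR R :=
  (s : R) + (x : R).

Lemma measurable_translate {R : realType} (s : measurableTypeR R) :
  measurable_fun [set: measurableTypeR R] (translate s).
Proof. by apply: measurable_funD => //; exact: measurable_cst. Qed.

HB.instance Definition _ (R : realType) (s : measurableTypeR R) :=
  isMeasurableFun.Build _ _ _ _ (translate s) (measurable_translate s).

Section translation_invariance.
Context {R : realType}.
Implicit Types (s x : R) (D : set R) (f : R -> R).
Notation mu := (@lebesgue_measure R).

Lemma lebesgue_measure_translate s (A : set (measurableTypeR R)) : measurable A ->
  pushforward mu (translate s : _ -> measurableTypeR R) A = mu A.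
Proof.
move=> mA; apply/esym/lebesgue_measure_unique => //= _ [[a b]] _ <-.
have -> : pushforward mu (translate s) `]a, b]%classic = mu `]a - s, b - s]%classic.
  rewrite /pushforward; congr (mu _); apply/seteqP; split => x /=;
    by rewrite /translate !in_itv/= => /andP[? ?]; apply/andP; split; lra.
rewrite /= !lebesgue_measure_itv/= !lte_fin ltrD2r; case: ifPn => // _.
by rewrite -!EFinB; congr EFin; ring.
Qed.

Lemma ge0_integral_translate s D (f : R -> \bar R) : measurable D ->
  measurable_fun D f -> (forall x, D x -> 0 <= f x)%E ->
  (\int[mu]_(x in D) f x = \int[mu]_(x in translate s @^-1` D) f (s + x)%R)%E.
Proof.
move=> mD mf f0.
have := @ge0_integral_pushforward _ _ _ _ R _ (measurable_translate s) mu D f mD mf.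
move=> <-; last by move=> y /set_mem; exact: f0.
apply: eq_measure_integral => //= A mA AS.
by first [exact: lebesgue_measure_translate|exact/esym/lebesgue_measure_translate].
Qed.

Lemma integrable_translate s D f : measurable D ->
  mu.-integrable D (EFin \o f) ->
  mu.-integrable (translate s @^-1` D) (EFin \o (fun x => f (s + x))).
Proof.
move=> mD fi; have mf := integrable_measurable fi.
have mD' : measurable (translate s @^-1` D).
  by rewrite -[X in measurable X]setTI; exact: measurable_translate.
apply/integrableP; split.
  apply/measurable_EFinP.
  apply: (@measurable_comp _ _ _ _ _ _ D f _ (translate s)) => //.
    by move=> _ [x ? <-].
  by apply: measurable_funTS; exact: measurable_translate.
move/integrableP : fi => [mfE]; apply: le_lt_trans.
rewrite [leRHS](@ge0_integral_translate s)//.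
exact: measurableT_comp.
Qed.

Lemma Rintegral_translate s D f : measurable D -> mu.-integrable D (EFin \o f) ->
  \int[mu]_(x in D) f x = \int[mu]_(x in translate s @^-1` D) f (s + x).
Proof.
move=> mD fi; have mf := integrable_measurable fi.
have mfE : measurable_fun D (EFin \o f) by exact/measurable_EFinP.
rewrite /Rintegral; congr fine; rewrite integralE [RHS]integralE; congr (_ - _)%E.
  rewrite (@ge0_integral_translate s D ((fun x : R => (f x)%:E)^\+)%E)//; first by apply: eq_integral => x _; rewrite !funeposE.
  exact: (measurable_funepos mfE).
rewrite (@ge0_integral_translate s D ((fun x : R => (f x)%:E)^\-)%E)//; first by apply: eq_integral => x _; rewrite !funenegE.
exact: (measurable_funeneg mfE).
Qed.

Lemma translate_preimage_itv s a b :
  translate s @^-1` `[s + a, s + b] = `[a, b]%classic.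
Proof. by apply/seteqP; split => x /=; rewrite /translate !in_itv/= !lerD2l. Qed.

Lemma integrable_translate_itv s a b f :
  mu.-integrable `[s + a, s + b] (EFin \o f) ->
  mu.-integrable `[a, b] (EFin \o (fun x => f (s + x))).
Proof. by move=> fi; rewrite -(translate_preimage_itv s); exact: integrable_translate. Qed.

Lemma Rintegral_translate_itv s a b f :
  mu.-integrable `[s + a, s + b] (EFin \o f) ->
  \int[mu]_(x in `[s + a, s + b]) f x = \int[mu]_(x in `[a, b]) f (s + x).
Proof. by move=> fi; rewrite (@Rintegral_translate s)// translate_preimage_itv. Qed.

End translation_invariance.

Section local_integrability.
Context {R : realType}.
Implicit Types (s a b x : R) (f g h : R -> R).
Notation mu := (@lebesgue_measure R).

Lemma ae_imp (P Q : R -> Prop) : (forall x, P x -> Q x) ->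
  {ae mu, forall x, P x} -> {ae mu, forall x, Q x}.
Proof. by move=> PQ; apply: filterS => //; exact: (ae_filter_ringOfSetsType mu). Qed.

Lemma ae_imp2 (P Q S : R -> Prop) : (forall x, P x -> Q x -> S x) ->
  {ae mu, forall x, P x} -> {ae mu, forall x, Q x} -> {ae mu, forall x, S x}.
Proof. by move=> PQ; apply: filterS2 => //; exact: (ae_filter_ringOfSetsType mu). Qed.

Lemma integrable_cst_itv a b (c : R) : mu.-integrable `[a, b] (EFin \o (fun=> c)).
Proof.
apply: continuous_compact_integrable; first exact: segment_compact.
by apply: continuous_subspaceT => ?; exact: cvg_cst.
Qed.

Lemma Rintegral_cst_itv a b (c : R) : a <= b -> \int[mu]_(x in `[a, b]) c = c * (b - a).
Proof.
move=> ab; have D x : is_derive x 1 (fun x => c * x) c.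
  by apply: is_derive_eq; rewrite /GRing.scale/= mulr1.
rewrite (Rintegral_FTC2 (F := fun x => c * x) _ _ _ (fun x _ => D x))//; first by ring.
- by apply: continuous_subspaceT => ?; exact: cvg_cst.
- by apply: continuous_subspaceT => x; apply: cvgM; [exact: cvg_cst|exact: cvg_id].
Qed.

Lemma L1loc_lin a b f g : L1loc f -> L1loc g -> L1loc (fun x => a * f x + b * g x).
Proof. by move=> Lf Lg c c0; apply: integrable_lin => //; [exact: Lf|exact: Lg]. Qed.

Lemma L1loc_shift s f : 0 <= s -> L1loc f -> L1loc (right_shift s f).
Proof.
move=> s0 Lf b b0; apply: (@integrable_translate_itv _ s 0 b f).
by apply: L1loc_integrable; rewrite ?addr0.
Qed.

Lemma L1loc_measurable f : L1loc f -> measurable_fun (`[0%R, +oo[%classic : set R) f.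
Proof.
move=> Lf; have -> : (`[0%R, +oo[%classic : set R) = \bigcup_n `[0, n%:R : R]%classic.
  apply/seteqP; split => x /=; rewrite in_itv/= ?andbT.
    move=> x0; exists (Num.truncn x).+1 => //=.
    by rewrite in_itv/= x0/= ltW// truncnS_gt.
  by move=> [n _]; rewrite /= in_itv/= => /andP[].
apply/measurable_fun_bigcup => // n.
by apply: (@integrable_measurable _ _ _ mu); apply: Lf; rewrite ler0n.
Qed.

Lemma L1loc_continuous f : {within `[0, +oo[, continuous f} -> L1loc f.
Proof.
move=> cf b b0; apply: continuous_compact_integrable; first exact: segment_compact.
by apply: continuous_subspaceW cf; apply: subset_itvl; rewrite bnd_simp.
Qed.

(* The integral function of f vanishes identically, so by Lebesgue's
   differentiation theorem its derivative f vanishes almost everywhere. *)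
Lemma L1loc_ae_eq0 f : L1loc f ->
  (forall b, 0 <= b -> \int[mu]_(x in `[0, b]) f x = 0) ->
  {ae mu, forall x, 0 <= x -> f x = 0}.
Proof.
move=> Lf F0.
suff H : {ae mu, forall x (n : nat), 0 < x -> x < n%:R -> f x = 0}.
  have H0 : {ae mu, forall x, x != 0}.
    exists [set 0]; split; [exact: measurable_set1|exact: lebesgue_measure_set1|].
    by move=> x /= /negP; rewrite negbK => /eqP.
  apply: ae_imp2 H H0 => x H /eqP x0 xge0.
  apply: (H (Num.truncn x).+1); last exact: truncnS_gt.
  by rewrite lt_neqAle xge0 andbT eq_sym; exact/eqP.
apply: ae_foralln => n.
have mn : measurable (`[0, n%:R : R]%classic : set R) by [].
have ifn : mu.-integrable `[0, n%:R] (EFin \o f) by apply: Lf.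
have ifnT : mu.-integrable setT (EFin \o (f \_ `[0, n%:R])).
  by rewrite -restrict_EFin; apply/integrable_restrict => //; rewrite setTI.
have := @FTC1 R (f \_ `[0, n%:R]) (BLeft 0)  _ (integrable_locally mn ifn).
have iy y : mu.-integrable `[0, y] (EFin \o (f \_ `[0, n%:R])).
  exact: (@integrableS _ _ _ mu setT).
move=> /(_ iy).
apply: ae_imp => x Hx x0 xn.
have [] := Hx.
  by first [exact: x0|exact: (ltW x0)|rewrite bnd_simp ltW|rewrite ltBSide/= ltW|rewrite lteBSide/= ltW|rewrite /Order.lt/= ltW].
move=> _; rewrite patchE mem_set; last by rewrite /= in_itv/= !ltW.
move=> <-; rewrite derive1E.
rewrite (@near_eq_derive _ _ _ _ (cst 0)); first exact: derive_cst.
near=> y.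
have y0 : 0 < y by near: y; exact: lt_nbhsr.
have yn : y < n%:R by near: y; exact: lt_nbhsl.
rewrite /= -Rintegral_mkcondr setIidl; first by rewrite F0// ltW.
by move=> z /=; rewrite !in_itv/= => /andP[-> zy]/=; rewrite ltW// (le_lt_trans zy).
Unshelve. all: by end_near. Qed.

Lemma L1loc_ae_eq f g : L1loc f -> L1loc g ->
  (forall b, 0 <= b -> \int[mu]_(x in `[0, b]) f x = \int[mu]_(x in `[0, b]) g x) ->
  {ae mu, forall x, 0 <= x -> f x = g x}.
Proof.
move=> Lf Lg fg.
have H b : 0 <= b -> \int[mu]_(x in `[0, b]) (1 * f x + (-1) * g x) = 0.
  by move=> b0; rewrite Rintegral_lin ?fg//; [ring|exact: Lf|exact: Lg].
have := L1loc_ae_eq0 (L1loc_lin _ _ Lf Lg) H.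
apply: ae_imp => x {}H x0.
by have := H x0; rewrite mul1r mulN1r => /eqP; rewrite subr_eq0 => /eqP.
Qed.

End local_integrability.

(** * The space of forward curves *)

Lemma discriminant_le0 (R : realFieldType) (A B C : R) : 0 <= C ->
  (forall t, 0 <= A - 2 * t * B + t ^+ 2 * C) -> B ^+ 2 <= A * C.
Proof.
rewrite le_eqVlt => /predU1P[<-|C0] Q.
  rewrite mulr0; have [->|B0] := eqVneq B 0; first by rewrite expr0n.
  (* With [C = 0] the form is affine in [t]; at this point it takes the value [-1]. *)
  have := Q ((A + 1) / (2 * B)); rewrite mulr0 addr0.
  have -> : 2 * ((A + 1) / (2 * B)) * B = A + 1 by field.
  lra.
have := Q (B / C).
have -> : A - 2 * (B / C) * B + (B / C) ^+ 2 * C = (A * C - B ^+ 2) / C.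
  by field; rewrite gt_eqF.
by rewrite pmulr_lge0 ?invr_gt0// subr_ge0.
Qed.

Section weighted_space.
Context {R : realType} (w : R -> R) (hw : admissible_weight w).
Implicit Types (s a b x : R) (f g h k : R -> R).
Notation mu := (@lebesgue_measure R).
Notation Rp := (`[0%R, +oo[%classic : set R).

Lemma weight_ge1 x : 0 <= x -> 1 <= w x. Proof. by case: hw => + _ _ _ _; exact. Qed.

Lemma weight_ge0 x : 0 <= x -> 0 <= w x.
Proof. by move=> /weight_ge1; apply: le_trans. Qed.

Lemma weight_nondecreasing x y : 0 <= x -> x <= y -> w x <= w y.
Proof. by case: hw => _ + _ _ _; exact. Qed.

Lemma measurable_weight : measurable_fun Rp w.
Proof.
by case: hw => _ _ cw _ _; apply: subspace_continuous_measurable_fun.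
Qed.

Lemma wderivP h : spaceE w h -> is_weak_derivative h (wderiv h).
Proof. by case=> _ _ [g hg] _; rewrite /wderiv; exact: (xgetPex _ (ex_intro _ g hg)). Qed.

Lemma spaceE_L1loc h : spaceE w h -> L1loc h. Proof. by case. Qed.

Lemma wderiv_L1loc h : spaceE w h -> L1loc (wderiv h).
Proof. by move=> /wderivP[]. Qed.

Lemma measurable_wderiv h : spaceE w h -> measurable_fun Rp (wderiv h).
Proof. by move=> Eh; apply: L1loc_measurable; exact: wderiv_L1loc. Qed.

Lemma spaceE_continuous h : spaceE w h -> {within Rp, continuous h}.
Proof. by case. Qed.

Lemma spaceE_sq_integrable h : spaceE w h ->
  mu.-integrable Rp (EFin \o (fun x => wderiv h x ^+ 2 * w x)).
Proof.
move=> Eh; have mh := measurable_wderiv Eh.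
apply/integrableP; split.
  apply/measurable_EFinP; apply: measurable_funM; last exact: measurable_weight.
  by apply: measurable_funX.
case: Eh => _ _ _ H.
have : (\int[mu]_(x in Rp) (`|wderiv h x| ^+ 2 * w x)%:E < +oo)%E.
  by apply: le_lt_trans H; rewrite leeDr// lee_fin sqr_ge0.
apply: le_lt_trans; apply: ge0_le_integral_nonmeas => // x /=; rewrite in_itv/= andbT => x0.
rewrite lee_fin normrM (ger0_norm (weight_ge0 x0)) normrX.
exact: lexx.
Qed.

(** The endpoint 0 is out of reach of test functions. It is recovered as a limit of the points
    [b / n.+1], by continuity of [h] up to 0 and integrability of [g] near 0. *)
Lemma weak_derivative_FTC0 h g a b : L1loc h -> {within Rp, continuous h} ->
  is_weak_derivative h g -> 0 <= a -> a <= b ->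
  h b - h a = \int[mu]_(x in `[a, b]) g x.
Proof.
move=> Lh ch wdh.
rewrite le_eqVlt => /predU1P[<-|a0] ab; last exact: weak_derivative_FTC.
move: ab; rewrite le_eqVlt => /predU1P[<-|b0].
  by rewrite set_itv1 Rintegral_set1 subrr.
have Lg : L1loc g by case: wdh.
have ig : mu.-integrable `[0, b] (EFin \o g) by apply: Lg; exact: ltW.
have [ch0 ch1] : {in `]0, +oo[, continuous h} /\ h x @[x --> 0^'+] --> h 0.
  by move/continuous_within_itvcyP : ch => [].
pose u n : R := b * n.+1%:R^-1.
have u0 n : 0 < u n by rewrite mulr_gt0.
have ub n : u n <= b by rewrite ger_pMr// invf_le1// ler1n.
have ucvg : u @ \oo --> (0 : R).
  rewrite -[X in _ --> X](mulr0 b); apply: cvgM; first exact: cvg_cst.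
  exact: cvg_harmonic.
have H1 : (fun n => h b - h (u n)) @ \oo --> h b - h 0.
  apply: cvgB; first exact: cvg_cst.
  by move/cvg_at_rightP : ch1; apply; split.
have H2 : (fun n => \int[mu]_(x in `[0, b]) (g \_ `[u n, b]) x) @ \oo --> \int[mu]_(x in `[0, b]) g x.
  apply: (proj2 (@Rintegral_dominated _ _ _ mu _ _ _ (fun x => `|g x|) _ _ _ _ _ _)) => //.
  - move=> n; apply/measurable_restrict => //.
    by apply: measurable_funS (integrable_measurable ig) => // x [].
  - exact: integrable_measurable ig.
  - exists [set 0]; split; [exact: measurable_set1|exact: lebesgue_measure_set1|].
    move=> x /=; apply: contra_notP => /eqP x0; rewrite in_itv/= => /andP[xge0 xb].
    apply: cvg_near_cst; near=> n; rewrite patchE mem_set//= in_itv/= xb andbT ltW//.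
    near: n; have x0' : 0 < x by rewrite lt_neqAle eq_sym x0.
    have /cvgrPdist_lt/(_ _ x0') := ucvg; apply: filterS => n.
    by rewrite sub0r normrN gtr0_norm.
  - exact: (@integrable_norm _ _ _ mu _ g).
  - by move=> n x _; rewrite patchE; case: ifPn => // _; rewrite normr0.
have E n : h b - h (u n) = \int[mu]_(x in `[0, b]) (g \_ `[u n, b]) x.
  rewrite (weak_derivative_FTC Lh ch wdh (u0 n) (ub n)) -Rintegral_mkcondr setIidr//.
  by apply: subset_itvr; rewrite bnd_simp ltW.
have H3 : (fun n => h b - h (u n)) @ \oo --> \int[mu]_(x in `[0, b]) g x.
  by under eq_fun do rewrite E.
exact: (cvg_unique _ H1 H3).
Unshelve. all: by end_near. Qed.

Lemma spaceE_FTC h a b : spaceE w h -> 0 <= a -> a <= b ->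
  h b - h a = \int[mu]_(x in `[a, b]) wderiv h x.
Proof.
by move=> Eh; apply: weak_derivative_FTC0;
  [exact: spaceE_L1loc|exact: spaceE_continuous|exact: wderivP].
Qed.

(** [wderiv] is an arbitrary choice within a class modulo null sets. This identifies it almost
    everywhere with any explicit candidate that has the right primitive. *)
Lemma wderiv_unique h g : spaceE w h -> L1loc g ->
  (forall b, 0 <= b -> h b - h 0 = \int[mu]_(x in `[0, b]) g x) ->
  {ae mu, forall x, 0 <= x -> wderiv h x = g x}.
Proof.
move=> Eh Lg H; apply: L1loc_ae_eq => //; first exact: wderiv_L1loc.
by move=> b b0; rewrite -H// -spaceE_FTC.
Qed.

Lemma integrable_test h phi : L1loc h -> continuous phi ->
  (exists a b, 0 < a /\ forall x, x \notin `[a, b] -> phi x = 0) ->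
  mu.-integrable `]0, +oo[ (EFin \o (fun x => h x * phi x)).
Proof.
move=> Lh cphi [a [b [a0 phi0]]].
have -> : (fun x => h x * phi x) = (fun x => h x * phi x) \_ `[a, b].
  apply/funext => x; rewrite patchE; case: ifPn => // /negP; rewrite inE/= => xc.
  by rewrite phi0 ?mulr0//; apply/negP.
rewrite -restrict_EFin; apply/integrable_restrict => //.
rewrite setIidr; last by move=> x /=; rewrite !in_itv/= andbT => /andP[ax _]; exact: lt_le_trans ax.
have [ab|ab] := leP a b; last by rewrite set_itv_ge ?bnd_simp -?ltNge//; exact: integrable_set0.
have [M hM] : exists M : R, forall x, x \in `[a, b] -> `|phi x| <= M.
  have cn : {within `[a, b], continuous (fun x => `|phi x|)}.
    by apply: continuous_subspaceT => x; apply: cvg_norm; exact: cphi.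
  by have [y _ hy] := EVT_max ab cn; exists `|phi y|.
apply: (@integrable_mul_bounded _ _ _ mu _ h _ M) => //.
- by apply: L1loc_integrable => //; exact: ltW.
- by apply: measurable_funTS; exact: continuous_measurable_fun.
Qed.

Lemma test_function_derive1 phi : test_function phi ->
  exists a b, 0 < a /\ forall x, x \notin `[a, b] -> derive1 phi x = 0.
Proof.
move=> [dphi _ [a [b [a0 phi0]]]]; exists a, b; split=> // x xab.
rewrite derive1E (@near_eq_derive _ _ _ _ (cst 0)); first exact: derive_cst.
move: xab; rewrite in_itv/= negb_and -!ltNge => /orP[xa|bx].
  near=> y; rewrite phi0// in_itv/= negb_and -!ltNge; apply/orP; left.
  by near: y; exact: lt_nbhsl.
near=> y; rewrite phi0// in_itv/= negb_and -!ltNge; apply/orP; right.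
by near: y; exact: lt_nbhsr.
Unshelve. all: by end_near. Qed.

Lemma is_weak_derivative_lin a b h1 h2 g1 g2 : L1loc h1 -> L1loc h2 ->
  is_weak_derivative h1 g1 -> is_weak_derivative h2 g2 ->
  is_weak_derivative (fun x => a * h1 x + b * h2 x) (fun x => a * g1 x + b * g2 x).
Proof.
move=> L1 L2 [Lg1 w1] [Lg2 w2]; split; first exact: L1loc_lin.
move=> phi tphi; have := test_function_derive1 tphi; case: (tphi) => dphi cphi ab ab'.
have cp : continuous phi.
  by move=> x; apply: differentiable_continuous; apply/derivable1_diffP.
transitivity (\int[mu]_(x in `]0%R, +oo[) (a * (h1 x * derive1 phi x) + b * (h2 x * derive1 phi x))).
  by apply: eq_Rintegral => x _; ring.
rewrite Rintegral_lin//; [|exact: integrable_test|exact: integrable_test].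
rewrite w1// w2//.
transitivity (- \int[mu]_(x in `]0%R, +oo[) (a * (g1 x * phi x) + b * (g2 x * phi x))).
  by rewrite Rintegral_lin//; [ring|exact: integrable_test|exact: integrable_test].
by congr (- _); apply: eq_Rintegral => x _; ring.
Qed.

Lemma wderiv_lin a b h1 h2 : spaceE w h1 -> spaceE w h2 ->
  is_weak_derivative (fun x => a * h1 x + b * h2 x) (wderiv (fun x => a * h1 x + b * h2 x)) /\
  {ae mu, forall x, 0 <= x ->
    wderiv (fun x => a * h1 x + b * h2 x) x = a * wderiv h1 x + b * wderiv h2 x}.
Proof.
move=> E1 E2; pose h x := a * h1 x + b * h2 x.
have Lh : L1loc h by apply: L1loc_lin; exact: spaceE_L1loc.
have wd := is_weak_derivative_lin a b (spaceE_L1loc E1) (spaceE_L1loc E2) (wderivP E1) (wderivP E2).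
have wd' : is_weak_derivative h (wderiv h).
  by rewrite /wderiv; exact: (xgetPex _ (ex_intro _ _ wd)).
have ch : {within Rp, continuous h}.
  by move=> x; apply: cvgD; apply: cvgM; (try exact: cvg_cst); exact: spaceE_continuous.
split => //; apply: L1loc_ae_eq; [by case: wd'|by case: wd|move=> c c0].
by rewrite -(weak_derivative_FTC0 Lh ch wd')// -(weak_derivative_FTC0 Lh ch wd).
Qed.

Lemma spaceE_of_square_integrable h : L1loc h -> {within Rp, continuous h} ->
  is_weak_derivative h (wderiv h) ->
  mu.-integrable Rp (EFin \o (fun x => wderiv h x ^+ 2 * w x)) -> spaceE w h.
Proof.
move=> Lh ch wh /integrableP[_ ih]; split => //; first by exists (wderiv h).
apply: lte_add_pinfty; first by rewrite ltry.
apply: le_lt_trans ih; apply: ge0_le_integral_nonmeas => x /=; rewrite in_itv/= andbT => x0.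
  by rewrite lee_fin mulr_ge0 ?sqr_ge0// weight_ge0.
by rewrite lee_fin normrM (ger0_norm (weight_ge0 x0)) normrX.
Qed.

Lemma wderiv_mul_integrable h k : spaceE w h -> spaceE w k ->
  mu.-integrable Rp (EFin \o (fun x => wderiv h x * wderiv k x * w x)).
Proof.
move=> Eh Ek.
apply: (@integrable_le _ _ _ mu _ _ (fun x => 2^-1 * (wderiv h x ^+ 2 * w x) + 2^-1 * (wderiv k x ^+ 2 * w x))) => //.
- apply: measurable_funM; last exact: measurable_weight.
  by apply: measurable_funM; exact: measurable_wderiv.
- move=> x /=; rewrite in_itv/= andbT => /weight_ge0 w0.
  have {}w0 : 0 <= w x by exact: le_trans w0.
  rewrite normrM (ger0_norm w0).
  have -> : 2^-1 * (wderiv h x ^+ 2 * w x) + 2^-1 * (wderiv k x ^+ 2 * w x) =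
    2^-1 * (wderiv h x ^+ 2 + wderiv k x ^+ 2) * w x by ring.
  rewrite ler_wpM2r// ler_norml.
  have := sqr_ge0 (wderiv h x - wderiv k x); have := sqr_ge0 (wderiv h x + wderiv k x).
  rewrite sqrrD sqrrB; lra.
- by apply: integrable_lin => //; exact: spaceE_sq_integrable.
Qed.

Lemma spaceE_lin a b h1 h2 : spaceE w h1 -> spaceE w h2 ->
  spaceE w (fun x => a * h1 x + b * h2 x).
Proof.
move=> E1 E2; have [wd aeq] := wderiv_lin a b E1 E2.
apply: spaceE_of_square_integrable => //.
- by apply: L1loc_lin; exact: spaceE_L1loc.
- by move=> x; apply: cvgD; apply: cvgM; (try exact: cvg_cst); exact: spaceE_continuous.
pose q x := a * a * (wderiv h1 x * wderiv h1 x * w x) + 1 * (2 * a * b * (wderiv h1 x * wderiv h2 x * w x) +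
   b * b * (wderiv h2 x * wderiv h2 x * w x)).
have iq : mu.-integrable Rp (EFin \o q).
  by do 2 (apply: integrable_lin => //; first exact: wderiv_mul_integrable); exact: wderiv_mul_integrable.
have mq : measurable_fun Rp q by exact: integrable_measurable iq.
have mw : measurable_fun Rp (wderiv (fun x => a * h1 x + b * h2 x)).
  by apply: L1loc_measurable; case: wd.
have mf : measurable_fun Rp (fun x => wderiv (fun x => a * h1 x + b * h2 x) x ^+ 2 * w x).
  by apply: measurable_funM; [exact: measurable_funX|exact: measurable_weight].
move/integrableP : iq => [mqE iq]; apply/integrableP; split; first exact/measurable_EFinP.
apply: le_lt_trans iq; rewrite le_eqVlt; apply/orP; left; apply/eqP.
apply: ge0_ae_eq_integral => //.
- by apply: measurableT_comp => //; exact/measurable_EFinP.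
- exact: measurableT_comp.
- apply: ae_imp aeq => x H; rewrite /= in_itv/= andbT => x0.
  by rewrite H// /q; congr (`| _%:E |)%E; ring.
Qed.

Lemma dotEC h k : dotE w h k = dotE w k h.
Proof.
rewrite /dotE (mulrC (h 0)).
suff -> : \int[mu]_(x in Rp) (wderiv h x * wderiv k x * w x) =
  \int[mu]_(x in Rp) (wderiv k x * wderiv h x * w x) by [].
by apply: eq_Rintegral => x _; rewrite (mulrC (wderiv h x)).
Qed.

Lemma dotE_lin a b h1 h2 k : spaceE w h1 -> spaceE w h2 -> spaceE w k ->
  dotE w (fun x => a * h1 x + b * h2 x) k = a * dotE w h1 k + b * dotE w h2 k.
Proof.
move=> E1 E2 Ek; have [wd aeq] := wderiv_lin a b E1 E2.
have E12 := spaceE_lin a b E1 E2.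
rewrite /dotE.
have -> : \int[mu]_(x in Rp) (wderiv (fun x => a * h1 x + b * h2 x) x * wderiv k x * w x) =
   a * \int[mu]_(x in Rp) (wderiv h1 x * wderiv k x * w x) +
   b * \int[mu]_(x in Rp) (wderiv h2 x * wderiv k x * w x).
  rewrite -Rintegral_lin//; [|exact: wderiv_mul_integrable|exact: wderiv_mul_integrable].
  rewrite /Rintegral; congr fine; apply: ae_eq_integral => //.
  - exact: (measurable_int mu (wderiv_mul_integrable E12 Ek)).
  - apply: (measurable_int mu); apply: (@integrable_lin _ _ _ mu) => //; exact: wderiv_mul_integrable.
  - apply: ae_imp aeq => x H; rewrite /= in_itv/= andbT => x0.
    by rewrite H//; congr EFin; ring.
by move: (\int[mu]_(x in Rp) _) (\int[mu]_(x in Rp) _) => A B; ring.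
Qed.

Lemma dotE_linr a b h1 h2 k : spaceE w h1 -> spaceE w h2 -> spaceE w k ->
  dotE w k (fun x => a * h1 x + b * h2 x) = a * dotE w k h1 + b * dotE w k h2.
Proof.
move=> E1 E2 Ek; rewrite dotEC (dotE_lin a b E1 E2 Ek).
by rewrite (dotEC h1) (dotEC h2).
Qed.

Lemma dotE_ge_sq h : 0 <= dotE w h h - h 0 ^+ 2.
Proof.
rewrite /dotE -expr2 addrAC subrr add0r; apply: Rintegral_ge0 => x /=.
by rewrite in_itv/= andbT => x0; rewrite -expr2 mulr_ge0 ?sqr_ge0// weight_ge0.
Qed.

Lemma dotE_ge0 h : 0 <= dotE w h h.
Proof. by have := dotE_ge_sq h; have := sqr_ge0 (h 0); lra. Qed.

Lemma dotE_ge_integral h :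
  \int[mu]_(x in Rp) (wderiv h x * wderiv h x * w x) <= dotE w h h.
Proof. by rewrite /dotE lerDr -expr2 sqr_ge0. Qed.

Lemma normE_ge0 h : 0 <= normE w h. Proof. exact: sqrtr_ge0. Qed.

Lemma normE_sqr h : normE w h ^+ 2 = dotE w h h.
Proof. by rewrite sqr_sqrtr// dotE_ge0. Qed.

Opaque dotE normE.

Lemma cauchy_schwarzE h k : spaceE w h -> spaceE w k ->
  `|dotE w h k| <= normE w h * normE w k.
Proof.
move=> Eh Ek; rewrite -ler_sqr ?nnegrE ?mulr_ge0 ?normE_ge0//.
have -> : (normE w h * normE w k) ^+ 2 = dotE w h h * dotE w k k.
  move: (normE_sqr h) (normE_sqr k).
  by move: (normE w h) (normE w k) => p q <- <-; ring.
have -> : `|dotE w h k| ^+ 2 = dotE w h k ^+ 2 by rewrite real_normK// num_real.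
have Q t : 0 <= dotE w h h - 2 * t * dotE w h k + t ^+ 2 * dotE w k k.
  have := dotE_ge0 (fun x => 1 * h x + (- t) * k x).
  have Ehk := spaceE_lin 1 (- t) Eh Ek.
  rewrite (dotE_lin 1 (- t) Eh Ek Ehk) (dotE_linr 1 (- t) Eh Ek Eh).
  rewrite (dotE_linr 1 (- t) Eh Ek Ek) (dotEC k h).
  by move: (dotE w h h) (dotE w h k) (dotE w k k) => A B C; lra.
by apply: discriminant_le0; rewrite ?dotE_ge0.
Qed.

(** Cauchy-Schwarz on [[0, x]] together with [w >= 1], obtained by integrating
    [|d| <= (l * d ^ 2 + 1 / l) / 2] and optimising over [l]. Sublinear growth is the only trace of
    the space E that later constrains the Nelson-Siegel curves. *)
Lemma spaceE_growth h x : spaceE w h -> 0 <= x -> `|h x - h 0| <= Num.sqrt x * normE w h.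
Proof.
move=> Eh x0; have Lg := wderiv_L1loc Eh; have ig := Lg x x0.
rewrite (@spaceE_FTC h 0 x)//; apply: (le_trans (le_normr_Rintegral _ ig)) => //.
set A := \int[mu]_(t in `[0, x]) _; pose N := normE w h.
have B l : 0 < l -> A <= (l * N ^+ 2 + x / l) / 2.
  move=> l0; rewrite normE_sqr.
  have iR : mu.-integrable Rp (EFin \o (fun x => wderiv h x * wderiv h x * w x)) by exact: wderiv_mul_integrable.
  have i1 : mu.-integrable `[0, x] (EFin \o (fun x => wderiv h x * wderiv h x * w x)).
    by apply: integrableS iR => //; apply: subset_itvl; rewrite bnd_simp.
  have i2 : mu.-integrable `[0, x] (EFin \o (fun=> l^-1)).
    apply: continuous_compact_integrable; first exact: segment_compact.
    by apply: continuous_subspaceT => ?; exact: cvg_cst.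
  apply: (@le_trans _ _ (\int[mu]_(t in `[0, x]) (l / 2 * (wderiv h t * wderiv h t * w t) + 2^-1 * l^-1))).
    apply: le_Rintegral => //; first exact: (@integrable_norm _ _ _ mu _ (wderiv h)).
      exact: integrable_lin.
    move=> t /=; rewrite in_itv/= => /andP[t0 _]; have w1 := weight_ge1 t0.
    set d := wderiv h t.
    have d1 : d * d <= d * d * w t by rewrite ler_peMr// -expr2 sqr_ge0.
    apply: (@le_trans _ _ (l / 2 * (d * d) + 2^-1 * l^-1)); last by rewrite lerD2r ler_wpM2l// divr_ge0// ltW.
    have := sqr_ge0 (l * `|d| - 1); have -> : d * d = `|d| ^+ 2 by rewrite -normrX ger0_norm ?sqr_ge0// expr2.
    move=> H; rewrite -subr_ge0.
    have -> : l / 2 * `|d| ^+ 2 + 2^-1 / l - `|d| = (l * `|d| - 1) ^+ 2 / (2 * l).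
      by field; rewrite gt_eqF.
    by rewrite divr_ge0// mulr_ge0// ltW.
  rewrite Rintegral_lin// Rintegral_cst_itv// subr0.
  have : \int[mu]_(t in `[0, x]) (wderiv h t * wderiv h t * w t) <= dotE w h h.
    apply: (@le_trans _ _ (\int[mu]_(t in Rp) (wderiv h t * wderiv h t * w t))).
      rewrite /Rintegral fine_le ?integrable_fin_num//.
      apply: ge0_subset_integral => //; first exact: (measurable_int mu iR).
        by move=> t /=; rewrite in_itv/= andbT => t0; rewrite lee_fin mulr_ge0 ?weight_ge0// -expr2 sqr_ge0.
      by apply: subset_itvl; rewrite bnd_simp.
    exact: dotE_ge_integral.
  move=> H; have := ler_wpM2l (_ : 0 <= l / 2) H => /(_ (divr_ge0 (ltW l0) (ler0n _ 2))).
  lra.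
have N0 : 0 <= N by exact: normE_ge0.
have [xz|xp] := eqVneq x 0.
  by rewrite /A xz set_itv1 Rintegral_set1 mulr_ge0 ?sqrtr_ge0.
have {}xp : 0 < x by rewrite lt_neqAle eq_sym xp.
have [Nz|Np] := eqVneq N 0.
  rewrite -/N Nz mulr0; apply/ler_addgt0Pr => e e0; rewrite add0r.
  (* With [N = 0] the bound is [x / (2 * l)], which this [l] makes equal to [e / 2]. *)
  have := B (x / e) (divr_gt0 xp e0); rewrite Nz expr0n mulr0 add0r.
  have -> : x / (x / e) = e by field; rewrite !gt_eqF.
  by move=> /le_trans; apply; rewrite ler_pdivrMr// ler_pMr// ler1n.
have {}Np : 0 < N by rewrite lt_neqAle eq_sym Np.
have s0 : 0 < Num.sqrt x by rewrite sqrtr_gt0.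
(* The minimiser of [l * N ^ 2 + x / l]. *)
have := B (Num.sqrt x / N) (divr_gt0 s0 Np).
have -> : x / (Num.sqrt x / N) = Num.sqrt x * N.
  by rewrite -{1}(sqr_sqrtr x0); field; rewrite !gt_eqF.
have -> : Num.sqrt x / N * N ^+ 2 = Num.sqrt x * N by field; rewrite gt_eqF.
by rewrite -/N; lra.
Qed.

Lemma spaceE_eval h x : spaceE w h -> 0 <= x -> `|h x| <= (1 + Num.sqrt x) * normE w h.
Proof.
move=> Eh x0; have := spaceE_growth Eh x0.
have : `|h 0| <= normE w h.
  rewrite -[leRHS]ger0_norm ?normE_ge0// -ler_sqr ?nnegrE// -!normrX !ger0_norm ?sqr_ge0// normE_sqr.
  by have := dotE_ge_sq h; lra.
have := ler_normD (h x - h 0) (h 0); rewrite subrK; lra.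
Qed.

End weighted_space.

(** * The shift semigroup *)

Section shift_semigroup.
Context {R : realType} (w : R -> R) (hw : admissible_weight w).
Implicit Types (s a b x : R) (f g h k : R -> R).
Notation mu := (@lebesgue_measure R).
Notation Rp := (`[0%R, +oo[%classic : set R).

Let measurable_w := measurable_weight hw.
Let w_ge0 := weight_ge0 hw.
Let w_mono := weight_nondecreasing hw.

Lemma measurable_shift s g : 0 <= s -> measurable_fun Rp g ->
  measurable_fun Rp (fun x => g (s + x)).
Proof.
move=> s0 mg; apply: (@measurable_comp _ _ _ _ _ _ Rp g _ (translate s)) => //.
  by move=> _ [x /= + <-]; rewrite /translate !in_itv/= !andbT => x0; rewrite addr_ge0.
by apply: measurable_funTS; exact: measurable_translate.
Qed.

Definition shift_dist2 g s s' : \bar R :=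
  (\int[mu]_(x in Rp) ((g (s + x)%R - g (s' + x)%R) ^+ 2 * w x)%:E)%E.

(** Strong continuity of the shifts in the weighted L^2 space. It is stated along sequences to fit
    dominated convergence, and with an extended real distance so that no finiteness has to be
    carried along. *)
Definition shift_continuous g := forall (u : nat -> R) s, (forall n, 0 <= u n) ->
  0 <= s -> u @ \oo --> s -> forall eps : R, 0 < eps ->
  \forall n \near \oo, (shift_dist2 g (u n) s <= eps%:E)%E.

(** Because [w] is nondecreasing, [w x <= w (s + x)]: shifting to the right is a contraction of the
    weighted space. *)
Lemma ge0_integral_shift_le g s : 0 <= s -> measurable_fun Rp g ->
  (forall x, 0 <= x -> 0 <= g x) ->
  (\int[mu]_(x in Rp) (g (s + x)%R * w x)%:E <= \int[mu]_(x in Rp) (g x * w x)%:E)%E.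
Proof.
move=> s0 mg g0.
have mgw : measurable_fun Rp (fun x => (g x * w x)%:E).
  by apply/measurable_EFinP; exact: measurable_funM.
have sub : `[s, +oo[ `<=` Rp by apply: subset_itvr; rewrite bnd_simp.
apply: (@le_trans _ _ (\int[mu]_(x in `[s, +oo[) (g x * w x)%:E)%E); last first.
  apply: ge0_subset_integral => // x /=; rewrite in_itv/= andbT => x0.
  by rewrite lee_fin mulr_ge0 ?w_ge0 ?g0.
rewrite (@ge0_integral_translate _ s `[s, +oo[)//; last 2 first.
- exact: measurable_funS mgw.
- move=> x /= /sub; rewrite /= in_itv/= andbT => x0.
  by rewrite lee_fin mulr_ge0 ?w_ge0 ?g0.
have -> : translate s @^-1` `[s, +oo[ = Rp.
  by apply/seteqP; split => x /=; rewrite /translate !in_itv/= !andbT lerDl.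
apply: ge0_le_integral_nonmeas => x /=; rewrite in_itv/= andbT => x0; rewrite lee_fin.
  by rewrite mulr_ge0 ?w_ge0 ?g0// addr_ge0.
by rewrite ler_wpM2l ?g0 ?addr_ge0// w_mono// lerDr.
Qed.

(** Closedness under L^2 limits. The contraction property makes the approximation error uniform in
    the shift, and [(p + q - r) ^ 2 <= 3 * (p ^ 2 + q ^ 2 + r ^ 2)] explains the [eps / 9]. *)
Lemma shift_continuous_approx g : measurable_fun Rp g ->
  (forall eps : R, 0 < eps -> exists k, [/\ measurable_fun Rp k, shift_continuous k &
    (\int[mu]_(x in Rp) ((g x - k x) ^+ 2 * w x)%:E <= eps%:E)%E]) ->
  shift_continuous g.
Proof.
move=> mg H u s u0 s0 us eps eps0.
have [|k [mk ck gk]] := H (eps / 9); first by rewrite divr_gt0.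
have e9 : 0 < eps / 9 by rewrite divr_gt0.
have := ck u s u0 s0 us _ e9; apply: filterS => n Hn.
have mgk : measurable_fun Rp (fun x => (g x - k x) ^+ 2).
  by apply: measurable_funX; exact: measurable_funB.
have sq0 (a : R) x : 0 <= x -> (0 <= (a ^+ 2 * w x)%:E)%E.
  by move=> x0; rewrite lee_fin mulr_ge0 ?sqr_ge0 ?w_ge0.
have B t : 0 <= t -> (\int[mu]_(x in Rp) ((g (t + x)%R - k (t + x)%R) ^+ 2 * w x)%:E <= (eps / 9)%:E)%E.
  move=> t0; apply: le_trans gk.
  by apply: (@ge0_integral_shift_le (fun x => (g x - k x) ^+ 2)) => // x _; exact: sqr_ge0.
pose A1 x : R := (g (u n + x) - k (u n + x)) ^+ 2 * w x.
pose A2 x : R := (k (u n + x) - k (s + x)) ^+ 2 * w x.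
pose A3 x : R := (g (s + x) - k (s + x)) ^+ 2 * w x.
have mA1 : measurable_fun Rp (EFin \o A1).
  apply/measurable_EFinP; apply: measurable_funM => //; apply: measurable_funX.
  by apply: measurable_funB; exact: measurable_shift.
have mA2 : measurable_fun Rp (EFin \o A2).
  apply/measurable_EFinP; apply: measurable_funM => //; apply: measurable_funX.
  by apply: measurable_funB; exact: measurable_shift.
have mA3 : measurable_fun Rp (EFin \o A3).
  apply/measurable_EFinP; apply: measurable_funM => //; apply: measurable_funX.
  by apply: measurable_funB; exact: measurable_shift.
have A10 x : Rp x -> (0 <= (EFin \o A1) x)%E by rewrite /= in_itv/= andbT; exact: sq0.
have A20 x : Rp x -> (0 <= (EFin \o A2) x)%E by rewrite /= in_itv/= andbT; exact: sq0.
have A30 x : Rp x -> (0 <= (EFin \o A3) x)%E by rewrite /= in_itv/= andbT; exact: sq0.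
apply: (@le_trans _ _ (\int[mu]_(x in Rp) (3%:E * ((EFin \o A1) x + ((EFin \o A2) x + (EFin \o A3) x))))%E).
  apply: ge0_le_integral_nonmeas => x /=; rewrite in_itv/= andbT => x0; first exact: sq0.
  rewrite -!EFinD -EFinM lee_fin /A1 /A2 /A3 -!mulrDl mulrA ler_wpM2r ?w_ge0//.
  set p := g (u n + x) - k (u n + x); set q := k _ - _; set r := g (s + x) - k (s + x).
  have -> : g (u n + x) - g (s + x) = p + q - r by rewrite /p /q /r; lra.
  have := sqr_ge0 (p - q); have := sqr_ge0 (p + r); have := sqr_ge0 (q + r); lra.
have m23 : measurable_fun Rp (fun x => (EFin \o A2) x + (EFin \o A3) x)%E.
  exact: emeasurable_funD.
have m123 : measurable_fun Rp (fun x => (EFin \o A1) x + ((EFin \o A2) x + (EFin \o A3) x))%E.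
  exact: emeasurable_funD.
have p23 x : Rp x -> (0 <= (EFin \o A2) x + (EFin \o A3) x)%E.
  by move=> Rx; rewrite adde_ge0 ?A20 ?A30.
have p123 x : Rp x -> (0 <= (EFin \o A1) x + ((EFin \o A2) x + (EFin \o A3) x))%E.
  by move=> Rx; rewrite adde_ge0 ?A10 ?p23.
rewrite ge0_integralZl//.
rewrite ge0_integralD//.
rewrite ge0_integralD//.
apply: (@le_trans _ _ (3%:E * ((eps / 9)%:E + ((eps / 9)%:E + (eps / 9)%:E)))%E).
  by rewrite lee_wpmul2l ?lee_fin// !leeD// ?B.
by rewrite -!EFinD -EFinM lee_fin; lra.
Qed.

(** The base case of the density argument: convergence is pointwise almost everywhere, and
    everything is dominated by a constant on [[0, N]]. *)
Lemma shift_continuous_truncation (kap : R -> R) (N : nat) (M : R) :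
  continuous kap -> (forall x, `|kap x| <= M) ->
  measurable_fun Rp (kap \_ `[0, N%:R]) /\ shift_continuous (kap \_ `[0, N%:R]).
Proof.
move=> ck kM; set k := kap \_ _.
have mk : measurable_fun setT k.
  apply/(measurable_restrictT _ _).1 => //.
  by apply: measurable_funTS; exact: continuous_measurable_fun.
split; first exact: measurable_funTS.
have M0 : 0 <= M by apply: le_trans (kM 0).
have kM' x : `|k x| <= M by rewrite /k patchE; case: ifPn => // _; rewrite normr0.
have k0 x : N%:R < x -> k x = 0.
  by move=> Nx; rewrite /k patchE memNset//= in_itv/= (leNgt x) Nx andbF.
move=> u s u0 s0 us eps eps0.
pose G : R -> R := (fun=> (2 * M) ^+ 2 * w N%:R) \_ `[0, N%:R].
have iG : mu.-integrable Rp (EFin \o G).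
  rewrite -restrict_EFin; apply/integrable_restrict => //; rewrite setIidr.
    exact: integrable_cst_itv.
  by apply: subset_itvl; rewrite bnd_simp.
have mf_ t : 0 <= t -> measurable_fun Rp (fun x => (k (t + x) - k (s + x)) ^+ 2 * w x).
  move=> t0; apply: measurable_funM => //; apply: measurable_funX.
  by apply: measurable_funB; apply: measurable_shift => //; exact: measurable_funTS.
have bd t x : 0 <= t -> Rp x -> `|(k (t + x) - k (s + x)) ^+ 2 * w x| <= G x.
  move=> t0; rewrite /= in_itv/= andbT => x0.
  have nn : 0 <= (k (t + x) - k (s + x)) ^+ 2 * w x.
    by apply: mulr_ge0; [exact: sqr_ge0|exact: w_ge0].
  rewrite (ger0_norm nn) /G patchE.
  have [xN|Nx] := leP x N%:R.
    rewrite mem_set; last by rewrite /= in_itv/= x0.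
    rewrite ler_pM ?sqr_ge0 ?w_ge0//; last exact: w_mono.
    rewrite -(real_normK (num_real _)) ler_sqr ?nnegrE ?mulr_ge0//.
    apply: (le_trans (ler_normB _ _)); have := kM' (t + x); have := kM' (s + x); lra.
  rewrite memNset; last by rewrite /= in_itv/= (leNgt x) Nx andbF.
  by rewrite !k0 ?subrr ?expr0n ?mul0r// (lt_le_trans Nx)// lerDr.
have ae0 : {ae mu, forall x, Rp x ->
    (fun n => (k (u n + x) - k (s + x)) ^+ 2 * w x) @ \oo --> cst 0 x}.
  (* The cut at [N] is a possible jump; after the shift by [s] it sits at this single point, the
     only place where convergence may fail. *)
  exists [set N%:R - s]; split; [exact: measurable_set1|exact: lebesgue_measure_set1|].
  move=> x /=; apply: contra_notP => /eqP xN; rewrite in_itv/= andbT => x0.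
  have usx : (fun n => u n + x) @ \oo --> s + x by apply: cvgD => //; exact: cvg_cst.
  have kc : (fun n => k (u n + x)) @ \oo --> k (s + x).
    have sx0 : 0 <= s + x by rewrite addr_ge0.
    have ux0 n : 0 <= u n + x by rewrite addr_ge0.
    have [sxN|Nsx|sxN] := ltgtP (s + x) N%:R.
    - have -> : k (s + x) = kap (s + x) by rewrite /k patchE mem_set//= in_itv/= sx0 ltW.
      have : (fun n => kap (u n + x)) @ \oo --> kap (s + x).
        by apply: continuous_cvg => //; exact: ck.
      apply: cvg_trans; apply: near_eq_cvg; near=> n.
      rewrite /k patchE mem_set//= in_itv/= ux0/= ltW//.
      near: n; have := cvgr_lt (s + x) usx; exact.
    - rewrite (k0 (s + x))//; apply: cvg_near_cst; near=> n; rewrite k0//.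
      near: n; have := cvgr_gt (s + x) usx; exact.
    - by move: xN; rewrite -sxN addrAC subrr add0r eqxx.
  rewrite -[X in _ --> X](mul0r (w x)); apply: cvgM; last exact: cvg_cst.
  rewrite -[X in _ --> X](expr0n R 2) -(subrr (k (s + x))).
  have dc : (fun n => k (u n + x) - k (s + x)) @ \oo --> k (s + x) - k (s + x).
    by apply: cvgB => //; exact: cvg_cst.
  by under eq_fun do rewrite expr2; rewrite expr2; exact: cvgM.
have [] := @Rintegral_dominated _ _ _ mu Rp (fun n x => (k (u n + x) - k (s + x)) ^+ 2 * w x)
   (cst 0) G (measurable_itv _) (fun n => mf_ _ (u0 n)) (measurable_cst _) ae0 iG
   (fun n x => bd (u n) x (u0 n)).
move=> _ /cvgrPdist_le/(_ _ eps0); rewrite (_ : \int[mu]_(x in Rp) cst 0 x = 0); last first.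
  by rewrite /Rintegral integral0_eq.
apply: filterS => n; rewrite sub0r normrN => Hn.
have iF : mu.-integrable Rp (EFin \o (fun x => (k (u n + x) - k (s + x)) ^+ 2 * w x)).
  by apply: (@integrable_le _ _ _ mu _ _ G) => // [|x Rx]; [exact: mf_|exact: bd].
rewrite /shift_dist2 -[leLHS]fineK; last exact: (integrable_fin_num _ iF).
by rewrite lee_fin (le_trans _ Hn)// ler_norm.
Unshelve. all: by end_near. Qed.

Definition truncation_domain (N : nat) g : set R :=
  `[0, N%:R] `&` g @^-1` `[- N%:R, N%:R].

Definition truncation (N : nat) g : R -> R := g \_ (truncation_domain N g).

Lemma measurable_truncation_domain N g : measurable_fun Rp g ->
  measurable (truncation_domain N g).
Proof.
move=> mg; have mg' : measurable_fun (`[0, N%:R]%classic : set R) g.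
  by apply: measurable_funS mg => //; apply: subset_itvl; rewrite bnd_simp.
exact: mg'.
Qed.

Lemma measurable_truncation N g : measurable_fun Rp g -> measurable_fun Rp (truncation N g).
Proof.
move=> mg; have mD := measurable_truncation_domain N mg.
apply/measurable_restrict => //; apply: measurable_funS mg => //; by move=> x [].
Qed.

Lemma truncation_le N g x : `|truncation N g x| <= N%:R.
Proof.
rewrite /truncation patchE; case: ifPn => [/set_mem[_ /=]|_]; last by rewrite normr0.
by rewrite in_itv/= -ler_norml.
Qed.

Lemma truncation_eq0 N g x : ~ (0 <= x <= N%:R) -> truncation N g x = 0.
Proof.
move=> Nx; rewrite /truncation patchE memNset// => -[+ _].
by rewrite /= in_itv.
Qed.

(** The clamp to [[- M, M]] for [M >= 0], written with absolute values so that its continuity is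
    immediate. *)
Definition clip (M x : R) : R := (`|x + M| - `|x - M|) / 2.

Lemma clipP M x : 0 <= M -> [\/ x <= - M /\ clip M x = - M,
  M <= x /\ clip M x = M | - M <= x <= M /\ clip M x = x].
Proof.
move=> M0; rewrite /clip; have [xM|xM] := leP x (- M).
  by apply: Or31; split=> //; rewrite !ler0_norm; lra.
have [Mx|Mx] := leP M x.
  by apply: Or32; split=> //; rewrite !ger0_norm; lra.
by apply: Or33; split; [lra|rewrite ger0_norm ?ler0_norm; lra].
Qed.

Lemma clip_le M x : 0 <= M -> `|clip M x| <= M.
Proof. by move=> M0; rewrite ler_norml; case: (clipP x M0) => -[? ->]; lra. Qed.

Lemma clip_contraction M x y : 0 <= M -> `|y| <= M -> `|y - clip M x| <= `|y - x|.
Proof.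
move=> M0; rewrite ler_norml => /andP[yM My]; case: (clipP x M0) => -[xM ->] //.
  by rewrite !ger0_norm; lra.
by rewrite !ler0_norm; lra.
Qed.

Lemma continuous_clip M : continuous (clip M).
Proof.
move=> x; rewrite /clip; apply: cvgM; last exact: cvg_cst.
apply: cvgB; apply: cvg_norm; [apply: cvgD|apply: cvgB]; (try exact: cvg_cst); exact: cvg_id.
Qed.

(** The density theorem provides continuous approximants in L^1 only. Clipping them to [[- N, N]]
    does not increase the distance to a function bounded by [N], and then a squared error is at most
    [2 * N] times the error itself, which upgrades L^1 to L^2. *)
Lemma shift_continuous_truncated N g : measurable_fun Rp g ->
  shift_continuous (truncation N g).
Proof.
move=> mg; have mt := measurable_truncation N mg; pose gN := truncation N g.
apply: shift_continuous_approx => // eps eps0.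
have iN : mu.-integrable `[0, N%:R] (EFin \o gN).
  apply: (@integrable_le _ _ _ mu _ _ (fun=> N%:R)) => //.
  - by apply: measurable_funS mt => //; apply: subset_itvl; rewrite bnd_simp.
  - by move=> x _; exact: truncation_le.
  - exact: integrable_cst_itv.
have fin : (mu `[0%R, N%:R : R] < +oo)%E by rewrite /= lebesgue_measure_itv/=; case: ifP; rewrite ?ltry.
have [kap [ck ik kcvg]] := approximation_continuous_integrable (measurable_itv _) fin iN.
(* Factor from L^1 to weighted L^2 on [[0, N]]; the summand 1 only makes it positive when
   [N = 0]. *)
pose C := 2 * N%:R * w N%:R + 1 : R.
have C0 : 0 < C by rewrite ltr_wpDl// mulr_ge0 ?w_ge0// mulr_ge0.
have ec : (0 < (eps / C)%:E)%E by rewrite lte_fin divr_gt0.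
have {}ec : 0 < eps / C by rewrite divr_gt0.
have [m Hm] : exists m, (\int[mu]_(z in `[0%R, N%:R]) `|(gN z - kap m z)%:E| <= (eps / C)%:E)%E.
  move/fine_cvgP : kcvg => [kfin /cvgrPdist_le/(_ _ ec) kc].
  near \oo => m; exists m; rewrite -[leLHS]fineK; last by near: m.
  rewrite lee_fin; apply: le_trans (ler_norm _) _; rewrite -normrN -sub0r.
  by near: m.
pose kc := clip N%:R \o kap m.
have ckc : continuous kc.
  by move=> x; apply: continuous_comp; [exact: ck|exact: continuous_clip].
have kcN x : `|kc x| <= N%:R by apply: clip_le.
have [mk sk] := @shift_continuous_truncation kc N N%:R ckc kcN.
exists (kc \_ `[0, N%:R]); split => //.
have mkap : measurable_fun setT (kap m) by exact: continuous_measurable_fun.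
have mgN : measurable_fun (`[0, N%:R]%classic : set R) gN by exact: integrable_measurable iN.
apply: (@le_trans _ _ (\int[mu]_(z in `[0%R, N%:R]) (C%:E * `|(gN z - kap m z)%:E|))%E).
  rewrite [leRHS]integral_mkcond [leLHS]integral_mkcond.
  apply: ge0_le_integral_nonmeas => x _; rewrite !patchE.
    case: ifPn => // /set_mem/=; rewrite in_itv/= andbT => x0.
    by rewrite lee_fin mulr_ge0 ?sqr_ge0 ?w_ge0.
  case: ifPn => [/set_mem/=|]; last first.
    by move=> _; case: ifPn => // _; rewrite mule_ge0// lee_fin ltW.
  rewrite in_itv/= andbT => x0; case: ifPn => [/set_mem|/negP]; rewrite ?inE /= in_itv/= x0/=.
    move=> xN; rewrite -EFinM lee_fin -/(gN x).
    have H1 := clip_contraction (kap m x) (ler0n R N) (truncation_le N g x).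
    have H2 : `|gN x - kc x| <= 2 * N%:R.
      by apply: (le_trans (ler_normB _ _)); have := kcN x; have := truncation_le N g x; rewrite -/gN; lra.
    rewrite -[(gN x - kc x) ^+ 2]ger0_norm ?sqr_ge0// normrX expr2.
    apply: (@le_trans _ _ (2 * N%:R * `|gN x - kap m x| * w N%:R)).
      by rewrite ler_pM ?mulr_ge0 ?w_ge0 ?w_mono// ler_pM.
    by rewrite mulrAC ler_wpM2r// /C lerDl.
  move=> xN; rewrite truncation_eq0 ?subrr ?expr0n ?mul0r//; last by rewrite x0/=.
have mabs : measurable_fun (`[0%R, N%:R]%classic : set R) (fun z => `|(gN z - kap m z)%:E|)%E.
  apply: (@measurableT_comp _ _ _ _ _ _ (@abse R)) => //; apply/measurable_EFinP.
  by apply: measurable_funB => //; exact: measurable_funTS.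
have C0' : (0 <= C%:E)%E by rewrite lee_fin ltW.
rewrite ge0_integralZl//.
apply: (@le_trans _ _ (C%:E * (eps / C)%:E)%E); first by rewrite lee_wpmul2l// lee_fin ltW.
by rewrite -EFinM lee_fin mulrC divfK// gt_eqF.
Unshelve. all: by end_near. Qed.

(** At a given [x] the truncation agrees with [g] once [N] exceeds [x] and [|g x|], so dominated
    convergence reduces to the bounded, compactly supported case. *)
Lemma shift_continuous_weighted g : measurable_fun Rp g ->
  mu.-integrable Rp (EFin \o (fun x => g x ^+ 2 * w x)) -> shift_continuous g.
Proof.
move=> mg ig; apply: shift_continuous_approx => // eps eps0.
have mf N : measurable_fun Rp (fun x => (g x - truncation N g x) ^+ 2 * w x).
  apply: measurable_funM => //; apply: measurable_funX; apply: measurable_funB => //.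
  exact: measurable_truncation.
have bd N x : Rp x -> `|(g x - truncation N g x) ^+ 2 * w x| <= g x ^+ 2 * w x.
  rewrite /= in_itv/= andbT => x0.
  have nn : 0 <= (g x - truncation N g x) ^+ 2 * w x.
    by apply: mulr_ge0; [exact: sqr_ge0|exact: w_ge0].
  rewrite (ger0_norm nn) ler_wpM2r ?w_ge0// /truncation patchE; case: ifPn => _; last by rewrite subr0.
  by rewrite subrr expr0n sqr_ge0.
have ae0 : {ae mu, forall x, Rp x ->
    (fun N => (g x - truncation N g x) ^+ 2 * w x) @ \oo --> cst 0 x}.
  apply: aeW => x; rewrite /= in_itv/= andbT => x0.
  apply: cvg_near_cst; near=> N.
  rewrite /truncation patchE mem_set ?subrr ?expr0n ?mul0r//; split => /=.
    rewrite in_itv/= x0/=; near: N; exact: nbhs_infty_ger.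
  rewrite in_itv/= -ler_norml; near: N; exact: nbhs_infty_ger.
have [] := @Rintegral_dominated _ _ _ mu Rp (fun N x => (g x - truncation N g x) ^+ 2 * w x)
   (cst 0) _ (measurable_itv _) mf (measurable_cst _) ae0 ig bd.
move=> _ /cvgrPdist_le/(_ _ eps0) [N _ /(_ N (leqnn N))].
rewrite (_ : \int[mu]_(x in Rp) cst 0 x = 0); last by rewrite /Rintegral integral0_eq.
rewrite sub0r normrN => HN; exists (truncation N g); split.
- exact: measurable_truncation.
- exact: shift_continuous_truncated.
have iF : mu.-integrable Rp (EFin \o (fun x => (g x - truncation N g x) ^+ 2 * w x)).
  by apply: (@integrable_le _ _ _ mu _ _ _ _ (mf N) (bd N) ig).
rewrite -[leLHS]fineK; last exact: (integrable_fin_num _ iF).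
by rewrite lee_fin (le_trans _ HN)// ler_norm.
Unshelve. all: by end_near. Qed.

Lemma wderiv_shift s h : 0 <= s -> spaceE w h -> spaceE w (right_shift s h) ->
  {ae mu, forall x, 0 <= x -> wderiv (right_shift s h) x = wderiv h (s + x)}.
Proof.
move=> s0 Eh Es; apply: (wderiv_unique (g := right_shift s (wderiv h)) Es).
  by apply: L1loc_shift => //; exact: wderiv_L1loc Eh.
move=> b b0; rewrite /right_shift addr0 (spaceE_FTC Eh)//; last by rewrite lerDl.
rewrite -{1}(addr0 s) Rintegral_translate_itv//.
by apply: L1loc_integrable; rewrite ?addr0//; exact: wderiv_L1loc Eh.
Qed.

Transparent dotE normE.
Lemma dotE_ae h k g1 g2 : spaceE w h -> spaceE w k ->
  measurable_fun Rp g1 -> measurable_fun Rp g2 ->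
  {ae mu, forall x, 0 <= x -> wderiv h x = g1 x} ->
  {ae mu, forall x, 0 <= x -> wderiv k x = g2 x} ->
  dotE w h k = h 0 * k 0 + \int[mu]_(x in Rp) (g1 x * g2 x * w x).
Proof.
move=> Eh Ek m1 m2 e1 e2; rewrite /dotE; apply: (congr1 (fun z => _ + z)).
rewrite /Rintegral; congr fine; apply: ae_eq_integral => //.
- exact: (measurable_int mu (wderiv_mul_integrable hw Eh Ek)).
- by apply/measurable_EFinP; apply: measurable_funM => //; exact: measurable_funM.
- apply: ae_imp2 e1 e2 => x H1 H2; rewrite /= in_itv/= andbT => x0.
  by rewrite H1// H2.
Qed.
Opaque dotE normE.

Lemma spaceEB h k : spaceE w h -> spaceE w k -> spaceE w (h \- k).
Proof.
move=> Eh Ek; have := spaceE_lin hw 1 (-1) Eh Ek.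
by rewrite (_ : (fun x => _) = h \- k)//; apply/funext => x /=; ring.
Qed.

Lemma wderivB_ae h k g1 g2 : spaceE w h -> spaceE w k ->
  {ae mu, forall x, 0 <= x -> wderiv h x = g1 x} ->
  {ae mu, forall x, 0 <= x -> wderiv k x = g2 x} ->
  {ae mu, forall x, 0 <= x -> wderiv (h \- k) x = g1 x - g2 x}.
Proof.
move=> Eh Ek e1 e2; have [_] := wderiv_lin 1 (-1) Eh Ek.
rewrite (_ : (fun x => _) = h \- k); last by apply/funext => x /=; ring.
have := ae_imp2 (fun x => @conj _ _) e1 e2.
apply: ae_imp2 => x [H1 H2] H3 x0; rewrite H3// H1// H2//; ring.
Qed.

Lemma normE_shift_dist (s s' : R) h : 0 <= s -> 0 <= s' -> spaceE w h ->
  spaceE w (right_shift s h) -> spaceE w (right_shift s' h) ->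
  normE w (right_shift s h \- right_shift s' h) ^+ 2 =
  (h s - h s') ^+ 2 + fine (shift_dist2 (wderiv h) s s').
Proof.
move=> s0 s'0 Eh Es Es'; rewrite (normE_sqr hw).
have mw := measurable_wderiv Eh.
have m : measurable_fun Rp (fun x => wderiv h (s + x) - wderiv h (s' + x)).
  by apply: measurable_funB; exact: measurable_shift.
have e := wderivB_ae Es Es' (wderiv_shift s0 Eh Es) (wderiv_shift s'0 Eh Es').
rewrite (dotE_ae (spaceEB Es Es') (spaceEB Es Es') m m e e) /= /right_shift !addr0 -expr2.
by apply: (congr1 (fun z => _ + z)); apply: eq_Rintegral => x _; rewrite -expr2.
Qed.

Lemma within_cvg_seq h (u : nat -> R) s : {within Rp, continuous h} ->
  (forall n, 0 <= u n) -> 0 <= s -> u @ \oo --> s -> (fun n => h (u n)) @ \oo --> h s.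
Proof.
move=> /subspace_continuousP ch u0 s0 us.
apply: (@cvg_comp _ _ _ u h _ (within Rp (nbhs s))); last first.
  by apply: ch; rewrite /= in_itv/= andbT.
move=> P WP; have : \forall n \near \oo, Rp (u n) -> P (u n) by exact: us _ WP.
apply: filterS => n; apply.
by rewrite /= in_itv/= andbT.
Qed.

Lemma right_shift_continuous h (u : nat -> R) s : spaceE w h ->
  (forall n, 0 <= u n) -> 0 <= s -> (forall n, spaceE w (right_shift (u n) h)) ->
  spaceE w (right_shift s h) -> u @ \oo --> s ->
  (fun n => normE w (right_shift (u n) h \- right_shift s h)) @ \oo --> (0 : R).
Proof.
move=> Eh u0 s0 Eu Es us.
have hc : (fun n => h (u n)) @ \oo --> h s.
  exact: (within_cvg_seq (spaceE_continuous Eh)).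
have sc := shift_continuous_weighted (measurable_wderiv Eh) (spaceE_sq_integrable hw Eh) u0 s0 us.
apply/cvgrPdist_le => e e0; have e20 : 0 < e ^+ 2 / 2 by rewrite divr_gt0// exprn_gt0.
have e1 : 0 < e / 2 by rewrite divr_gt0.
have := sc _ e20; move/cvgrPdist_le : hc => /(_ _ e1).
apply: filterS2 => n H1 H2.
have := normE_shift_dist (u0 n) s0 Eh (Eu n) Es.
have := normE_ge0 w (right_shift (u n) h \- right_shift s h).
move: (normE _ _) => N N0 N2.
rewrite sub0r normrN ger0_norm//.
have -> : (N <= e) = (N ^+ 2 <= e ^+ 2) by rewrite ler_sqr ?nnegrE// ltW.
rewrite N2.
have : fine (shift_dist2 (wderiv h) (u n) s) <= e ^+ 2 / 2.
  rewrite -lee_fin fineK// ge0_fin_numE.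
    by apply: le_lt_trans H2 _; rewrite ltry.
  apply: integral_ge0 => x /=; rewrite in_itv/= andbT => x0.
  by rewrite lee_fin mulr_ge0 ?sqr_ge0 ?w_ge0.
have : (h (u n) - h s) ^+ 2 <= (e / 2) ^+ 2.
  move: H1; rewrite distrC ler_norml => /andP[? ?].
  rewrite -subr_ge0 subr_sqr mulr_ge0//; lra.
move: (fine _) => F; have := sqr_ge0 e; rewrite expr_div_n; lra.
Qed.

(** A bound that is locally uniform in [s], used to dominate the discretised integrands:
    [1 + sqrt s] pays for the value at 0 and the contraction property for the derivative. *)
Lemma normE_shift_le (s : R) h : 0 <= s -> spaceE w h -> spaceE w (right_shift s h) ->
  normE w (right_shift s h) <= (2 + Num.sqrt s) * normE w h.
Proof.
move=> s0 Eh Es; have mw := measurable_wderiv Eh.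
have := spaceE_eval hw Eh s0; set N := normE w h; set q := Num.sqrt s => hs.
have N0 : 0 <= N by exact: normE_ge0.
have q0 : 0 <= q by exact: sqrtr_ge0.
rewrite -ler_sqr ?nnegrE ?normE_ge0 ?mulr_ge0 ?addr_ge0// (normE_sqr hw).
have m : measurable_fun Rp (fun x => wderiv h (s + x)) by exact: measurable_shift.
have e := wderiv_shift s0 Eh Es.
rewrite (dotE_ae Es Es m m e e) /= /right_shift addr0.
have H : \int[mu]_(x in Rp) (wderiv h (s + x) * wderiv h (s + x) * w x) <= N ^+ 2.
  rewrite (normE_sqr hw); apply: le_trans (dotE_ge_integral w h).
  have i1 := wderiv_mul_integrable hw Eh Eh.
  rewrite /Rintegral fine_le//.
  - rewrite ge0_fin_numE.
      apply: (@le_lt_trans _ _ (\int[mu]_(x in Rp) (wderiv h x * wderiv h x * w x)%:E)%E).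
        apply: (@ge0_integral_shift_le (fun x => wderiv h x * wderiv h x)) => //.
          exact: measurable_funM.
        by move=> x _; rewrite -expr2 sqr_ge0.
      by apply: integrable_lty.
    apply: integral_ge0 => x /=; rewrite in_itv/= andbT => x0.
    by rewrite lee_fin mulr_ge0 ?w_ge0// -expr2 sqr_ge0.
  - exact: integrable_fin_num.
  apply: (@ge0_integral_shift_le (fun x => wderiv h x * wderiv h x)) => //.
    exact: measurable_funM.
  by move=> x _; rewrite -expr2 sqr_ge0.
have : h s * h s <= ((1 + q) * N) ^+ 2.
  by rewrite -expr2 -(real_normK (num_real _)) ler_sqr ?nnegrE ?mulr_ge0 ?addr_ge0.
have : 0 <= (2 * q + 2) * N ^+ 2 by rewrite mulr_ge0 ?sqr_ge0// addr_ge0// mulr_ge0.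
have -> : ((2 + q) * N) ^+ 2 = ((1 + q) * N) ^+ 2 + N ^+ 2 + (2 * q + 2) * N ^+ 2 by ring.
move: H; move: (\int[mu]_(x in Rp) _) => I; lra.
Qed.

(** Measurability into E speaks of norm-open sets only. Evaluation at [x] is norm-continuous on E,
    so the sets of curves with value above [c] at [x] are open, and they generate what is needed. *)
Lemma measurable_eval (disp : measure_display) (X : measurableType disp) (D : set X)
    (f : X -> R -> R) x : measurable D -> 0 <= x -> measurableE w D f ->
  measurable_fun D (fun om => f om x).
Proof.
move=> mD x0 [Ef mf] _; apply: (measurability _ (RGenOInfty.measurableE R)) => //.
move=> /= _ [_ [c ->] <-].
have -> : D `&` (fun om => f om x) @^-1` `]c, +oo[ = D `&` f @^-1` [set h | c < h x].
  by apply/seteqP; split => a [Da]; rewrite /= ?in_itv/= ?andbT.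
apply: mf => h Eh /= ch.
have q0 : 0 < 1 + Num.sqrt x by rewrite ltr_pwDl// sqrtr_ge0.
exists ((h x - c) / (1 + Num.sqrt x)); first by rewrite divr_gt0// subr_gt0.
move=> g Eg; rewrite ltr_pdivlMr// mulrC => H.
have := le_lt_trans (spaceE_eval hw (spaceEB Eg Eh) x0) H.
by rewrite ltr_norml /=; lra.
Qed.

End shift_semigroup.

(** * The fractional kernel *)

Section fractional_kernel.
Context {R : realType} (H : R) (hH : 2^-1 < H < 1).
Implicit Types (a b c d r s t u v x y : R).
Notation mu := (@lebesgue_measure R).

Let H0 : 0 < H. Proof. by case/andP: hH => ? _; lra. Qed.
Let e_gt0 : 0 < 2 * H - 1. Proof. by case/andP: hH => ? _; lra. Qed.

Lemma phiH_ge0 x : 0 <= phiH H x.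
Proof. by rewrite /phiH mulr_ge0 ?powR_ge0// mulr_ge0 ?ltW. Qed.

Lemma phiHN x : phiH H (- x) = phiH H x. Proof. by rewrite /phiH normrN. Qed.

Lemma measurable_phiH : measurable_fun setT (phiH H).
Proof.
apply: measurable_funM; first exact: measurable_cst.
apply: (measurableT_comp (measurable_powR _)); exact: normr_measurable.
Qed.

Lemma continuous_norm_powR p : 0 < p -> continuous (fun x => `|x| `^ p).
Proof.
move=> p0 x; have [->|x0] := eqVneq x 0.
  apply/cvgrPdist_lt => eps eps0.
  have /cvgrPdist_lt/(_ _ eps0) := powR_cvg0 p0.
  move=> [d /= d0 hd]; exists d => //= y; rewrite /ball_/= sub0r normrN => yd.
  rewrite normr0 powR0 ?gt_eqF// sub0r normrN ger0_norm ?powR_ge0//.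
  have [->|y0] := eqVneq y 0; first by rewrite normr0 powR0 ?gt_eqF.
  have := hd `|y|; rewrite /ball_/= sub0r normrN normr_id => /(_ yd).
  by rewrite normr_gt0 sub0r normrN ger0_norm ?powR_ge0//; exact.
have nx : 0 < `|x| by rewrite normr_gt0.
apply: (@continuous_comp R R R (fun y : R => `|y|) (fun y : R => y `^ p) x); first exact: norm_continuous.
apply: differentiable_continuous; apply/derivable1_diffP.
by apply: derivable_powR; rewrite in_itv/= andbT.
Qed.

(** The odd primitive [sign x * H * |x| ^ (2 * H - 1)] of [phiH H], written with positive and
    negative parts so that it is visibly continuous at 0. [phi_prim2] is in turn its even
    primitive. *)
Definition phi_prim x : R :=
  H * (`|(`|x| + x) / 2| `^ (2 * H - 1) - `|(`|x| - x) / 2| `^ (2 * H - 1)).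

Definition phi_prim2 x : R := `|x| `^ (2 * H) / 2.

Lemma phi_prim_ge0E x : 0 <= x -> phi_prim x = H * x `^ (2 * H - 1).
Proof.
move=> x0; rewrite /phi_prim (ger0_norm x0).
have -> : (x + x) / 2 = x by field.
by rewrite subrr mul0r normr0 powR0 ?gt_eqF// subr0 ger0_norm.
Qed.

Lemma phi_primN x : phi_prim (- x) = - phi_prim x.
Proof. by rewrite /phi_prim normrN opprK; ring. Qed.

Lemma continuous_phi_prim : continuous phi_prim.
Proof.
move=> x; rewrite /phi_prim.
have cn := continuous_norm_powR e_gt0.
apply: cvgM; first exact: cvg_cst.
apply: cvgB.
- apply: (@continuous_comp _ _ _ (fun y => (`|y| + y) / 2) (fun y => `|y| `^ (2 * H - 1))); last exact: cn.
  apply: cvgM; last exact: cvg_cst.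
  by apply: cvgD; [apply: cvg_norm; exact: cvg_id|exact: cvg_id].
- apply: (@continuous_comp _ _ _ (fun y => (`|y| - y) / 2) (fun y => `|y| `^ (2 * H - 1))); last exact: cn.
  apply: cvgM; last exact: cvg_cst.
  by apply: cvgB; [apply: cvg_norm; exact: cvg_id|exact: cvg_id].
Qed.

Lemma is_derive_phi_prim x : 0 < x -> is_derive x 1 phi_prim (phiH H x).
Proof.
move=> x0; apply: (@near_eq_is_derive _ R R (fun y => H * y `^ (2 * H - 1))).
  near=> y; have y0 : 0 < y by near: y; exact: lt_nbhsr.
  by rewrite phi_prim_ge0E// ltW.
have D := is_derive1_powR (2 * H - 1) x0.
apply: is_derive_eq; rewrite /phiH gtr0_norm// /GRing.scale/= ?mulr0 ?addr0.
by rewrite (_ : 2 * H - 1 - 1 = 2 * H - 2); ring.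
Unshelve. all: by end_near. Qed.

Lemma is_derive_phi_prim2 x : is_derive x 1 phi_prim2 (phi_prim x).
Proof.
have P y : 0 < y -> is_derive y 1 phi_prim2 (phi_prim y).
  move=> y0; apply: (@near_eq_is_derive _ R R (fun z => 2^-1 * z `^ (2 * H))).
    near=> z; rewrite /phi_prim2 mulrC gtr0_norm//; near: z; exact: lt_nbhsr.
  have D := is_derive1_powR (2 * H) y0.
  by apply: is_derive_eq; rewrite phi_prim_ge0E ?ltW// /GRing.scale/= ?mulr0 ?addr0; field.
have [x0|x0|->] := ltgtP x 0; last first.
- rewrite phi_prim_ge0E// powR0 ?gt_eqF// mulr0.
  have L : h^-1 *: ((phi_prim2 \o shift 0) (h *: 1) - phi_prim2 0) @[h --> (0 : R)^'] --> (0 : R).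
    have B : (fun h : R => `|h| `^ (2 * H - 1) / 2) @ (0:R)^' --> (0 : R).
      have := (@continuous_norm_powR _ e_gt0 0); rewrite /continuous_at normr0 powR0 ?gt_eqF// => cn.
      rewrite -[X in _ --> X](mul0r (2^-1)); apply: cvgM; last exact: cvg_cst.
      by apply: cvg_trans cn; apply: cvg_app; exact: nbhs_dnbhs.
    apply: norm_cvg0; move: B; apply: cvg_trans; apply: near_eq_cvg; near=> h.
    have h0 : h != 0 by near: h; exact: nbhs_dnbhs_neq.
    rewrite /= /GRing.scale/= mulr1 addr0 /phi_prim2 normr0 powR0 ?mul0r ?subr0; last by rewrite gt_eqF// mulr_gt0.
    rewrite normrM normfV [`|_ / 2|]ger0_norm ?divr_ge0 ?powR_ge0//.
    rewrite -(@mulr_powRB1 _ `|h| (2 * H)) ?mulr_gt0//.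
    by field; rewrite normr_eq0.
  by apply: DeriveDef; [apply: cvgP L|exact: cvg_lim L].
- exact: P.
- have := P (- x); rewrite oppr_gt0 => /(_ x0) D.
  have -> : phi_prim2 = phi_prim2 \o -%R.
    by apply/funext => y; rewrite /phi_prim2 /= normrN.
  have -> : phi_prim x = phi_prim (- x) * - 1 by rewrite phi_primN; ring.
  exact: (@is_derive1_comp R phi_prim2 -%R x _ _ D (is_deriveNid x 1)).
Unshelve. all: by end_near. Qed.

Lemma ge0_integral_opp (D : set R) (f : R -> \bar R) : measurable D ->
  measurable_fun D f -> (forall x, D x -> 0 <= f x)%E ->
  (\int[mu]_(x in D) f x = \int[mu]_(x in -%R @^-1` D) f (- x)%R)%E.
Proof.
move=> mD mf f0.
have mopp : measurable_fun setT (-%R : measurableTypeR R -> measurableTypeR R).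
  exact: oppr_measurable.
have := @ge0_integral_pushforward _ _ _ _ R _ mopp mu D f mD mf.
move=> <-; last by move=> y /set_mem; exact: f0.
apply: eq_measure_integral => //= A mA AS.
by first [exact: lebesgue_measureN|exact/esym/lebesgue_measureN].
Qed.

(** The kernel blows up near 0, so the fundamental theorem is applied on [[b / n.+1, b]] and
    monotone convergence finishes; [H > 1/2] makes the primitive vanish continuously at 0. *)
Lemma integral_phiH0 b : 0 <= b ->
  (\int[mu]_(x in `[0%R, b]) (phiH H x)%:E = (phi_prim b)%:E)%E.
Proof.
rewrite le_eqVlt => /predU1P[<-|b0].
  by rewrite set_itv1 integral_set1 phi_prim_ge0E// powR0 ?mulr0 ?gt_eqF.
have mphi (D : set R) : measurable_fun D (fun x => (phiH H x)%:E).
  by apply/measurable_EFinP; apply: measurable_funTS; exact: measurable_phiH.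
rewrite -integral_itv_obnd_cbnd//.
pose u n : R := b * n.+1%:R^-1.
have u0 n : 0 < u n by rewrite mulr_gt0.
have ub n : u n <= b by rewrite ger_pMr// invf_le1// ler1n.
have ucvg : u @ \oo --> (0 : R).
  rewrite -[X in _ --> X](mulr0 b); apply: cvgM; first exact: cvg_cst.
  exact: cvg_harmonic.
have U : \bigcup_n `[u n, b]%classic = `]0, b]%classic.
  apply/seteqP; split => x /=.
    by move=> [n _ /=]; rewrite !in_itv/= => /andP[ux ->]; rewrite (lt_le_trans (u0 n)).
  rewrite in_itv/= => /andP[x0 xb].
  have /cvgrPdist_lt/(_ _ x0)[n _ /(_ n (leqnn n))] := ucvg.
  rewrite sub0r normrN gtr0_norm// => ux; exists n => //=.
  by rewrite in_itv/= xb ltW.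
rewrite -U.
have cvg1 := @ge0_nondecreasing_set_cvg_integral _ (measurableTypeR R) R (fun n => `[u n, b]%classic) (fun x => (phiH H x)%:E) mu.
have E n : (\int[mu]_(x in `[u n, b]) (phiH H x)%:E = (phi_prim b - phi_prim (u n))%:E)%E.
  have cphi : {within `[u n, b], continuous (phiH H)}.
    apply: continuous_in_subspaceT => x; rewrite inE/= in_itv/= => /andP[ux _].
    have x0 : 0 < x by exact: lt_le_trans ux.
    apply: cvgM; first exact: cvg_cst.
    apply: (@continuous_comp R R R (fun y : R => `|y|) (fun y : R => y `^ (2 * H - 2)) x); first exact: norm_continuous.
    apply: differentiable_continuous; apply/derivable1_diffP.
    by apply: derivable_powR; rewrite in_itv/= andbT normr_gt0 gt_eqF.
  have cprim : {within `[u n, b], continuous phi_prim}.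
    by apply: continuous_subspaceT => x; exact: continuous_phi_prim.
  have dprim x : u n < x < b -> is_derive x 1 phi_prim (phiH H x).
    by move=> /andP[ux _]; apply: is_derive_phi_prim; exact: lt_trans ux.
  rewrite -(Rintegral_FTC2 (ub n) cphi cprim dprim).
  rewrite /Rintegral fineK//; apply: integrable_fin_num => //.
  by apply: continuous_compact_integrable => //; exact: segment_compact.
have cvg2 : (fun n => (\int[mu]_(x in `[u n, b]) (phiH H x)%:E)%E) @ \oo --> (phi_prim b)%:E.
  under eq_fun do rewrite E; apply: cvg_EFin; first exact: nearW.
  rewrite -[X in _ --> X]subr0; apply: cvgB; first exact: cvg_cst.
  have -> : 0 = phi_prim 0 by rewrite phi_prim_ge0E// powR0 ?mulr0 ?gt_eqF.
  by apply: continuous_cvg ucvg; exact: continuous_phi_prim.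
apply: (cvg_unique _ (cvg1 _ _ _ _) cvg2) => //.
- move=> n m nm; apply/subsetPset; apply: subset_itvr; rewrite bnd_simp.
  by rewrite ler_pM2l// lef_pV2 ?posrE// ler_nat.
- by move=> n; exact: mphi.
- by move=> n x _; rewrite lee_fin phiH_ge0.
Qed.

Lemma integral_phiH a b : a <= b ->
  (\int[mu]_(x in `[a, b]) (phiH H x)%:E = (phi_prim b - phi_prim a)%:E)%E.
Proof.
have mphi (D : set R) : measurable_fun D (fun x => (phiH H x)%:E).
  by apply/measurable_EFinP; apply: measurable_funTS; exact: measurable_phiH.
have split3 x y z : x <= y -> y <= z -> (\int[mu]_(t in `[x, z]) (phiH H t)%:E =
    \int[mu]_(t in `[x, y]) (phiH H t)%:E + \int[mu]_(t in `[y, z]) (phiH H t)%:E)%E.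
  move=> xy yz; rewrite (@itv_bndbnd_setU _ _ (BLeft x) (BRight y) (BRight z)) ?bnd_simp//.
  rewrite ge0_integral_setU//=.
  - by rewrite integral_itv_obnd_cbnd.
  - exact: mphi.
  - by move=> t _; rewrite lee_fin phiH_ge0.
  - apply/disj_setPS => t [/=]; rewrite !in_itv/= => /andP[_ ty] /andP[yt _].
    by move: yt; rewrite ltNge ty.
have refl x y : (\int[mu]_(t in `[x, y]) (phiH H t)%:E = \int[mu]_(t in `[(- y)%R, (- x)%R]) (phiH H t)%:E)%E.
  rewrite ge0_integral_opp//; last by move=> t _; rewrite lee_fin phiH_ge0.
  rewrite opp_preimage_itvbndbnd/=.
  by apply: eq_integral => t _; rewrite phiHN.
have pos x y : 0 <= x -> x <= y -> (\int[mu]_(x in `[x, y]) (phiH H x)%:E = (phi_prim y - phi_prim x)%:E)%E.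
  move=> x0 xy; have := split3 0 x y x0 xy; rewrite !integral_phiH0//; last exact: le_trans xy.
  case: (\int[mu]_(x in `[x, y]) _)%E => [I| |] //=; rewrite -EFinD => -[->].
  by congr EFin; ring.
move=> ab; have [a0|a0] := leP 0 a; first exact: pos.
have [b0|b0] := leP b 0.
  by rewrite refl pos ?lerN2 ?oppr_ge0// !phi_primN; congr EFin; ring.
rewrite (split3 _ 0 _ (ltW a0) (ltW b0)) (refl a 0) oppr0.
have na0 : 0 <= - a by rewrite oppr_ge0 ltW.
rewrite (pos 0 (- a) (lexx 0) na0) (pos 0 b (lexx 0) (ltW b0)) phi_primN -EFinD.
have p0 : phi_prim 0 = 0 by rewrite phi_prim_ge0E// powR0 ?mulr0 ?gt_eqF.
by rewrite p0; congr EFin; ring.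
Qed.

Lemma integral_phiH_shift u a b : a <= b ->
  (\int[mu]_(v in `[a, b]) (phiH H (u - v))%:E = (phi_prim (u - a) - phi_prim (u - b))%:E)%E.
Proof.
move=> ab.
have -> : (\int[mu]_(v in `[a, b]) (phiH H (u - v))%:E = \int[mu]_(v in `[(a - u)%R, (b - u)%R]) (phiH H v)%:E)%E.
  rewrite (@ge0_integral_translate _ (- u) `[a - u, b - u])//.
  - have -> : a - u = - u + a by ring. have -> : b - u = - u + b by ring.
    rewrite translate_preimage_itv; apply: eq_integral => v _.
    by rewrite -phiHN; congr (phiH _ _)%:E; ring.
  - by apply/measurable_EFinP; apply: measurable_funTS; exact: measurable_phiH.
  - by move=> t _; rewrite lee_fin phiH_ge0.
rewrite integral_phiH ?lerD2r//; congr EFin.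
rewrite -(opprB u a) -(opprB u b) !phi_primN; ring.
Qed.

Lemma integrable_phiH_shift u a b : mu.-integrable `[a, b] (EFin \o (fun v => phiH H (u - v))).
Proof.
have [ab|ba] := leP a b; last by rewrite set_itv_ge ?bnd_simp -?ltNge//; exact: integrable_set0.
apply/integrableP; split.
  apply/measurable_EFinP; apply: measurable_funTS; apply: (measurableT_comp measurable_phiH).
  by apply: measurable_funB => //; exact: measurable_cst.
under eq_integral do rewrite /= ger0_norm ?phiH_ge0//.
by rewrite integral_phiH_shift// ltry.
Qed.

Lemma Rintegral_phiH_shift u a b : a <= b ->
  \int[mu]_(v in `[a, b]) phiH H (u - v) = phi_prim (u - a) - phi_prim (u - b).
Proof. by move=> ab; rewrite /Rintegral integral_phiH_shift. Qed.

(** The covariance of the increments of a fractional Brownian motion over [[a, b]] and [[c, d]]. It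
    is also the integral of [phiH] over the rectangle, which is the source both of the isometry and
    of its sign. *)
Definition fbm_cov a b c d : R :=
  phi_prim2 (b - c) + phi_prim2 (a - d) - phi_prim2 (a - c) - phi_prim2 (b - d).

Lemma measurable_phiH2 : measurable_fun setT (fun p : measurableTypeR R * measurableTypeR R => phiH H (p.1 - p.2)).
Proof.
apply: (measurableT_comp measurable_phiH).
by apply: measurable_funB; [exact: measurable_fst|exact: measurable_snd].
Qed.

Lemma integral_phiH_rectangle a b c d : a <= b -> c <= d ->
  (\int[(mu \x mu)%E]_(p in `]a, b] `*` `]c, d]) (phiH H (p.1 - p.2))%:E =
   (fbm_cov a b c d)%:E)%E.
Proof.
move=> ab cd; rewrite integral_mkcond fubini_tonelli1; last 2 first.
- apply/(measurable_restrictT _ _).1; first exact: measurableX.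
  by apply/measurable_EFinP; apply: measurable_funTS; exact: measurable_phiH2.
- by move=> p; rewrite patchE; case: ifPn => // _; rewrite lee_fin phiH_ge0.
transitivity (\int[mu]_(u in `]a, b]) (phi_prim (u - c) - phi_prim (u - d))%:E)%E.
  rewrite [RHS]integral_mkcond; apply: eq_integral => u _; rewrite /fubini_F patchE.
  case: ifPn => [/set_mem ua|ua].
    rewrite -integral_phiH_shift// -integral_itv_obnd_cbnd//; last first.
      apply/measurable_EFinP; apply: measurable_funTS; apply: (measurableT_comp measurable_phiH).
      by apply: measurable_funB => //; exact: measurable_cst.
    rewrite [RHS]integral_mkcond; apply: eq_integral => v _.
    rewrite !patchE; congr (if _ then _ else _).
    by apply/idP/idP; rewrite !inE/=; [case|].
  apply: integral0_eq => v _; rewrite patchE; case: ifPn => // /set_mem[/= uab _].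
  by move: ua; rewrite notin_setE/= => /(_ uab).
have cp : {within `[a, b], continuous (fun u => phi_prim (u - c) - phi_prim (u - d))}.
  apply: continuous_subspaceT => x; apply: cvgB;
    exact: (continuous_shiftB continuous_phi_prim).
have dp e x : is_derive x 1 (fun u => phi_prim2 (u - e)) (phi_prim (x - e)).
  have := @is_derive1_comp R phi_prim2 (fun y => y - e) x _ _ (is_derive_phi_prim2 _) _.
  move=> /(_ 1)D; rewrite -[X in is_derive _ _ _ X]mulr1; apply: D.
  by apply: is_derive_eq; rewrite subr0.
have D x : is_derive x 1 (fun u => phi_prim2 (u - c) - phi_prim2 (u - d)) (phi_prim (x - c) - phi_prim (x - d)).
  by have := dp c x; have := dp d x => *; apply: is_derive_eq.
have cF : {within `[a, b], continuous (fun u => phi_prim2 (u - c) - phi_prim2 (u - d))}.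
  apply: continuous_subspaceT => x; apply: differentiable_continuous; apply/derivable1_diffP.
  exact: (@ex_derive _ _ _ _ _ _ _ (D x)).
have -> : fbm_cov a b c d = (phi_prim2 (b - c) - phi_prim2 (b - d)) -
   (phi_prim2 (a - c) - phi_prim2 (a - d)) by rewrite /fbm_cov; ring.
rewrite integral_itv_obnd_cbnd//; last first.
  apply/measurable_EFinP; apply: measurable_funTS; apply: continuous_measurable_fun => x.
  by apply: cvgB; exact: (continuous_shiftB continuous_phi_prim).
rewrite -(Rintegral_FTC2 ab cp cF (fun x _ => D x)) /Rintegral fineK//.
apply: integrable_fin_num => //.
by apply: continuous_compact_integrable => //; exact: segment_compact.
Qed.

Lemma fbm_cov_ge0 a b c d : a <= b -> c <= d -> 0 <= fbm_cov a b c d.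
Proof.
move=> ab cd; rewrite -lee_fin -integral_phiH_rectangle//.
by apply: integral_ge0 => p _; rewrite lee_fin phiH_ge0.
Qed.

Lemma integrable_phiH_square t : 0 <= t ->
  (mu \x mu)%E.-integrable (`[0, t] `*` `[0, t]) (EFin \o (fun p => phiH H (p.1 - p.2))).
Proof.
move=> t0; have mX : measurable (`[0%R, t] `*` `[0%R, t] : set (measurableTypeR R * measurableTypeR R)).
  exact: measurableX.
apply/integrableP; split.
  by apply/measurable_EFinP; apply: measurable_funTS; exact: measurable_phiH2.
under eq_integral do rewrite /= ger0_norm ?phiH_ge0//.
have t1 : -1 <= t by rewrite (le_trans _ t0)// lerN10.
(* The rectangle formula is for half-open sides; starting at [-1] swallows the closed endpoint 0. *)
apply: (@le_lt_trans _ _ (\int[(mu \x mu)%E]_(p in `](-1)%R, t] `*` `](-1)%R, t]) (phiH H (p.1 - p.2))%:E)%E).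
  apply: ge0_subset_integral => //.
  - exact: measurableX.
  - by apply/measurable_EFinP; apply: measurable_funTS; exact: measurable_phiH2.
  - by move=> p _; rewrite lee_fin phiH_ge0.
  - move=> p [/=]; rewrite !in_itv/= => /andP[a ->] /andP[b ->]; rewrite !andbT.
    by split; [exact: lt_le_trans a|exact: lt_le_trans b].
by rewrite integral_phiH_rectangle// ltry.
Qed.

End fractional_kernel.

(** * Gaussian laws *)

Section density.
Local Open Scope ereal_scope.
Context d (T : measurableType d) (R : realType) (mu nu : {measure set T -> \bar R}).
Import HBNNSimple.

Lemma ge0_integral_density (p : T -> R) (f : T -> \bar R) :
  measurable_fun setT p -> (forall x, 0 <= p x)%R ->
  (forall A, measurable A -> nu A = \int[mu]_(x in A) (p x)%:E) ->
  measurable_fun setT f -> (forall x, 0 <= f x) ->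
  \int[nu]_x f x = \int[mu]_x (f x * (p x)%:E).
Proof.
move=> mp p0 nuE mf f0.
have p0E x : 0 <= (p x)%:E by rewrite lee_fin.
have mpE : measurable_fun setT (fun x => (p x)%:E) by exact/measurable_EFinP.
pose g := nnsfun_approx measurableT mf.
have gcvg x : (g n x)%:E @[n --> \oo] --> f x.
  by apply: cvg_nnsfun_approx.
have gE0 n x : 0 <= (g n x)%:E by rewrite lee_fin.
have mg n : measurable_fun setT (fun x => (g n x)%:E).
  by apply/measurable_EFinP; exact/measurable_funP.
have homog x : {homo (fun n => (g n x)%:E) : n m / (n <= m)%N >-> n <= m}.
  by move=> m n mn; rewrite lee_fin; exact/lefP/nd_nnsfun_approx.
have c1 := @cvg_monotone_convergence _ _ _ nu setT measurableT (fun n x => (g n x)%:E)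
  mg (fun n x _ => gE0 n x) (fun x _ => homog x).
have c2 := @cvg_monotone_convergence _ _ _ mu setT measurableT
  (fun n x => (g n x)%:E * (p x)%:E)
  (fun n => emeasurable_funM (mg n) mpE) (fun n x _ => mule_ge0 (gE0 n x) (p0E x))
  (fun x _ n m nm => lee_wpmul2r (p0E x) (homog x n m nm)).
have E1 : \int[nu]_x limn (fun n => (g n x)%:E) = \int[nu]_x f x.
  by apply: eq_integral => x _; apply/cvg_lim => //.
have E2 : \int[mu]_x limn (fun n => (g n x)%:E * (p x)%:E) = \int[mu]_x (f x * (p x)%:E).
  by apply: eq_integral => x _; apply/cvg_lim => //; apply: cvgeZr.
rewrite E1 in c1; rewrite E2 in c2.
have E n : \int[nu]_x (g n x)%:E = \int[mu]_x ((g n x)%:E * (p x)%:E); last first.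
  move: c1; rewrite (_ : (fun n => \int[nu]_x (g n x)%:E) =
    (fun n => \int[mu]_x ((g n x)%:E * (p x)%:E))); last exact/funext.
  by move=> c1; apply: (cvg_unique _ c1 c2).
transitivity (\sum_(k \in range (g n)) \int[nu]_x (k * \1_(g n @^-1` [set k]) x)%:E).
  under eq_integral do rewrite fimfunE -fsumEFin//.
  rewrite ge0_integral_fsum//; last 2 first.
  - by move=> y; exact/measurable_EFinP/measurable_funM.
  - by move=> y x _; rewrite nnfun_muleindic_ge0.
transitivity (\sum_(k \in range (g n)) \int[mu]_x ((k * \1_(g n @^-1` [set k]) x)%:E * (p x)%:E)).
  apply: eq_fsbigr => r _; have [r0|r0] := ltP r 0%R.
    have -> : g n @^-1` [set r] = set0 by rewrite preimage_nnfun0.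
    by rewrite !integral0_eq// => x _; rewrite indic0 mulr0// mul0e.
  have mA : measurable (g n @^-1` [set r]) by exact: measurable_sfunP.
  have mi : measurable_fun setT (fun x => (\1_(g n @^-1` [set r]) x)%:E : \bar R).
    by apply/measurable_EFinP; exact: measurable_indic.
  have i0 x : 0 <= (\1_(g n @^-1` [set r]) x)%:E :> \bar R by rewrite lee_fin.
  under eq_integral do rewrite EFinM.
  rewrite ge0_integralZl// integral_indic// setIT.
  under [RHS]eq_integral do rewrite EFinM -muleA.
  rewrite ge0_integralZl//; last 2 first.
  - by apply: emeasurable_funM.
  - by move=> x _; exact: mule_ge0.
  congr (_ * _); rewrite nuE// integral_mkcond; apply: eq_integral => x _.
  by rewrite patchE indicE; case: (x \in _); rewrite ?mul1e ?mul0e.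
rewrite -ge0_integral_fsum//.
- apply: eq_integral => x _; rewrite fimfunE -fsumEFin//.
  by rewrite ge0_mule_fsuml// => k; rewrite nnfun_muleindic_ge0.
- by move=> r; apply: emeasurable_funM => //; exact/measurable_EFinP/measurable_funM.
- by move=> r x _; apply: mule_ge0 => //; rewrite nnfun_muleindic_ge0.
Qed.

End density.

Section gaussian.
Context {R : realType} (disp : measure_display) (Omega : measurableType disp)
  (P : probability Omega R).
Implicit Types (X : Omega -> R) (s : R).
Notation mu := (@lebesgue_measure R).

Lemma ge0_integral_law X (nu : {measure set (measurableTypeR R) -> \bar R}) (f : R -> R) :
  measurable_fun setT X -> (forall A : set R, measurable A -> P (X @^-1` A) = nu A) ->
  measurable_fun setT f -> (forall x, 0 <= f x) ->
  (\int[P]_om (f (X om))%:E = \int[nu]_x (f x)%:E)%E.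
Proof.
move=> mX XE mf f0.
have := @ge0_integral_pushforward _ _ _ _ R (X : Omega -> measurableTypeR R) mX P setT (fun x => (f x)%:E).
rewrite preimage_setT => <- //.
- by apply: eq_measure_integral => A mA _; exact: XE.
- exact/measurable_EFinP.
- by move=> x _; rewrite lee_fin.
Qed.

Lemma ge0_integral_normal s (f : R -> R) : s != 0 ->
  measurable_fun setT f -> (forall x, 0 <= f x) ->
  (\int[normal_prob 0 s]_x (f x)%:E = \int[mu]_x (f x * normal_pdf 0 s x)%:E)%E.
Proof.
move=> s0 mf f0.
apply: (@ge0_integral_density _ _ _ mu (normal_prob 0 s) (normal_pdf 0 s) (fun x => (f x)%:E)) => //.
- exact: measurable_normal_pdf.
- exact: normal_pdf_ge0.
- exact/measurable_EFinP.
Qed.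

(** Completing the square: [expR x] times the centered density is [expR (s ^ 2 / 2)] times the
    density with mean [s ^ 2]. *)
Lemma normal_mgf s : s != 0 ->
  (\int[normal_prob 0 s]_x (expR x)%:E = (expR (s ^+ 2 / 2))%:E)%E.
Proof.
move=> s0; rewrite (ge0_integral_normal s0 (@measurable_expR R) (@expR_ge0 R)).
transitivity (\int[mu]_x ((expR (s ^+ 2 / 2))%:E * (normal_pdf (s ^+ 2) s x)%:E))%E.
  apply: eq_integral => x _; rewrite -EFinM !normal_pdfE// /normal_fun.
  congr EFin; rewrite mulrCA [RHS]mulrCA; congr (_ * _); rewrite -!expRD; congr expR.
  by rewrite subr0 -mulr_natr; field.
rewrite ge0_integralZl ?integral_normal_pdf ?mule1//.
- by apply/measurable_EFinP; exact: measurable_normal_pdf.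
- by move=> x _; rewrite lee_fin normal_pdf_ge0.
Qed.

(* [expR (- a x^2) >= expR (- b x^2) (1 - (a - b) x^2)] for [a = (1 + y)^2 b] *)
Lemma normal_pdf_scale s y x : s != 0 -> -1 < y ->
  normal_pdf 0 s x * (1 - (2 * y + y ^+ 2) / (2 * s ^+ 2) * x ^+ 2) <=
  (1 + y)^-1 * normal_pdf 0 (s / (1 + y)) x.
Proof.
move=> s0 y1; have y1' : 0 < 1 + y by rewrite -(subrr 1) ltrD2l.
have s'0 : s / (1 + y) != 0 by rewrite mulf_neq0// invr_eq0 gt_eqF.
rewrite !normal_pdfE// /normal_fun !subr0.
have -> : normal_peak (s / (1 + y)) = (1 + y) * normal_peak s.
  rewrite /normal_peak exprMn exprVn.
  have -> : s ^+ 2 * (1 + y) ^- 2 * pi *+ 2 = ((1 + y)^-1) ^+ 2 * (s ^+ 2 * pi *+ 2).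
    rewrite exprVn [RHS]mulrnAr [in RHS]mulrA; congr (_ * _ + _ * _); exact: mulrC.
  by rewrite sqrtrM ?sqr_ge0// sqrtr_sqr invfM ger0_norm ?invr_ge0 ?ltW// invrK.
rewrite -(mulrA (normal_peak s)) -(mulrA (1 + y)) mulKf ?gt_eqF//.
apply: ler_wpM2l; first exact: normal_peak_ge0.
apply: (@le_trans _ _ (expR (- x ^+ 2 / (s ^+ 2 *+ 2)) * expR (- ((2 * y + y ^+ 2) / (2 * s ^+ 2) * x ^+ 2)))).
  by apply: ler_wpM2l; [exact: expR_ge0|exact: expR_ge1Dx].
rewrite -expRD ler_expR le_eqVlt; apply/orP; left; apply/eqP.
by rewrite -(mulr_natr (s ^+ 2)) -(mulr_natr ((s / (1 + y)) ^+ 2)); field; rewrite s0 gt_eqF.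
Qed.

(** At [y = - 1/2] the inequality [normal_pdf_scale] bounds [1 + 3 / (8 * s ^ 2) * x ^ 2] times the
    density by twice a wider Gaussian density. *)
Lemma integrable_normal_sqr s : s != 0 ->
  mu.-integrable setT (EFin \o (fun x => x ^+ 2 * normal_pdf 0 s x)).
Proof.
move=> s0; have y1 : - 1 < - 2^-1 :> R by rewrite ltrN2 invf_lt1 ?ltr1n.
have s2 : 0 < s ^+ 2 by rewrite exprn_even_gt0.
pose s' := s / (1 + - 2^-1).
have s'0 : s' != 0.
  by rewrite mulf_neq0// invr_eq0 gt_eqF// subr_gt0 invf_lt1 ?ltr1n.
have iG : mu.-integrable setT (EFin \o (fun x => (8 * s ^+ 2 / 3 * 2) * normal_pdf 0 s' x)).
  by apply: integrable_scale => //; exact: integrable_normal_pdf.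
have mf : measurable_fun setT (fun x : R => x ^+ 2 * normal_pdf 0 s x).
  by apply: measurable_funM; [exact: measurable_funX|exact: measurable_normal_pdf].
apply: (@integrable_le _ (measurableTypeR R) R mu setT _ (fun x => (8 * s ^+ 2 / 3 * 2) * normal_pdf 0 s' x) measurableT mf) => //.
move=> x _; have := normal_pdf_scale x s0 y1; rewrite -/s'.
have p0 := normal_pdf_ge0 0 s x; have p0' := normal_pdf_ge0 0 s' x.
have -> : (1 + - 2^-1)^-1 = 2 :> R by field.
rewrite ger0_norm ?(mulr_ge0 (sqr_ge0 _))//.
move: (normal_pdf 0 s x) (normal_pdf 0 s' x) p0 p0' => p q p0 q0 h.
have {h} : 3 / (8 * s ^+ 2) * (x ^+ 2 * p) <= 2 * q.
  apply: le_trans h; have -> : p * (1 - (2 * - 2^-1 + (- 2^-1) ^+ 2) / (2 * s ^+ 2) * x ^+ 2) = p + 3 / (8 * s ^+ 2) * (x ^+ 2 * p).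
    by field.
  by rewrite lerDr.
move=> h; have k0 : 0 < 8 * s ^+ 2 / 3 by rewrite divr_gt0// mulr_gt0.
have := ler_wpM2l (ltW k0) h; rewrite -(mulrA _ 2 q); apply: le_trans.
by rewrite le_eqVlt; apply/orP; left; apply/eqP; field.
Qed.

(** No integration by parts: integrating [normal_pdf_scale] gives an inequality in [y] between total
    masses and the second moment that is an equality at [y = 0]. Its first-order terms must
    therefore agree, and this identifies the moment. *)
Lemma normal_second_moment s : s != 0 ->
  \int[mu]_x (x ^+ 2 * normal_pdf 0 s x) = s ^+ 2.
Proof.
move=> s0; have s2 : 0 < s ^+ 2 by rewrite exprn_even_gt0.
have iq := integrable_normal_sqr s0.
have ip t : t != 0 -> mu.-integrable setT (EFin \o normal_pdf 0 t).
  by move=> t0; exact: integrable_normal_pdf.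
have one t : t != 0 -> \int[mu]_x normal_pdf 0 t x = 1.
  by move=> t0; rewrite /Rintegral integral_normal_pdf.
set M := \int[mu]_x _.
have key y : -1 < y -> y * (2 * s ^+ 2) <= y * ((1 + y) * (2 + y)) * M.
  move=> y1; have y1' : 0 < 1 + y by rewrite -(subrr 1) ltrD2l.
  have s'0 : s / (1 + y) != 0 by rewrite mulf_neq0// invr_eq0 gt_eqF.
  set k := (2 * y + y ^+ 2) / (2 * s ^+ 2).
  have : \int[mu]_x (1 * normal_pdf 0 s x + (- k) * (x ^+ 2 * normal_pdf 0 s x)) <=
       \int[mu]_x ((1 + y)^-1 * normal_pdf 0 (s / (1 + y)) x).
    apply: le_Rintegral => //.
    - exact: integrable_lin (ip _ s0) iq.
    - exact: integrable_scale (ip _ s'0).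
    - move=> x _; apply: le_trans (normal_pdf_scale x s0 y1).
      by rewrite -/k le_eqVlt; apply/orP; left; apply/eqP; ring.
  rewrite (Rintegral_lin _ _ measurableT (ip _ s0) iq) RintegralZl//; last exact: ip.
  rewrite !one// -/M /k; clearbody M => h.
  have h2 : 0 <= (1 + y) * (2 * s ^+ 2) by rewrite mulr_ge0 ?(ltW y1')// mulr_ge0 ?(ltW s2).
  have := ler_wpM2l h2 h.
  have -> : (1 + y) * (2 * s ^+ 2) * ((1 + y)^-1 * 1) = 2 * s ^+ 2 by field; rewrite gt_eqF.
  have -> : (1 + y) * (2 * s ^+ 2) * (1 * 1 + - ((2 * y + y ^+ 2) / (2 * s ^+ 2)) * M) =
     (1 + y) * (2 * s ^+ 2) - y * ((1 + y) * (2 + y)) * M by field.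
  by move=> {}h; rewrite -subr_ge0 in h; rewrite -subr_ge0; apply: le_trans h _; rewrite le_eqVlt; apply/orP; left; apply/eqP; ring.
have M0 : 0 <= M.
  by apply: Rintegral_ge0 => x _; rewrite mulr_ge0 ?sqr_ge0 ?normal_pdf_ge0.
clearbody M; clear ip one iq; move: (s ^+ 2) s2 key => S S0 key.
apply/eqP; rewrite eq_le; apply/andP; split; rewrite leNgt; apply/negP => lt.
(* Dividing [key] by [y] compares [2 * S] and [2 * M] up to terms of order [y], in opposite
   directions for the two signs of [y]. This value, and the one in the other case, are small enough
   for the gap between [S] and [M] to absorb those terms. *)
- pose y := - ((M - S) / (4 * M)).
  have M1 : 0 < M by exact: lt_trans lt.
  have y0 : y < 0 by rewrite oppr_lt0 divr_gt0 ?subr_gt0 ?mulr_gt0.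
  have yE : y * M = (S - M) / 4 by rewrite /y; field; rewrite gt_eqF.
  have y1 : -1 < y by rewrite ltrN2 ltr_pdivrMr ?mulr_gt0//; lra.
  have := key _ y1; rewrite -mulrA ler_nM2l//.
  have -> : (1 + y) * (2 + y) * M = 2 * M + 3 * (y * M) + y ^+ 2 * M by ring.
  rewrite yE => h; have : 0 <= y ^+ 2 * M by rewrite mulr_ge0 ?sqr_ge0.
  by lra.
- pose y := (S - M) / (4 * S).
  have y0 : 0 < y by rewrite divr_gt0 ?subr_gt0 ?mulr_gt0.
  have yS : y * S = (S - M) / 4 by rewrite /y; field; rewrite gt_eqF.
  have y1 : y <= 4^-1 by rewrite ler_pdivrMr ?mulr_gt0//; lra.
  have := key y; rewrite -mulrA ler_pM2l// => h; have {h} := h ltac:(lra).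
  have -> : (1 + y) * (2 + y) * M = 2 * M + (3 + y) * (y * M) by ring.
  have : (3 + y) * (y * M) <= 4 * (y * S).
    apply: ler_pM => //; [lra|by rewrite mulr_ge0// ltW|lra|by rewrite ler_pM2l// ltW].
  by lra.
Qed.

Lemma normal_second_moment_law s : s != 0 ->
  (\int[normal_prob 0 s]_x (x ^+ 2)%:E = (s ^+ 2)%:E)%E.
Proof.
move=> s0; rewrite ge0_integral_normal//; last by move=> ?; exact: sqr_ge0.
rewrite -(normal_second_moment s0) /Rintegral fineK//.
by apply: integrable_fin_num => //; exact: integrable_normal_sqr.
Qed.

(** The standard deviation in the law is existential, so it is eliminated in favour of the second
    moment; the Dirac case is [v = 0]. *)
Lemma centered_gaussian_mgf X v : centered_gaussian P X ->
  (\int[P]_om (X om ^+ 2)%:E = v%:E)%E ->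
  (\int[P]_om (expR (X om))%:E = (expR (v / 2))%:E)%E.
Proof.
have msq : measurable_fun setT (fun x : R => x ^+ 2) by exact: measurable_funX.
move=> [mX [[s s0 XE]|XE]].
- rewrite (ge0_integral_law mX XE msq (fun x => sqr_ge0 x)).
  rewrite normal_second_moment_law// => -[<-].
  by rewrite (ge0_integral_law mX XE (@measurable_expR R) (@expR_ge0 R)) normal_mgf.
- rewrite (ge0_integral_law (nu := \d_(0 : measurableTypeR R)) mX XE msq (fun x => sqr_ge0 x)).
  rewrite integral_dirac//=; last by apply/measurable_EFinP.
  rewrite diracT mul1e expr0n/= => -[<-].
  rewrite (ge0_integral_law (nu := \d_(0 : measurableTypeR R)) mX XE (@measurable_expR R) (@expR_ge0 R)).
  rewrite integral_dirac//=; last by apply/measurable_EFinP; exact: measurable_expR.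
  by rewrite diracT mul1e mul0r.
Qed.

Lemma centered_gaussian_sqr_fin X : centered_gaussian P X ->
  P.-integrable setT (EFin \o (fun om => X om ^+ 2)).
Proof.
have msq : measurable_fun setT (fun x : R => x ^+ 2) by exact: measurable_funX.
move=> [mX h]; apply/integrableP; split.
  by apply/measurable_EFinP; exact: measurable_funX.
under eq_integral do rewrite /= ger0_norm ?sqr_ge0//.
case: h => [[s s0 XE]|XE].
- rewrite (ge0_integral_law mX XE msq (fun x => sqr_ge0 x)).
  by rewrite normal_second_moment_law// ltry.
- rewrite (ge0_integral_law (nu := \d_(0 : measurableTypeR R)) mX XE msq (fun x => sqr_ge0 x)).
  rewrite integral_dirac//=; last by apply/measurable_EFinP.
  by rewrite diracT mul1e ltry.
Qed.

End gaussian.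

(** * Fractional Brownian motion *)

Section finite_sums.
Context d (T : measurableType d) (R : realType) (mu : {measure set T -> \bar R}).

Lemma Rintegral_bigsum (I : eqType) (r : seq I) (D : set T) (F : I -> T -> R) :
  measurable D ->
  (forall i, i \in r -> mu.-integrable D (EFin \o F i)) ->
  mu.-integrable D (EFin \o (fun x => \sum_(i <- r) F i x)) /\
  (\int[mu]_(x in D) (\sum_(i <- r) F i x) = \sum_(i <- r) \int[mu]_(x in D) F i x)%R.
Proof.
move=> mD; elim: r => [|i r IH] h.
  rewrite big_nil; have E : (fun x => \sum_(i <- [::]) F i x) = cst 0.
    by apply/funext => x; rewrite big_nil.
  by rewrite E; split; [exact: integrable0|by rewrite /Rintegral integral0].
have hi : mu.-integrable D (EFin \o F i) by apply: h; rewrite mem_head.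
have h' j : j \in r -> mu.-integrable D (EFin \o F j).
  by move=> jr; apply: h; rewrite in_cons jr orbT.
have [h1 h2] := IH h'.
have E : (fun x => \sum_(i <- i :: r) F i x) = (fun x => F i x + \sum_(i <- r) F i x).
  by apply/funext => x; rewrite big_cons.
rewrite E big_cons; split; first exact: integrable_add.
by rewrite RintegralD// h2.
Qed.

Lemma aeS (P Q : T -> Prop) : (forall x, P x -> Q x) ->
  {ae mu, forall x, P x} -> {ae mu, forall x, Q x}.
Proof. by move=> PQ; apply: filterS => //; exact: (ae_filter_ringOfSetsType mu). Qed.

End finite_sums.

Section fbm.
Context {R : realType} (T H : R) (disp : measure_display) (Omega : measurableType disp)
  (P : probability Omega R) (d : nat) (beta : 'I_d -> R -> Omega -> R).
Context (hT : 0 < T) (hH : 2^-1 < H < 1) (hb : is_fbm P T H beta).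
Implicit Types (a b c e s t : R) (i j : 'I_d).

Let H0 : 0 < H. Proof. by case/andP: hH => ? _; lra. Qed.

Lemma fbm_gaussian n (c : 'I_n -> R) (j : 'I_n -> 'I_d) (t : 'I_n -> R) :
  (forall k, t k \in `[0, T]) ->
  centered_gaussian P (fun om => \sum_(k < n) c k * beta (j k) (t k) om).
Proof. by case: hb => + _ _ _; exact. Qed.

Lemma fbm_gaussian1 j t : t \in `[0, T] -> centered_gaussian P (beta j t).
Proof.
move=> tT; have := @fbm_gaussian 1 (fun=> 1) (fun=> j) (fun=> t) (fun=> tT).
by congr centered_gaussian; apply/funext => om; rewrite big_ord1 mul1r.
Qed.

Lemma measurable_fbm j t : t \in `[0, T] -> measurable_fun setT (beta j t).
Proof. by move=> /fbm_gaussian1 h; have [] := h j. Qed.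

Lemma fbm_gaussian_increment j s t : s \in `[0, T] -> t \in `[0, T] ->
  centered_gaussian P (fun om => beta j t om - beta j s om).
Proof.
move=> sT tT; have := @fbm_gaussian 2 (fun k => if k == ord0 then 1 else - 1) (fun=> j)
  (fun k => if k == ord0 then t else s) _.
move=> h; have {h} := h ltac:(by move=> k; case: ifP).
congr centered_gaussian; apply/funext => om.
by rewrite big_ord_recl big_ord1/= mul1r mulN1r.
Qed.

Lemma integral_fbm_increment_sqr j s t : s \in `[0, T] -> t \in `[0, T] ->
  (\int[P]_om ((beta j t om - beta j s om) ^+ 2)%:E = (`|t - s| `^ (2 * H))%:E)%E.
Proof.
move=> sT tT; case: hb => _ _ _ /(_ j j s t sT tT).
by rewrite eqxx mul1r unlock => <-.
Qed.

Lemma integrable_fbm_increment_sqr j s t : s \in `[0, T] -> t \in `[0, T] ->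
  P.-integrable setT (EFin \o (fun om => (beta j t om - beta j s om) ^+ 2)).
Proof. by move=> sT tT; exact/centered_gaussian_sqr_fin/fbm_gaussian_increment. Qed.

(** Polarisation: the product of two increments is half a signed sum of four squared increments,
    whose means are prescribed. *)
Lemma fbm_covariance j a b c e :
  a \in `[0, T] -> b \in `[0, T] -> c \in `[0, T] -> e \in `[0, T] ->
  P.-integrable setT (EFin \o (fun om =>
    (beta j b om - beta j a om) * (beta j e om - beta j c om))) /\
  \int[P]_om ((beta j b om - beta j a om) * (beta j e om - beta j c om)) =
    fbm_cov H a b c e.
Proof.
move=> aT bT cT eT.
pose q s t om := (beta j t om - beta j s om) ^+ 2.
have iq s t : s \in `[0, T] -> t \in `[0, T] -> P.-integrable setT (EFin \o q s t).
  exact: integrable_fbm_increment_sqr.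
have Iq s t : s \in `[0, T] -> t \in `[0, T] -> \int[P]_om q s t om = `|t - s| `^ (2 * H).
  by move=> sT tT; rewrite /Rintegral integral_fbm_increment_sqr.
pose f1 om := 2^-1 * q c b om + 2^-1 * q e a om.
pose f2 om := 2^-1 * q c a om + 2^-1 * q e b om.
have i1 : P.-integrable setT (EFin \o f1) by apply: integrable_lin => //; exact: iq.
have i2 : P.-integrable setT (EFin \o f2) by apply: integrable_lin => //; exact: iq.
have E : (fun om => (beta j b om - beta j a om) * (beta j e om - beta j c om)) =
         (fun om => 1 * f1 om + (- 1) * f2 om).
  by apply/funext => om; rewrite /f1 /f2 /q; field.
have E1 : \int[P]_om f1 om = 2^-1 * \int[P]_om q c b om + 2^-1 * \int[P]_om q e a om.
  by apply: Rintegral_lin => //; exact: iq.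
have E2 : \int[P]_om f2 om = 2^-1 * \int[P]_om q c a om + 2^-1 * \int[P]_om q e b om.
  by apply: Rintegral_lin => //; exact: iq.
rewrite E; split; first exact: integrable_lin.
rewrite (Rintegral_lin _ _ measurableT i1 i2) E1 E2 !Iq// /fbm_cov /phi_prim2.
by move: (`|_ - _| `^ _) (`|_ - _| `^ _) (`|_ - _| `^ _) (`|_ - _| `^ _) => *; ring.
Qed.

Lemma fbm_marginal_cov i j t : t \in `[0, T] ->
  P.-integrable setT (EFin \o (fun om => beta i t om * beta j t om)) /\
  \int[P]_om (beta i t om * beta j t om) = (i == j)%:R * t `^ (2 * H).
Proof.
move=> tT; have t0 : 0 <= t by move: tT; rewrite in_itv/= => /andP[].
have [mi mj] := (measurable_fbm i tT, measurable_fbm j tT).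
have O : (0 : R) \in `[0, T] by rewrite in_itv/= lexx ltW.
have sq k : P.-integrable setT (EFin \o (fun om => beta k t om ^+ 2)).
  exact/centered_gaussian_sqr_fin/fbm_gaussian1.
split.
  apply: (integrable_le (g := fun om => beta i t om ^+ 2 + beta j t om ^+ 2)) => //.
  - exact: measurable_funM.
  - move=> om _; rewrite normrM -(real_normK (num_real (beta i t om))) -(real_normK (num_real (beta j t om))).
    move: `|_| `|_| (normr_ge0 (beta i t om)) (normr_ge0 (beta j t om)) => x y x0 y0.
    have : 0 <= (x - y) ^+ 2 by exact: sqr_ge0.
    have : 0 <= x * y by exact: mulr_ge0.
    by rewrite sqrrB; lra.
  - exact: integrable_add.
case: hb => _ _ b0 /(_ i j 0 t O tT); rewrite subr0 ger0_norm// unlock => h.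
rewrite /Rintegral -[RHS]/(fine (_%:E)) -h; congr fine.
have mm k : measurable_fun setT (beta k 0) by exact: measurable_fbm.
apply: ae_eq_integral => //.
- by apply/measurable_EFinP; apply: measurable_funM.
- by apply/measurable_EFinP; apply: measurable_funM; apply: measurable_funB.
- by apply: aeS b0 => om h0 _; rewrite !h0 !subr0.
Qed.

Lemma fbm_marginal_variance (c : 'I_d -> R) t : t \in `[0, T] ->
  (\int[P]_om ((\sum_(k < d) c k * beta k t om) ^+ 2)%:E =
   ((\sum_(k < d) c k ^+ 2) * t `^ (2 * H))%:E)%E.
Proof.
move=> tT.
pose F (p : 'I_d * 'I_d) om := (c p.1 * c p.2) * (beta p.1 t om * beta p.2 t om).
have iF p : P.-integrable setT (EFin \o F p).
  by apply: integrable_scale => //; exact: (fbm_marginal_cov _ _ tT).1.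
have IF p : \int[P]_om F p om = (c p.1 * c p.2) * ((p.1 == p.2)%:R * t `^ (2 * H)).
  by rewrite /F RintegralZl ?(fbm_marginal_cov _ _ tT).2//; exact: (fbm_marginal_cov _ _ tT).1.
have [iS IS] := @Rintegral_bigsum _ _ _ P _ (index_enum ('I_d * 'I_d)%type) setT F measurableT (fun p _ => iF p).
have E om : (\sum_(k < d) c k * beta k t om) ^+ 2 = \sum_p F p om.
  rewrite expr2 mulr_suml -(pair_bigA _ (fun i j => F (i, j) om))/=; apply: eq_bigr => i _.
  by rewrite mulr_sumr; apply: eq_bigr => j _; rewrite /F/=; ring.
under eq_integral do rewrite E.
rewrite -[LHS]fineK; last by apply: integrable_fin_num.
congr EFin; rewrite -/(Rintegral _ _ _) IS.
rewrite -(pair_bigA _ (fun i j => \int[P]_om F (i, j) om))/= mulr_suml.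
apply: eq_bigr => i _; rewrite (bigD1 i)//= big1 ?addr0; last first.
  by move=> j ji; rewrite IF/= eq_sym (negPf ji) mul0r mulr0.
by rewrite IF/= eqxx mul1r expr2.
Qed.

(** The law of [beta t / t ^ H] is standard Gaussian whatever [t] is; this uniformity is what allows
    one probability bound for all small times. *)
Lemma fbm_mgf (a : 'I_d -> R) b t : 0 < t -> t <= T ->
  (\int[P]_om (expR (\sum_(k < d) a k * (beta k t om / t `^ H) + b))%:E =
   (expR ((\sum_(k < d) a k ^+ 2) / 2 + b))%:E)%E.
Proof.
move=> t0 tT; have tI : t \in `[0, T] by rewrite in_itv/= ltW.
have tH : 0 < t `^ H by rewrite powR_gt0.
have G : centered_gaussian P (fun om => \sum_(k < d) (a k / t `^ H) * beta k t om).
  by apply: (@fbm_gaussian d (fun k => a k / t `^ H) id (fun=> t)).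
have V := fbm_marginal_variance (fun k => a k / t `^ H) tI.
have E : (\sum_(k < d) (a k / t `^ H) ^+ 2) * t `^ (2 * H) = \sum_(k < d) a k ^+ 2.
  rewrite mulr_suml; apply: eq_bigr => k _.
  by rewrite [2 * H]mulrC powRrM powR_mulrn ?powR_ge0// -exprMn mulfVK ?gt_eqF.
rewrite E in V; have M := centered_gaussian_mgf G V.
have S om : \sum_(k < d) a k * (beta k t om / t `^ H) = \sum_(k < d) a k / t `^ H * beta k t om.
  by apply: eq_bigr => k _; rewrite mulrAC mulrA.
under eq_integral do rewrite expRD S EFinM.
have mG : measurable_fun setT (fun om => expR (\sum_(k < d) a k / t `^ H * beta k t om)).
  by apply: (measurableT_comp (@measurable_expR R)); case: G.
have mGE : measurable_fun setT (fun om => (expR (\sum_(k < d) a k / t `^ H * beta k t om))%:E : \bar R).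
  exact/measurable_EFinP.
have eb : (0 <= (expR b)%:E)%E by rewrite lee_fin expR_ge0.
have ge om : (0 <= (expR (\sum_(k < d) a k / t `^ H * beta k t om))%:E)%E.
  by rewrite lee_fin expR_ge0.
rewrite ge0_integralZr//.
by rewrite M -EFinM -expRD.
Qed.

(* Exponential tilting: E exp(<c, z> - |c|^2/2) = 1 for the standard Gaussian
   vector z = beta_t / t^H, and under the tilted law z - c is standard. *)
Lemma fbm_support : exists m : R, 0 < m /\ forall c : 'I_d -> R,
  exists p : R, 0 < p /\ forall t, 0 < t -> t <= T ->
  exists2 A : set Omega, measurable A & (p%:E <= P A)%E /\
    forall om, A om -> forall j, `|beta j t om / t `^ H - c j| <= m.
Proof.
(* Large enough that [2 * d * expR (- m ^ 2 / 2) <= 1/2], so the tilted law leaves at least half of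
   its mass in the ball. It does not involve the centre. *)
pose m : R := 4 * d%:R + 1.
have d0 : 0 <= d%:R :> R by [].
have m0 : 0 < m by rewrite ltr_wpDl// mulr_ge0.
(* [K] bounds [<c, z>] on the ball, hence [expR K] bounds the tilting density there. *)
exists m; split => // c; pose K := \sum_(j < d) `|c j| * (`|c j| + m).
exists (expR (- K) / 2); split; first by rewrite divr_gt0 ?expR_gt0.
move=> t t0 tT; have tI : t \in `[0, T] by rewrite in_itv/= ltW.
pose z j om := beta j t om / t `^ H.
have mz j : measurable_fun setT (z j) by apply: measurable_funM => //; exact: measurable_fbm.
pose A := \bigcap_(j in [set: 'I_d]) [set om | `|z j om - c j| <= m].
have mA : measurable A.
  apply: fin_bigcap_measurable => // j _.
  have -> : [set om | `|z j om - c j| <= m] = (fun om => `|z j om - c j|) @^-1` `]-oo, m].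
    by apply/seteqP; split => om /=; rewrite in_itv.
  rewrite -[X in measurable X]setTI; apply: measurable_funTS => //.
  apply: (measurableT_comp (@normr_measurable R _)).
  by apply: measurable_funB.
exists A => //; split; last by move=> om Aom j; exact: Aom.
pose C := \sum_(k < d) c k ^+ 2.
pose ex (a : 'I_d -> R) b om := expR (\sum_(k < d) a k * z k om + b).
have mex (a : 'I_d -> R) b : measurable_fun setT (ex a b).
  apply: (measurableT_comp (@measurable_expR R)); apply: measurable_funD => //.
  by apply: measurable_sum => k; apply: measurable_funM.
have Iex (a : 'I_d -> R) b : (\int[P]_om (ex a b om)%:E = (expR ((\sum_(k < d) a k ^+ 2) / 2 + b))%:E)%E.
  exact: fbm_mgf.
(* Chernoff bound under the tilted law: outside the ball some [|z j - c j|] exceeds [m], and there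
   the density is at most itself times [expR (s * m * (z j - c j) - m ^ 2)] with [s] the sign. This
   is again a Gaussian exponential, tilted by [c] plus or minus [m] in direction [j], with integral
   [expR (- m ^ 2 / 2)]. *)
pose sh (s : R) j k := c k + s * m * (k == j)%:R.
pose tl s j := ex (sh s j) (- C / 2 - s * m * c j - m ^+ 2).
have sumsh s j (F : 'I_d -> R) : \sum_(k < d) (s * m * (k == j)%:R) * F k = s * m * F j.
  rewrite (bigD1 j)//= big1 ?addr0 ?eqxx ?mulr1// => k kj.
  by rewrite (negPf kj) mulr0 mul0r.
have Itl s j : s ^+ 2 = 1 -> (\int[P]_om (tl s j om)%:E = (expR (- (m ^+ 2 / 2)))%:E)%E.
  move=> s1; rewrite /tl Iex; congr (expR _)%:E.
  have -> : \sum_(k < d) sh s j k ^+ 2 = C + 2 * (s * m * c j) + s ^+ 2 * m ^+ 2.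
    transitivity (\sum_(k < d) (c k ^+ 2 + (s * m * (k == j)%:R) * (2 * c k + s * m * (k == j)%:R))).
      by apply: eq_bigr => k _; rewrite /sh; ring.
    by rewrite big_split/= sumsh eqxx -/C /=; move: (C) => C0; ring.
  by rewrite s1; move: (C) (s * m * c j) => C0 y; field.
have tlE s j om : tl s j om = ex c (- C / 2) om * expR (s * m * (z j om - c j) - m ^+ 2).
  rewrite /tl /ex -expRD; congr expR.
  have -> : \sum_(k < d) sh s j k * z k om = \sum_(k < d) c k * z k om + s * m * z j om.
    by rewrite -(sumsh s j (z ^~ om)) -big_split/=; apply: eq_bigr => k _; rewrite /sh; ring.
  by ring.
have e0 (a : R) : (0 <= (expR a)%:E)%E by rewrite lee_fin expR_ge0.
(* Integrated, this reads [1 <= expR K * P A + 2 * d * expR (- m ^ 2 / 2)]. *)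
have ptw om : ex c (- C / 2) om <= expR K * \1_A om + \sum_(j < d) (tl 1 j om + tl (-1) j om).
  have tl0 s j : 0 <= tl s j om by exact: expR_ge0.
  have [Aom|nA] := boolP (om \in A).
    rewrite indicE Aom mulr1 ler_wpDr//; first by apply: sumr_ge0 => j _; rewrite addr_ge0.
    rewrite ler_expR -[leRHS]addr0 lerD//; last first.
      by rewrite mulNr oppr_le0 divr_ge0// sumr_ge0// => k _; exact: sqr_ge0.
    apply: ler_sum => k _; apply: le_trans (ler_norm _) _; rewrite normrM ler_wpM2l//.
    move/set_mem: Aom => /(_ k I)/= h; rewrite -lerBlDl; apply: le_trans h.
    exact: lerB_dist.
  rewrite indicE (negPf nA) mulr0 add0r.
  move: nA; rewrite notin_setE => nA.
  have [j /negP] : exists j, ~ `|z j om - c j| <= m.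
    by apply/existsNP => h; apply: nA => j _; exact: h.
  rewrite -ltNge => hj.
  rewrite (bigD1 j)//= ler_wpDr//; first by apply: sumr_ge0 => k _; rewrite addr_ge0.
  have L0 : 0 <= ex c (- C / 2) om by exact: expR_ge0.
  have [zc|zc] := leP 0 (z j om - c j).
    rewrite ler_wpDr// tlE -[leLHS]mulr1 ler_wpM2l// -[leLHS]expR0 ler_expR.
    by rewrite mul1r expr2 -mulrBr mulr_ge0 ?(ltW m0)// subr_ge0 -(ger0_norm zc) ltW.
  rewrite ler_wpDl// tlE -[leLHS]mulr1 ler_wpM2l// -[leLHS]expR0 ler_expR.
  rewrite mulN1r mulNr -mulrN expr2 -mulrBr mulr_ge0 ?(ltW m0)// subr_ge0.
  by rewrite -(ltr0_norm zc) ltW.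
have mE f : measurable_fun setT f -> measurable_fun setT (fun om : Omega => (f om)%:E : \bar R).
  by move=> ?; apply/measurable_EFinP.
have : (\int[P]_om (ex c (- C / 2) om)%:E <=
  \int[P]_om ((expR K)%:E * (\1_A om)%:E + \sum_(j < d) ((tl 1 j om)%:E + (tl (-1) j om)%:E)))%E.
  apply: ge0_le_integral_nonmeas => om _; first exact: e0.
  apply: le_trans (_ : (expR K * \1_A om + \sum_(j < d) (tl 1 j om + tl (-1) j om))%:E <= _)%E.
    by rewrite lee_fin.
  by rewrite EFinD EFinM -sumEFin.
have i0 om : (0 <= (\1_A om)%:E :> \bar R)%E by rewrite lee_fin.
have mi : measurable_fun setT (fun om => (\1_A om)%:E : \bar R) by apply: mE; exact: measurable_indic.
have q1 om : (0 <= (expR K)%:E * (\1_A om)%:E :> \bar R)%E by rewrite mule_ge0.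
have q2 om : (0 <= \sum_(j < d) ((tl 1 j om)%:E + (tl (-1) j om)%:E))%E.
  by apply: sume_ge0 => j _; rewrite adde_ge0 ?e0.
have q3 : measurable_fun setT (fun om => (expR K)%:E * (\1_A om)%:E : \bar R)%E.
  exact: emeasurable_funM.
have q4 : measurable_fun setT (fun om => \sum_(j < d) ((tl 1 j om)%:E + (tl (-1) j om)%:E))%E.
  by apply: emeasurable_sum => j; apply: emeasurable_funD; exact/mE/mex.
rewrite Iex ge0_integralD//.
rewrite ge0_integralZl// integral_indic// setIT.
have q5 j : measurable_fun setT (fun om => (tl 1 j om)%:E + (tl (-1) j om)%:E)%E.
  by apply: emeasurable_funD; exact/mE/mex.
have q6 j om : setT om -> (0 <= (tl 1 j om)%:E + (tl (-1) j om)%:E)%E.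
  by move=> _; rewrite adde_ge0 ?e0.
rewrite (ge0_integral_sum _ _ q5 q6)//.
have -> : (\sum_(j < d) \int[P]_om ((tl 1 j om)%:E + (tl (-1) j om)%:E) =
  (d%:R * (2 * expR (- (m ^+ 2 / 2))))%:E)%E.
  rewrite mulr_natl -[d in RHS]card_ord -sumr_const -sumEFin; apply: eq_bigr => j _.
  rewrite ge0_integralD//; try by [exact/mE/mex|move=> om _; exact: e0].
  rewrite !Itl ?expr1n// ?sqrrN ?expr1n// -EFinD; congr EFin; ring.
have PA : P A \is a fin_num by exact: fin_num_measure.
have pE := fineK PA => hI; rewrite -[leRHS]pE; move: hI; rewrite -[X in (_ * X)%E]pE.
move: (fine _) => p; rewrite -(EFinM (expR K) p) -EFinD !lee_fin.
have -> : (\sum_(k < d) c k ^+ 2) / 2 + - C / 2 = 0 by rewrite -/C; ring.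
rewrite expR0 => h.
have e1 : expR (- (m ^+ 2 / 2)) * (1 + m ^+ 2 / 2) <= 1.
  rewrite expRN mulrC ler_pdivrMr ?expR_gt0// mul1r; exact: expR_ge1Dx.
have e2 : d%:R * (2 * expR (- (m ^+ 2 / 2))) <= 2^-1.
  have E0 := expR_ge0 (- (m ^+ 2 / 2)); move: (expR _) E0 e1 => E E0.
  have -> : 1 + m ^+ 2 / 2 = 4 * d%:R + (8 * d%:R ^+ 2 + 3 / 2) by rewrite /m; field.
  rewrite mulrDr => e1.
  have : 0 <= E * (8 * d%:R ^+ 2 + 3 / 2) by rewrite mulr_ge0// addr_ge0 ?divr_ge0// mulr_ge0 ?sqr_ge0.
  by move: e1; rewrite (mulrA E 4) (mulrC E 4) -(mulrA 4) (mulrC E) => e1 e3; rewrite mulrCA; lra.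
rewrite expRN mulrC -ler_pdivlMr ?invr_gt0 ?expR_gt0// invrK mulrC.
by lra.
Qed.

End fbm.

(** * Approximation of the Paley-Wiener integral *)

Lemma measurable_bigsum d (X : measurableType d) (R : realType) (I : eqType) (r : seq I) (D : set X)
    (F : I -> X -> R) : (forall i, i \in r -> measurable_fun D (F i)) ->
  measurable_fun D (fun x => \sum_(i <- r) F i x).
Proof.
elim: r => [|i r IH] h.
  rewrite (_ : (fun x => _) = cst 0); first exact: measurable_cst.
  by apply/funext => x; rewrite big_nil.
rewrite (_ : (fun x => _) = (fun x => F i x + \sum_(i <- r) F i x)); last first.
  by apply/funext => x; rewrite big_cons.
apply: measurable_funD; first by apply: h; rewrite mem_head.
by apply: IH => m mr; apply: h; rewrite in_cons mr orbT.
Qed.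

Opaque spaceE.

Section step_functions.
Context {R : realType} (w : R -> R) (hw : admissible_weight w) (T H : R)
  (disp : measure_display) (Omega : measurableType disp) (P : probability Omega R)
  (d : nat) (beta : 'I_d -> R -> Omega -> R).
Context (hT : 0 < T) (hH : 2^-1 < H < 1) (hb : is_fbm P T H beta)
  (E0 : spaceE w (fun=> 0)).
Implicit Types (L : seq (R * R * (R -> R))) (t u v x : R) (h k : R -> R) (j : 'I_d).
Notation mu := (@lebesgue_measure R).
Notation mu2 := (@lebesgue_measure R \x @lebesgue_measure R)%E.

Definition stepsE L : Prop := {in L, forall p, spaceE w p.2}.

Lemma spaceE_sum (I : eqType) (r : seq I) (c : I -> R) (f : I -> R -> R) :
  (forall i, i \in r -> spaceE w (f i)) -> spaceE w (fun x => \sum_(i <- r) c i * f i x).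
Proof.
elim: r => [|i r IH] h.
  by rewrite (_ : (fun x => _) = fun=> 0)//; apply/funext => x; rewrite big_nil.
have h' m : m \in r -> spaceE w (f m) by move=> kr; apply: h; rewrite in_cons kr orbT.
have hi : spaceE w (f i) by apply: h; rewrite mem_head.
have := spaceE_lin hw (c i) 1 hi (IH h').
by congr spaceE; apply/funext => x; rewrite big_cons mul1r.
Qed.

Lemma dotE0 k : spaceE w k -> dotE w (fun=> 0) k = 0.
Proof.
move=> Ek; transitivity (dotE w (fun x => 0 * 0 + 0 * 0) k).
  by congr (dotE w _ k); apply/funext => x; rewrite mul0r addr0.
by rewrite (dotE_lin hw 0 0 E0 E0 Ek) !mul0r addr0.
Qed.

Lemma dotE_sum (I : eqType) (r : seq I) (c : I -> R) (f : I -> R -> R) k :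
  (forall i, i \in r -> spaceE w (f i)) -> spaceE w k ->
  dotE w (fun x => \sum_(i <- r) c i * f i x) k = \sum_(i <- r) c i * dotE w (f i) k.
Proof.
move=> + Ek; elim: r => [|i r IH] h.
  rewrite [RHS]big_nil; transitivity (dotE w (fun=> 0) k); last exact: dotE0.
  by congr (dotE w _ k); apply/funext => x; rewrite big_nil.
have h' m : m \in r -> spaceE w (f m) by move=> kr; apply: h; rewrite in_cons kr orbT.
have hi : spaceE w (f i) by apply: h; rewrite mem_head.
rewrite big_cons -(IH h').
have := dotE_lin hw (c i) 1 hi (spaceE_sum c h') Ek.
rewrite mul1r => <-; congr (dotE w _ k).
by apply/funext => x; rewrite big_cons mul1r.
Qed.

Lemma spaceE_step L u : stepsE L -> spaceE w (step_fun L u).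
Proof. by move=> EL; exact: (spaceE_sum (fun p => \1_(`]p.1.1, p.1.2]%classic) u) EL). Qed.

Lemma dotE_bilinear_sum (I J : eqType) (r : seq I) (s : seq J) (c : I -> R) (e : J -> R)
    (f : I -> R -> R) (g : J -> R -> R) :
  (forall i, i \in r -> spaceE w (f i)) -> (forall i, i \in s -> spaceE w (g i)) ->
  dotE w (fun x => \sum_(i <- r) c i * f i x) (fun x => \sum_(i <- s) e i * g i x) =
  \sum_(i <- r) \sum_(k <- s) c i * e k * dotE w (f i) (g k).
Proof.
move=> hf hg; rewrite (dotE_sum c hf (spaceE_sum e hg)).
apply: eq_big_seq => i ir; rewrite dotEC (dotE_sum e hg (hf i ir)).
by rewrite mulr_sumr; apply: eq_bigr => k _; rewrite dotEC mulrA.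
Qed.

Lemma dotE_step L u v : stepsE L ->
  dotE w (step_fun L u) (step_fun L v) =
  \sum_(p <- L) \sum_(q <- L) \1_(`]p.1.1, p.1.2]%classic) u * \1_(`]q.1.1, q.1.2]%classic) v *
    dotE w p.2 q.2.
Proof. by move=> EL; exact: dotE_bilinear_sum. Qed.

Lemma dotEB h1 h2 k : spaceE w h1 -> spaceE w h2 -> spaceE w k ->
  dotE w (h1 \- h2) k = dotE w h1 k - dotE w h2 k.
Proof.
move=> E1 E2 Ek; transitivity (dotE w (fun x => 1 * h1 x + (-1) * h2 x) k).
  by congr (dotE w _ k); apply/funext => x /=; ring.
by rewrite (dotE_lin hw 1 (-1) E1 E2 Ek) mul1r mulN1r.
Qed.

Lemma dotEBr h1 h2 k : spaceE w h1 -> spaceE w h2 -> spaceE w k ->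
  dotE w k (h1 \- h2) = dotE w k h1 - dotE w k h2.
Proof. by move=> E1 E2 Ek; rewrite (dotEC w k (h1 \- h2)) (dotEB E1 E2 Ek) (dotEC w h1 k) (dotEC w h2 k). Qed.

Lemma normE_triangle h k : spaceE w h -> spaceE w k ->
  normE w (h \- k) <= normE w h + normE w k.
Proof.
move=> Eh Ek; have E1 := spaceEB hw Eh Ek.
rewrite -ler_sqr ?nnegrE ?addr_ge0 ?normE_ge0// (normE_sqr hw (h \- k)).
rewrite (dotEB Eh Ek E1) (dotEBr Eh Ek Eh) (dotEBr Eh Ek Ek).
have := cauchy_schwarzE hw Eh Ek; rewrite ler_norml => /andP[+ _].
have := normE_sqr hw h; have := normE_sqr hw k; rewrite (dotEC w k h).
have := normE_ge0 w h; have := normE_ge0 w k.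
move: (normE w h) (normE w k) (dotE w h h) (dotE w h k) (dotE w k k) => a b p q s.
by move=> b0 a0 <- <- h2; lra.
Qed.

Lemma normE0 : normE w (fun=> 0) = 0.
Proof.
by have /eqP := normE_sqr hw (fun=> 0); rewrite (dotE0 E0) sqrf_eq0 => /eqP.
Qed.

Lemma dotE_cvg (a b : nat -> R -> R) h k :
  (forall n, spaceE w (a n)) -> (forall n, spaceE w (b n)) -> spaceE w h -> spaceE w k ->
  (fun n => normE w (a n \- h)) @ \oo --> (0 : R) ->
  (fun n => normE w (b n \- k)) @ \oo --> (0 : R) ->
  (fun n => dotE w (a n) (b n)) @ \oo --> dotE w h k.
Proof.
move=> Ea Eb Eh Ek ca cb; apply/cvgrPdist_le => e e0.
pose bd n := normE w (a n \- h) * normE w (b n \- k) + normE w (a n \- h) * normE w k + normE w h * normE w (b n \- k).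
have gen (na nb : nat -> R) (c1 c2 : R) : na @ \oo --> (0 : R) -> nb @ \oo --> (0 : R) ->
    (fun n => na n * nb n + na n * c1 + c2 * nb n) @ \oo --> (0 : R).
  move=> ha hb'; rewrite -[X in _ --> X](_ : 0 * 0 + 0 * c1 + c2 * 0 = 0); last by rewrite !mul0r mulr0 !addr0.
  by apply: cvgD; [apply: cvgD|]; apply: cvgM => //; exact: cvg_cst.
have bc : bd @ \oo --> (0 : R) by exact: gen.
have /cvgrPdist_le/(_ _ e0) := bc; apply: filterS => n; rewrite sub0r normrN distrC => h1.
apply: le_trans h1; apply: le_trans (ler_norm _).
have dE : dotE w (a n) (b n) - dotE w h k =
  dotE w (a n \- h) (b n \- k) + dotE w (a n \- h) k + dotE w h (b n \- k).
  rewrite (dotEB (Ea n) Eh (spaceEB hw (Eb n) Ek)) (dotEB (Ea n) Eh Ek).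
  rewrite (dotEBr (Eb n) Ek (Ea n)) (dotEBr (Eb n) Ek Eh).
  by move: (dotE w (a n) (b n)) (dotE w (a n) k) (dotE w h (b n)) (dotE w h k) => *; ring.
have q1 := cauchy_schwarzE hw (spaceEB hw (Ea n) Eh) (spaceEB hw (Eb n) Ek).
have q2 := cauchy_schwarzE hw (spaceEB hw (Ea n) Eh) Ek.
have q3 := cauchy_schwarzE hw Eh (spaceEB hw (Eb n) Ek).
have n3 (x y z X Y Z : R) : `|x| <= X -> `|y| <= Y -> `|z| <= Z -> `|x + y + z| <= X + Y + Z.
  move=> hx hy hz; apply: le_trans (ler_normD _ _) _; apply: lerD => //.
  by apply: le_trans (ler_normD _ _) _; exact: lerD.
by rewrite dE; exact: n3.
Qed.

Lemma measurable_dotE_step L : stepsE L ->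
  measurable_fun setT (fun z : measurableTypeR R * measurableTypeR R =>
    dotE w (step_fun L z.1) (step_fun L z.2) * phiH H (z.1 - z.2)).
Proof.
move=> EL; apply: measurable_funM; last exact: measurable_phiH2.
under eq_fun do rewrite (dotE_step _ _ EL).
apply: measurable_sum => p; apply: measurable_sum => q.
apply: measurable_funM; last exact: measurable_cst.
have mi (a b : R) : measurable_fun setT (\1_(`]a, b]%classic : set (measurableTypeR R)) : measurableTypeR R -> R).
  by exact: measurable_indic.
by apply: measurable_funM; [exact: (measurableT_comp (mi _ _) measurable_fst)|
  exact: (measurableT_comp (mi _ _) measurable_snd)].
Qed.

Lemma normE_step_bounded L : stepsE L -> exists M : R, forall u, normE w (step_fun L u) <= M.
Proof.
move=> EL; exists (Num.sqrt (\sum_(p <- L) \sum_(q <- L) `|dotE w p.2 q.2|)) => u.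
rewrite -[leLHS]ger0_norm ?normE_ge0// -sqrtr_sqr ler_wsqrtr// normE_sqr// dotE_step//.
apply: ler_sum => p _; apply: ler_sum => q _; apply: le_trans (ler_norm _) _.
rewrite normrM ler_piMl// normrM !indicE.
by case: (_ \in _); case: (_ \in _); rewrite ?normr0 ?normr1 ?mul0r ?mulr0 ?mulr1.
Qed.

Lemma stepsE_step t L : is_step w t L -> stepsE L.
Proof. by move=> h p pL; case: (h p pL). Qed.

Lemma pw_normsq_step t L : is_step w t L ->
  pw_normsq w H t (step_fun L) =
  \sum_(p <- L) \sum_(q <- L) dotE w p.2 q.2 * fbm_cov H p.1.1 p.1.2 q.1.1 q.1.2.
Proof.
move=> sL; have EL := stepsE_step sL.
have mD : measurable (`[0%R, t] `*` `[0%R, t] : set (measurableTypeR R * measurableTypeR R)).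
  exact: measurableX.
pose D := (`[0%R, t] `*` `[0%R, t] : set (measurableTypeR R * measurableTypeR R)).
pose F (p q : R * R * (R -> R)) (z : measurableTypeR R * measurableTypeR R) : R :=
  dotE w p.2 q.2 * ((\1_(`]p.1.1, p.1.2] : set R) z.1 * \1_(`]q.1.1, q.1.2] : set R) z.2) * phiH H (z.1 - z.2)).
have FE p q : p \in L -> q \in L -> mu2.-integrable D (EFin \o F p q) /\
    \int[mu2]_(z in D) F p q z = dotE w p.2 q.2 * fbm_cov H p.1.1 p.1.2 q.1.1 q.1.2.
  move=> /sL[p0 p1 pt _] /sL[q0 q1 qt _].
  pose A := (`]p.1.1, p.1.2] `*` `]q.1.1, q.1.2] : set (measurableTypeR R * measurableTypeR R)).
  have mA : measurable A by exact: measurableX.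
  have AD : A `<=` D.
    move=> z [/=]; rewrite !in_itv/= => /andP[a1 a2] /andP[b1 b2].
    split => /=; rewrite in_itv/=; apply/andP; split.
    - exact: le_trans (ltW a1). - exact: le_trans pt.
    - exact: le_trans (ltW b1). - exact: le_trans qt.
  have E z : D z -> (\1_(`]p.1.1, p.1.2] : set R) z.1 * \1_(`]q.1.1, q.1.2] : set R) z.2) * phiH H (z.1 - z.2) =
      ((fun z => phiH H (z.1 - z.2)) \_ A) z.
    move=> _; rewrite patchE !indicE /A.
    have -> : (z \in (`]p.1.1, p.1.2] `*` `]q.1.1, q.1.2])%classic) = (z.1 \in `]p.1.1, p.1.2]%classic) && (z.2 \in `]q.1.1, q.1.2]%classic).
      by apply/idP/andP; rewrite !inE.
    by case: (_ \in _); case: (_ \in _); rewrite /= ?mul0r ?mulr0 ?mul0r ?mul1r.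
  have t0 : 0 <= t by exact: le_trans p0 (le_trans p1 pt).
  have iphi : mu2.-integrable A (EFin \o (fun z => phiH H (z.1 - z.2))).
    by apply: (integrableS mD mA AD); exact: integrable_phiH_square.
  have iG : mu2.-integrable D (EFin \o (fun z => (\1_(`]p.1.1, p.1.2] : set R) z.1 * \1_(`]q.1.1, q.1.2] : set R) z.2) * phiH H (z.1 - z.2))).
    apply: (eq_integrable mD (EFin \o ((fun z => phiH H (z.1 - z.2)) \_ A))).
      by move=> z /set_mem Dz /=; rewrite E.
    rewrite -restrict_EFin; apply/(integrable_mkcond _ mD); rewrite -patch_setI setIC.
    by move/setIidPl : AD => ->; apply/(integrable_mkcond _ mA).
  split; first exact: integrable_scale.
  rewrite RintegralZl//; congr (_ * _); rewrite /Rintegral -[RHS]/(fine (fbm_cov H p.1.1 p.1.2 q.1.1 q.1.2)%:E).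
  rewrite -integral_phiH_rectangle//; congr fine.
  rewrite -/A integral_mkcond [RHS]integral_mkcond; apply: eq_integral => z _.
  rewrite !patchE; case: ifPn => [/set_mem Dz|nD].
    by rewrite E// patchE; case: ifPn.
  by case: ifPn => // /set_mem/AD Dz; move: nD; rewrite mem_set.
have S1 p : p \in L -> mu2.-integrable D (EFin \o (fun z => \sum_(q <- L) F p q z)) /\
    \int[mu2]_(z in D) (\sum_(q <- L) F p q z) = \sum_(q <- L) dotE w p.2 q.2 * fbm_cov H p.1.1 p.1.2 q.1.1 q.1.2.
  move=> pL; have [i1 ->] := Rintegral_bigsum mD (fun q qL => (FE p q pL qL).1).
  by split => //; apply: eq_big_seq => q qL; exact: (FE p q pL qL).2.
have [_ S2] := Rintegral_bigsum mD (fun p pL => (S1 p pL).1).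
transitivity (\int[mu2]_(z in D) (\sum_(p <- L) \sum_(q <- L) F p q z)); last first.
  by rewrite S2; apply: eq_big_seq => p pL; exact: (S1 p pL).2.
rewrite /pw_normsq; apply: eq_Rintegral => z _.
rewrite dotE_step// mulr_suml; apply: eq_bigr => p _; rewrite mulr_suml; apply: eq_bigr => q _.
by rewrite /F; move: (dotE w _ _) (phiH H _) => x y; ring.
Qed.

(** Both sides expand to the same double sum weighted by [fbm_cov]: on one side as covariances, on
    the other as integrals of the kernel over rectangles. *)
Lemma step_isometry t L j : t <= T -> is_step w t L ->
  measurable_fun setT (fun om => normE w (step_integral (beta j) L om) ^+ 2) /\
  (\int[P]_om (normE w (step_integral (beta j) L om) ^+ 2)%:E =
   (pw_normsq w H t (step_fun L))%:E)%E.
Proof.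
move=> tT sL; have EL := stepsE_step sL.
have nE om : normE w (step_integral (beta j) L om) ^+ 2 = \sum_(p <- L) \sum_(q <- L)
    dotE w p.2 q.2 * ((beta j p.1.2 om - beta j p.1.1 om) * (beta j q.1.2 om - beta j q.1.1 om)).
  rewrite normE_sqr// /step_integral dotE_bilinear_sum//.
  apply: eq_bigr => p _; apply: eq_bigr => q _.
  by move: (dotE w _ _) => x; ring.
pose F (p q : R * R * (R -> R)) om : R := dotE w p.2 q.2 *
  ((beta j p.1.2 om - beta j p.1.1 om) * (beta j q.1.2 om - beta j q.1.1 om)).
have FE p q : p \in L -> q \in L -> P.-integrable setT (EFin \o F p q) /\
    \int[P]_z F p q z = dotE w p.2 q.2 * fbm_cov H p.1.1 p.1.2 q.1.1 q.1.2.
  move=> /sL[p0 p1 pt _] /sL[q0 q1 qt _].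
  have I1 : p.1.1 \in `[0, T] by rewrite in_itv/= p0 (le_trans p1)// (le_trans pt).
  have I2 : p.1.2 \in `[0, T] by rewrite in_itv/= (le_trans p0)//= (le_trans pt).
  have I3 : q.1.1 \in `[0, T] by rewrite in_itv/= q0 (le_trans q1)// (le_trans qt).
  have I4 : q.1.2 \in `[0, T] by rewrite in_itv/= (le_trans q0)//= (le_trans qt).
  have [i1 i2] := fbm_covariance hb j I1 I2 I3 I4.
  split; first exact: integrable_scale.
  by rewrite RintegralZl// i2.
have S1 p : p \in L -> P.-integrable setT (EFin \o (fun z => \sum_(q <- L) F p q z)) /\
    \int[P]_z (\sum_(q <- L) F p q z) = \sum_(q <- L) dotE w p.2 q.2 * fbm_cov H p.1.1 p.1.2 q.1.1 q.1.2.
  move=> pL; have [i1 ->] := Rintegral_bigsum measurableT (fun q qL => (FE p q pL qL).1).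
  by split => //; apply: eq_big_seq => q qL; exact: (FE p q pL qL).2.
have [i2 S2] := Rintegral_bigsum measurableT (fun p pL => (S1 p pL).1).
under eq_fun do rewrite nE; split; first exact: integrable_measurable i2.
under eq_integral do rewrite nE.
rewrite (pw_normsq_step sL) -[LHS]fineK; last by apply: integrable_fin_num.
by congr EFin; rewrite -/(Rintegral _ _ _) S2; apply: eq_big_seq => p pL; exact: (S1 p pL).2.
Qed.

Lemma spaceE_step_integral t L (b : R -> Omega -> R) om : is_step w t L ->
  spaceE w (step_integral b L om).
Proof.
by move=> sL; exact: (spaceE_sum (fun p => b p.1.2 om - b p.1.1 om) (stepsE_step sL)).
Qed.

Lemma step_eval t L j x : t <= T -> 0 <= x -> is_step w t L ->
  (\int[P]_om (step_integral (beta j) L om x ^+ 2)%:E <=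
   ((1 + Num.sqrt x) ^+ 2 * pw_normsq w H t (step_fun L))%:E)%E.
Proof.
move=> tT x0 sL; have [mN IN] := step_isometry j tT sL; have EL := stepsE_step sL.
have mE : measurable_fun setT (fun om => (normE w (step_integral (beta j) L om) ^+ 2)%:E).
  exact/measurable_EFinP.
have N0 om : setT om -> (0 <= (normE w (step_integral (beta j) L om) ^+ 2)%:E)%E.
  by move=> _; rewrite lee_fin sqr_ge0.
have c0 : (0 <= ((1 + Num.sqrt x) ^+ 2)%:E)%E by rewrite lee_fin sqr_ge0.
rewrite EFinM -IN -(ge0_integralZl _ measurableT mE N0 c0)//.
apply: ge0_le_integral_nonmeas => om _; first by rewrite lee_fin sqr_ge0.
rewrite -EFinM lee_fin -exprMn -real_normK ?num_real// ler_sqr ?nnegrE ?mulr_ge0 ?addr_ge0 ?sqrtr_ge0 ?normE_ge0//.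
have ES := spaceE_sum (fun p => beta j p.1.2 om - beta j p.1.1 om) EL.
exact: (spaceE_eval hw ES x0).
Qed.

Definition grid t n (i : nat) : R := t * i%:R / n.+1%:R.

(** The integrand [u |-> right_shift (t - u) h] frozen at the left ends of [n.+1] equal cells. The
    cells are half open, so the step function vanishes at [u = 0]. *)
Definition grid_steps t n h : seq (R * R * (R -> R)) :=
  [seq (grid t n i, grid t n i.+1, right_shift (t - grid t n i) h) | i <- iota 0 n.+1].

Lemma grid0 t n : grid t n 0 = 0. Proof. by rewrite /grid mulr0 mul0r. Qed.

Lemma gridn t n : grid t n n.+1 = t. Proof. by rewrite /grid mulfK. Qed.

Lemma grid_nondecreasing t n i m : 0 <= t -> (i <= m)%N -> grid t n i <= grid t n m.
Proof. by move=> t0 im; rewrite ler_pM2r ?invr_gt0// ler_wpM2l// ler_nat. Qed.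

Lemma gridS t n i : grid t n i.+1 = grid t n i + t / n.+1%:R.
Proof. by rewrite /grid -natr1 mulrDr mulr1 mulrDl. Qed.

Lemma nondecreasing_cell (a : nat -> R) m u : a 0%N < u -> u <= a m ->
  exists2 i, (i < m)%N & a i < u <= a i.+1.
Proof.
elim: m => [|m IH] a0 am; first by move: a0; rewrite ltNge am.
have [um|mu] := leP u (a m); last by exists m => //; rewrite mu.
by have [i im hi] := IH a0 um; exists i => //; exact: ltnW.
Qed.

(** * Discretisation of the integrand on a uniform grid *)

Section grid.
Context (t : R) (t0 : 0 < t) (h : R -> R) (Eh : spaceE w h)
  (Esh : forall s, 0 <= s -> s <= t -> spaceE w (right_shift s h)).

Lemma grid_itv n i : (i <= n.+1)%N -> 0 <= grid t n i /\ grid t n i <= t.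
Proof.
move=> ni; split; first by rewrite -(grid0 t n); by apply: grid_nondecreasing; rewrite ?(ltW t0).
by rewrite -[leRHS](gridn t n); by apply: grid_nondecreasing; rewrite ?(ltW t0).
Qed.

Lemma is_step_grid n : is_step w t (grid_steps t n h).
Proof.
move=> p /mapP[i]; rewrite mem_iota /= add0n => ni ->/=.
have [a0 at_] := grid_itv (ltnW ni); have [b0 bt] := grid_itv ni.
have ab : grid t n i <= grid t n i.+1 by apply: grid_nondecreasing; rewrite ?(ltW t0).
have s0 : 0 <= t - grid t n i by rewrite subr_ge0.
have st : t - grid t n i <= t by rewrite lerBlDr lerDl.
exact: (And4 a0 ab bt (Esh s0 st)).
Qed.

Lemma step_fun_grid n u : 0 < u -> u <= t -> exists v,
  [/\ 0 <= v, v <= u, u - v <= t / n.+1%:R & step_fun (grid_steps t n h) u = right_shift (t - v) h].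
Proof.
move=> u0 ut; have [||i im /andP[iu ui]] := @nondecreasing_cell (grid t n) n.+1 u.
- by rewrite grid0.
- by rewrite gridn.
exists (grid t n i); split.
- by have [] := grid_itv (ltnW im).
- exact: ltW.
- by rewrite lerBlDl -gridS.
apply/funext => x; rewrite /step_fun big_map (bigD1_seq i) ?iota_uniq ?mem_iota//=.
rewrite indicE mem_set; last by rewrite /= in_itv/= iu.
rewrite mul1r big1 ?addr0// => k ki; rewrite indicE memNset ?mul0r//= in_itv/=.
move=> /andP[ku uk]; case: (ltngtP k i) ki => // [ki|ik] _.
  by have := lt_le_trans iu uk; rewrite ltNge grid_nondecreasing// (ltW t0).
by have := lt_le_trans ku ui; rewrite ltNge grid_nondecreasing// (ltW t0).
Qed.

Lemma step_fun_grid0 n : step_fun (grid_steps t n h) 0 = fun=> 0.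
Proof.
apply/funext => x; rewrite /step_fun big_map big1_seq// => k /andP[_].
rewrite mem_iota /= add0n => kn; rewrite indicE memNset ?mul0r//= in_itv/=.
by have [k0 _] := grid_itv (ltnW kn); rewrite ltNge k0.
Qed.

Definition neg_steps L : seq (R * R * (R -> R)) := [seq (p.1, fun x => - p.2 x) | p <- L].

Lemma step_fun_sub L1 L2 u : step_fun (L1 ++ neg_steps L2) u = step_fun L1 u \- step_fun L2 u.
Proof.
apply/funext => x; rewrite /step_fun big_cat/= big_map -sumrN; congr (_ + _).
by apply: eq_bigr => p _; rewrite mulrN.
Qed.

Lemma is_step_sub L1 L2 : is_step w t L1 -> is_step w t L2 -> is_step w t (L1 ++ neg_steps L2).
Proof.
move=> s1 s2 p; rewrite mem_cat => /orP[|/mapP[q /s2[q0 q1 q2 Eq] ->]]; first exact: s1.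
have E : spaceE w (fun x => - q.2 x).
  have := spaceE_lin hw (-1) 0 Eq Eq; congr spaceE; apply/funext => x.
  by rewrite mulN1r mul0r addr0.
exact: (And4 q0 q1 q2 E).
Qed.

Lemma step_integral_sub (b : R -> Omega -> R) L1 L2 om x :
  step_integral b (L1 ++ neg_steps L2) om x = step_integral b L1 om x - step_integral b L2 om x.
Proof.
rewrite /step_integral big_cat/= big_map -sumrN; congr (_ + _).
by apply: eq_bigr => p _; rewrite mulrN.
Qed.

(** The grid functions converge to the integrand in norm by strong continuity of the shifts, and the
    integrands are dominated by a multiple of [phiH]. The fixed step function [L] is subtracted
    throughout because the given integral is known only through unspecified step functions. *)
Lemma pw_normsq_grid_cvg L : is_step w t L ->
  (fun n => pw_normsq w H t (step_fun (grid_steps t n h ++ neg_steps L))) @ \oo -->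
  pw_normsq w H t (fun u => right_shift (t - u) h \- step_fun L u).
Proof.
move=> sL; have EL := stepsE_step sL.
pose f u := right_shift (t - u) h.
have Ef u : 0 <= u -> u <= t -> spaceE w (f u).
  by move=> u0 ut; apply: Esh; rewrite ?subr_ge0// lerBlDr lerDl.
pose D := (`[0%R, t] `*` `[0%R, t] : set (measurableTypeR R * measurableTypeR R)).
have mD : measurable D by exact: measurableX.
pose S n := grid_steps t n h ++ neg_steps L.
(* An extra cell []-1, 0]] carrying the value at 0 makes the convergence hold at every point of the
   square, so that the limit [F] is measurable as a limit of measurable functions. Only [S n], which
   differs on two null lines, enters the integrals. *)
pose S0 n := (-1, 0, f 0) :: S n.
have sS n : is_step w t (S n) by apply: is_step_sub sL; exact: is_step_grid.
have ES n : stepsE (S n) by exact: stepsE_step (sS n).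
have ES0 n : stepsE (S0 n).
  by move=> p; rewrite in_cons => /predU1P[->/=|]; [apply: Ef => //; exact: ltW|exact: ES].
have S0E n u : 0 <= u -> step_fun (S0 n) u = if u == 0 then f 0 \- step_fun L 0 else step_fun (S n) u.
  move=> u0; apply/funext => x; rewrite {1}/step_fun big_cons -/(step_fun (S n) u x) indicE.
  have [->|un0] := eqVneq u 0.
    rewrite mem_set; last by rewrite /= in_itv/= lexx ltrN10.
    by rewrite mul1r /S step_fun_sub step_fun_grid0 /= add0r.
  rewrite memNset ?mul0r ?add0r//= in_itv/= => /andP[_ ule].
  by move: un0; rewrite eq_le ule u0.
pose F z := dotE w (f z.1 \- step_fun L z.1) (f z.2 \- step_fun L z.2) * phiH H (z.1 - z.2).
pose Fn n z := dotE w (step_fun (S n) z.1) (step_fun (S n) z.2) * phiH H (z.1 - z.2).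
pose Gn n z := dotE w (step_fun (S0 n) z.1) (step_fun (S0 n) z.2) * phiH H (z.1 - z.2).
have mFn n : measurable_fun D (Fn n : measurableTypeR R * measurableTypeR R -> R).
  by apply: measurable_funTS; exact: measurable_dotE_step.
have mGn n : measurable_fun D (Gn n : measurableTypeR R * measurableTypeR R -> R).
  by apply: measurable_funTS; exact: measurable_dotE_step.
have Efs u : 0 <= u -> u <= t -> spaceE w (f u \- step_fun L u).
  by move=> u0 ut; exact: (spaceEB hw (Ef u u0 ut) (spaceE_step u EL)).
have ncvg u : 0 <= u -> u <= t ->
    (fun n => normE w (step_fun (S0 n) u \- (f u \- step_fun L u))) @ \oo --> (0 : R).
  move=> u0 ut; have [uz|un0] := eqVneq u 0.
    have -> : (fun n => normE w (step_fun (S0 n) u \- (f u \- step_fun L u))) = fun=> 0.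
      apply/funext => n; rewrite S0E// uz eqxx -[RHS]normE0; congr normE.
      by apply/funext => x /=; exact: subrr.
    exact: cvg_cst.
  have ugt : 0 < u by rewrite lt_neqAle eq_sym un0.
  have /choice[v hv] := fun n => step_fun_grid n ugt ut.
  have vt n : v n <= t by case: (hv n) => _ vu _ _; exact: le_trans ut.
  have E n : step_fun (S0 n) u \- (f u \- step_fun L u) = right_shift (t - v n) h \- right_shift (t - u) h.
    rewrite (S0E n u u0) (negPf un0) step_fun_sub; have [_ _ _ ->] := hv n.
    by apply/funext => x /=; rewrite /f; ring.
  rewrite (_ : (fun n => _) = (fun n => normE w (right_shift (t - v n) h \- right_shift (t - u) h))); last first.
    by apply/funext => n; rewrite E.
  have v0 n : 0 <= v n by case: (hv n).
  have tv0 n : 0 <= t - v n by rewrite subr_ge0.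
  have tvt n : t - v n <= t by rewrite lerBlDr lerDl.
  have tu0 : 0 <= t - u by rewrite subr_ge0.
  have tut : t - u <= t by rewrite lerBlDr lerDl.
  apply: (right_shift_continuous hw Eh tv0 tu0 (fun n => Esh (tv0 n) (tvt n)) (Esh tu0 tut)).
  apply: cvgB; first exact: cvg_cst.
  apply/cvgrPdist_le => e e0.
  have tn : (fun n => t / n.+1%:R) @ \oo --> (0 : R).
    rewrite -[X in _ --> X](mulr0 t); apply: cvgM; first exact: cvg_cst.
    exact: cvg_harmonic.
  have /cvgrPdist_le/(_ _ e0) := tn; apply: filterS => n; rewrite sub0r normrN.
  case: (hv n) => _ vu h2 _ h1; rewrite ger0_norm ?subr_ge0//.
  by apply: le_trans h2 (le_trans (ler_norm _) h1).
have ES0' n u : spaceE w (step_fun (S0 n) u) by exact: (spaceE_step u (ES0 n)).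
have cvgG z : D z -> (fun n => Gn n z) @ \oo --> F z.
  move=> [/=]; rewrite !in_itv/= => /andP[a1 a2] /andP[b1 b2].
  apply: cvgM; last exact: cvg_cst.
  exact: (dotE_cvg (fun n => ES0' n z.1) (fun n => ES0' n z.2) (Efs _ a1 a2) (Efs _ b1 b2)
    (ncvg _ a1 a2) (ncvg _ b1 b2)).
have mF : measurable_fun D (F : measurableTypeR R * measurableTypeR R -> R).
  exact: (measurable_fun_cvg mGn cvgG).
have [M2 hM2] := normE_step_bounded EL.
pose M1 := (2 + Num.sqrt t) * normE w h.
have M1ge u : 0 <= u -> u <= t -> normE w (f u) <= M1.
  move=> u0 ut; have tu : 0 <= t - u by rewrite subr_ge0.
  have tut : t - u <= t by rewrite lerBlDr lerDl.
  apply: le_trans (normE_shift_le hw tu Eh (Esh tu tut)) _.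
  by apply: ler_wpM2r; [exact: normE_ge0|rewrite lerD2l; exact: ler_wsqrtr].
have M10 : 0 <= M1 by apply: le_trans (M1ge 0 _ _) => //; [exact: normE_ge0|exact: ltW].
have M20 : 0 <= M2 by exact: le_trans (normE_ge0 w _) (hM2 0).
have bF n u : 0 <= u -> u <= t -> normE w (step_fun (S n) u) <= M1 + M2.
  move=> u0 ut; rewrite /S step_fun_sub.
  have Eg : spaceE w (step_fun (grid_steps t n h) u) by exact/spaceE_step/stepsE_step/is_step_grid.
  apply: le_trans (normE_triangle Eg (spaceE_step u EL)) _; apply: lerD => //.
  have [uz|un0] := eqVneq u 0; first by rewrite uz step_fun_grid0 normE0.
  have ugt : 0 < u by rewrite lt_neqAle eq_sym un0.
  have [v [v0 vu _ ->]] := step_fun_grid n ugt ut.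
  by apply: M1ge => //; exact: le_trans ut.
have iphi := integrable_phiH_square hH (ltW t0).
have ibd : mu2.-integrable D (EFin \o (fun z => (M1 + M2) ^+ 2 * phiH H (z.1 - z.2))).
  exact: integrable_scale.
have aecvg : {ae mu2, forall z, D z -> (fun n => Fn n z) @ \oo --> F z}.
  have ne0 : {ae mu2, forall z, z.1 != 0 /\ z.2 != 0}.
    have n1 : {ae mu2, forall z, z.1 != 0}.
      exists ([set 0] `*` setT : set (measurableTypeR R * measurableTypeR R)); split.
      - exact: measurableX.
      - by rewrite /= product_measure1E// [X in (X * _)%E](_ : _ = 0%E) ?mul0e//; exact: lebesgue_measure_set1.
      - by move=> z /= /negP; rewrite negbK => /eqP.
    have n2 : {ae mu2, forall z, z.2 != 0}.
      exists (setT `*` [set 0] : set (measurableTypeR R * measurableTypeR R)); split.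
      - exact: measurableX.
      - by rewrite /= product_measure1E// [X in (_ * X)%E](_ : _ = 0%E) ?mule0//; exact: lebesgue_measure_set1.
      - by move=> z /= /negP; rewrite negbK => /eqP.
    exact: (@filterI _ _ (ae_filter_ringOfSetsType mu2) _ _ n1 n2).
  apply: aeS ne0 => z [z1 z2] Dz.
  rewrite (_ : (fun n => Fn n z) = (fun n => Gn n z)); first exact: cvgG.
  apply/funext => n.
  case: Dz => /=; rewrite !in_itv/= => /andP[a1 _] /andP[b1 _].
  by rewrite /Gn /Fn (S0E n _ a1) (S0E n _ b1) (negPf z1) (negPf z2).
have bdn n z : D z -> `|Fn n z| <= (M1 + M2) ^+ 2 * phiH H (z.1 - z.2).
  move=> [/=]; rewrite !in_itv/= => /andP[a1 a2] /andP[b1 b2].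
  rewrite normrM (ger0_norm (phiH_ge0 hH _)); apply: ler_wpM2r; first exact: phiH_ge0.
  apply: le_trans (cauchy_schwarzE hw (spaceE_step _ (ES n)) (spaceE_step _ (ES n))) _.
  by rewrite expr2; apply: ler_pM; (try exact: normE_ge0); exact: bF.
by have [_] := Rintegral_dominated mD mFn mF aecvg ibd bdn.
Qed.

(** At [x] the deviation is a combination of grid increments with coefficients bounded by [om0]. As
    all covariances between increments are nonnegative, its variance is at most [om0 ^ 2] times that
    of the sum of the increments, which telescopes to [t ^ (2 * H)]. *)
Lemma step_integral_grid_dev n j x om0 : t <= T -> 0 <= x -> 0 <= om0 ->
  (forall s, 0 <= s -> s <= t -> `|h (x + s) - h x| <= om0) ->
  measurable_fun setT (fun om => step_integral (beta j) (grid_steps t n h) om x) /\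
  (\int[P]_om ((step_integral (beta j) (grid_steps t n h) om x - h x * (beta j t om - beta j 0 om)) ^+ 2)%:E
   <= (om0 ^+ 2 * t `^ (2 * H))%:E)%E.
Proof.
move=> tT x0 o0 ho.
pose D i om := beta j (grid t n i.+1) om - beta j (grid t n i) om.
pose g i := h (t - grid t n i + x) - h x.
have gI i : i \in iota 0 n.+1 -> grid t n i \in `[0, T] /\ grid t n i.+1 \in `[0, T].
  rewrite mem_iota /= add0n => ni; rewrite !in_itv/=.
  have [a0 at_] := grid_itv (ltnW ni); have [b0 bt] := grid_itv ni.
  by rewrite a0 b0 !(le_trans _ tT).
have siE om : step_integral (beta j) (grid_steps t n h) om x =
    \sum_(i <- iota 0 n.+1) D i om * h (t - grid t n i + x).
  by rewrite /step_integral big_map.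
have tel om : beta j t om - beta j 0 om = \sum_(i <- iota 0 n.+1) D i om.
  rewrite -[iota _ _]/(index_iota 0 n.+1) (telescope_sumr (fun i => beta j (grid t n i) om))//.
  by rewrite gridn grid0.
have devE om : step_integral (beta j) (grid_steps t n h) om x - h x * (beta j t om - beta j 0 om) =
    \sum_(i <- iota 0 n.+1) g i * D i om.
  rewrite siE tel mulr_sumr -sumrB; apply: eq_bigr => i _; rewrite /g; ring.
split.
  rewrite (_ : (fun om => _) = (fun om => \sum_(i <- iota 0 n.+1) D i om * h (t - grid t n i + x))); last exact/funext.
  apply: measurable_bigsum => i /gI[i1 i2]; apply: measurable_funM; last exact: measurable_cst.
  by apply: measurable_funB; exact: (measurable_fbm hb).
pose cov (i k : nat) := fbm_cov H (grid t n i) (grid t n i.+1) (grid t n k) (grid t n k.+1).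
have DD (i k : nat) : i \in iota 0 n.+1 -> k \in iota 0 n.+1 ->
    P.-integrable setT (EFin \o (fun om => D i om * D k om)) /\ \int[P]_om (D i om * D k om) = cov i k.
  by move=> /gI[i1 i2] /gI[k1 k2]; exact: (fbm_covariance hb j i1 i2 k1 k2).
have quad (c : nat -> R) : P.-integrable setT (EFin \o (fun om => (\sum_(i <- iota 0 n.+1) c i * D i om) ^+ 2)) /\
   \int[P]_om ((\sum_(i <- iota 0 n.+1) c i * D i om) ^+ 2) =
   \sum_(i <- iota 0 n.+1) \sum_(k <- iota 0 n.+1) c i * c k * cov i k.
  have E om : (\sum_(i <- iota 0 n.+1) c i * D i om) ^+ 2 =
      \sum_(i <- iota 0 n.+1) \sum_(k <- iota 0 n.+1) (c i * c k) * (D i om * D k om).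
    rewrite expr2 mulr_suml; apply: eq_bigr => i _; rewrite mulr_sumr; apply: eq_bigr => k _; ring.
  have S1 i : i \in iota 0 n.+1 ->
      P.-integrable setT (EFin \o (fun om => \sum_(k <- iota 0 n.+1) (c i * c k) * (D i om * D k om))) /\
      \int[P]_om (\sum_(k <- iota 0 n.+1) (c i * c k) * (D i om * D k om)) = \sum_(k <- iota 0 n.+1) c i * c k * cov i k.
    move=> ir.
    have isc (k : nat) : k \in iota 0 n.+1 -> P.-integrable setT (EFin \o (fun om => (c i * c k) * (D i om * D k om))).
      by move=> kr; apply: integrable_scale => //; exact: (DD i k ir kr).1.
    have [i1 ->] := Rintegral_bigsum measurableT isc.
    split => //; apply: eq_big_seq => k kr; rewrite RintegralZl//; last exact: (DD i k ir kr).1.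
    by rewrite (DD i k ir kr).2.
  have [i1 i2] := Rintegral_bigsum measurableT (fun i ir => (S1 i ir).1).
  under eq_fun do rewrite E; split; first by [].
  by rewrite i2; apply: eq_big_seq => i ir; exact: (S1 i ir).2.
have [ig Ig] := quad g; have [i1 I1] := quad (fun=> 1).
have V : \int[P]_om ((\sum_(i <- iota 0 n.+1) 1 * D i om) ^+ 2) = t `^ (2 * H).
  have O : (0 : R) \in `[0, T] by rewrite in_itv/= lexx ltW.
  have tI : t \in `[0, T] by rewrite in_itv/= (ltW t0).
  have := integral_fbm_increment_sqr hb j O tI; rewrite subr0 ger0_norm ?(ltW t0)// => VE.
  rewrite /Rintegral -[RHS]/(fine (t `^ (2 * H))%:E) -VE; congr fine.
  by apply: eq_integral => om _; rewrite tel; congr (_ ^+ 2)%:E; apply: eq_bigr => i _; rewrite mul1r.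
under eq_integral do rewrite devE.
rewrite -[leLHS]fineK; last by apply: integrable_fin_num.
rewrite lee_fin -/(Rintegral _ _ _) Ig -V I1 mulr_sumr big_seq [leRHS]big_seq.
apply: ler_sum => i ir; rewrite mulr_sumr big_seq [leRHS]big_seq; apply: ler_sum => k kr.
have c0 : 0 <= cov i k.
  by apply: fbm_cov_ge0 => //; apply: grid_nondecreasing => //; exact: ltW.
rewrite mul1r mul1r; apply: ler_wpM2r => //; apply: le_trans (ler_norm _) _.
have hg m : m \in iota 0 n.+1 -> `|g m| <= om0.
  rewrite mem_iota /= add0n => mn; have [a0 at_] := grid_itv (ltnW mn).
  by rewrite /g (addrC _ x); apply: ho; rewrite ?subr_ge0// lerBlDr lerDl.
by rewrite normrM expr2; apply: ler_pM => //; exact: hg.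
Qed.

(** The grid bound is transferred to the actual integral: [Y] is close to some step integral, and by
    the isometry that one is close to a grid integral. The 3 comes from squaring a sum of three
    terms. *)
Lemma pw_integral_dev j x (e : R) (Y : Omega -> R -> R) : t <= T -> 0 <= x -> 0 <= e ->
  (forall s, 0 <= s -> s <= t -> `|h (x + s) - h x| <= e) ->
  is_pw_integral P w H t (beta j) (fun s => right_shift (t - s) h) Y ->
  (\int[P]_om ((Y om x - h x * (beta j t om - beta j 0 om)) ^+ 2)%:E <=
   (3 * (e ^+ 2 * t `^ (2 * H)))%:E)%E.
Proof.
move=> tT x0 ee he [_ _ mY [s [sS Bs Es]]].
have EY om : spaceE w (Y om) := mY.1 om I.
have mYx : measurable_fun setT (fun om => Y om x) by exact: (measurable_eval hw measurableT x0 mY).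
pose K : R := (1 + Num.sqrt x) ^+ 2.
have K0 : 0 < K by rewrite exprn_gt0// ltr_wpDr ?sqrtr_ge0.
apply/lee_addgt0Pr => eps eps0.
(* The errors [A] and [B] each contribute [3 * K * del], together [eps]. *)
pose del := eps / (6 * K).
have del0 : 0 < del by rewrite divr_gt0 ?mulr_gt0.
have hB : \forall n \near \oo, pw_normsq w H t (fun u => right_shift (t - u) h \- step_fun (s n) u) < del.
  exact: (cvgr_lt _ Bs).
have hE : \forall n \near \oo, (expectation P (fun om => (normE w (Y om \- step_integral (beta j) (s n) om) ^+ 2)%R) < del%:E)%E.
  exact: (Es _ (open_nbhs_nbhs (conj (@open_ereal_lt_ereal R _) (_ : (0 < del%:E)%E)))).
have [n _ /(_ n (leqnn n)) [Bn En]] := filterI hB hE.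
have hG : \forall m \near \oo, pw_normsq w H t (step_fun (grid_steps t m h ++ neg_steps (s n))) < del.
  exact: (cvgr_lt _ (pw_normsq_grid_cvg (sS n))).
have [m _ /(_ m (leqnn m)) Gm] := hG.
pose S := grid_steps t m h ++ neg_steps (s n).
have sSS : is_step w t S by apply: is_step_sub (sS n); exact: is_step_grid.
have [mC IC] := step_integral_grid_dev m j tT x0 ee he.
have IB := step_eval j tT x0 sSS.
have mI n' : measurable_fun setT (fun om => step_integral (beta j) (s n') om x).
  apply: measurable_bigsum => p ps; apply: measurable_funM; last exact: measurable_cst.
  case: (sS n' p ps) => p0 p1 pt _.
  by apply: measurable_funB; apply: (measurable_fbm hb); rewrite in_itv/= ?p0 ?(le_trans p1)// ?(le_trans p0)//= ?(le_trans pt)// (le_trans p1)// (le_trans pt).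
pose A om := Y om x - step_integral (beta j) (s n) om x.
pose B om := step_integral (beta j) S om x.
pose C om := step_integral (beta j) (grid_steps t m h) om x - h x * (beta j t om - beta j 0 om).
have mA : measurable_fun setT A by exact: measurable_funB.
have mB : measurable_fun setT B.
  rewrite (_ : B = fun om => step_integral (beta j) (grid_steps t m h) om x - step_integral (beta j) (s n) om x); first exact: measurable_funB.
  by apply/funext => om; exact: step_integral_sub.
have mb : measurable_fun setT (fun om => h x * (beta j t om - beta j 0 om)).
  apply: measurable_funM; first exact: measurable_cst.
  by apply: measurable_funB; apply: (measurable_fbm hb); rewrite in_itv/= ?lexx ?(ltW hT) ?(ltW t0).
have mC' : measurable_fun setT C by exact: measurable_funB.
have sqE (f : Omega -> R) : measurable_fun setT f -> measurable_fun setT (fun om => (f om ^+ 2)%:E : \bar R).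
  by move=> mf; apply/measurable_EFinP; exact: measurable_funX.
have sq0 (f : Omega -> R) om : setT om -> (0 <= (f om ^+ 2)%:E :> \bar R)%E.
  by move=> _; rewrite lee_fin sqr_ge0.
have IA : (\int[P]_om (A om ^+ 2)%:E <= (K * del)%:E)%E.
  have h1 : (\int[P]_om ((K^-1)%:E * (A om ^+ 2)%:E) <= del%:E)%E.
    apply: le_trans (ltW En); rewrite unlock; apply: ge0_le_integral_nonmeas => om _.
      by rewrite -EFinM lee_fin mulr_ge0 ?sqr_ge0// invr_ge0 ltW.
    rewrite -EFinM lee_fin mulrC ler_pdivrMr// mulrC /K -exprMn -(real_normK (num_real (A om))).
    have Es' := spaceE_step_integral (beta j) om (sS n).
    rewrite ler_sqr ?nnegrE ?mulr_ge0 ?addr_ge0 ?sqrtr_ge0 ?normE_ge0//.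
    exact: (spaceE_eval hw (spaceEB hw (EY om) Es') x0).
  have k0 : (0 <= (K^-1)%:E)%E by rewrite lee_fin invr_ge0 ltW.
  rewrite (ge0_integralZl _ measurableT (sqE A mA) (sq0 A) k0) in h1.
  have := lee_wpmul2l (_ : 0 <= K%:E)%E h1.
  rewrite muleA -!EFinM divff ?gt_eqF// mul1e; apply.
  by rewrite lee_fin ltW.
have IB' : (\int[P]_om (B om ^+ 2)%:E <= (K * del)%:E)%E.
  by apply: (le_trans IB); rewrite lee_fin; exact: (ler_wpM2l (ltW K0) (ltW Gm)).
have c3 : (0 <= (3 : R)%:E)%E by rewrite lee_fin.
have main : (\int[P]_om ((Y om x - h x * (beta j t om - beta j 0 om)) ^+ 2)%:E <=
  \int[P]_om ((3 : R)%:E * ((A om ^+ 2)%:E + ((B om ^+ 2)%:E + (C om ^+ 2)%:E))))%E.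
  apply: ge0_le_integral_nonmeas => om _; first by rewrite lee_fin sqr_ge0.
  rewrite -!EFinD -EFinM lee_fin.
  have -> : Y om x - h x * (beta j t om - beta j 0 om) = A om - B om + C om.
    by rewrite /A /B /C step_integral_sub; ring.
  move: (A om) (B om) (C om) => a b c.
  rewrite -subr_ge0 (_ : _ - _ = (a + b) ^+ 2 + (a - c) ^+ 2 + (b + c) ^+ 2); last by ring.
  by rewrite addr_ge0 ?sqr_ge0// addr_ge0 ?sqr_ge0.
apply: (le_trans main).
have mBC : measurable_fun setT (fun om => (B om ^+ 2)%:E + (C om ^+ 2)%:E)%E by apply: emeasurable_funD; exact: sqE.
have mABC : measurable_fun setT (fun om => (A om ^+ 2)%:E + ((B om ^+ 2)%:E + (C om ^+ 2)%:E))%E.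
  by apply: emeasurable_funD => //; exact: sqE.
have gBC om : setT om -> (0 <= (B om ^+ 2)%:E + (C om ^+ 2)%:E)%E by move=> _; rewrite adde_ge0 ?lee_fin ?sqr_ge0.
have gABC om : setT om -> (0 <= (A om ^+ 2)%:E + ((B om ^+ 2)%:E + (C om ^+ 2)%:E))%E.
  by move=> _; rewrite !adde_ge0 ?lee_fin ?sqr_ge0.
rewrite (ge0_integralZl _ measurableT mABC gABC c3).
rewrite (ge0_integralD _ measurableT (sq0 A) (sqE A mA) gBC mBC).
rewrite (ge0_integralD _ measurableT (sq0 B) (sqE B mB) (sq0 C) (sqE C mC')).
have -> : ((3 * (e ^+ 2 * t `^ (2 * H)))%:E + eps%:E = 3%:E * ((K * del)%:E + ((K * del)%:E + (e ^+ 2 * t `^ (2 * H))%:E)))%E.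
  rewrite -!EFinD -EFinM; congr EFin; rewrite /del; field; by rewrite gt_eqF.
by apply: (lee_wpmul2l c3); apply: leeD => //; apply: leeD.
Qed.

End grid.

End step_functions.

(** * The Bochner integral of the drift *)

(** Even reflection turns continuity within the half line into plain continuity. *)
Lemma continuous_norm_extension (R : realType) (f : R -> R) :
  {within `[0, +oo[, continuous f} -> continuous (fun x : R => f `|x|).
Proof.
move=> /subspace_continuousP cf x.
apply: (@cvg_comp _ _ _ (fun x : R => `|x|) f _ (within `[0, +oo[ (nbhs `|x|))); last first.
  by apply: cf; rewrite /= in_itv/= andbT.
move=> A WA; have : \forall y \near x, `[0, +oo[%classic `|y| -> A `|y|.
  exact: (@norm_continuous _ R x _ WA).
by apply: filterS => y; apply; rewrite /= in_itv/= andbT.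
Qed.

Section bochner.
Context {R : realType} (w : R -> R) (hw : admissible_weight w) (E0 : spaceE w (fun=> 0)).
Notation mu := (@lebesgue_measure R).

Lemma integrable_indic_itv (A : set R) t : measurable A ->
  mu.-integrable `[0, t] (EFin \o (fun u => \1_A u)).
Proof.
move=> mA; have h1 := integrable_cst_itv 0 t (1 : R).
have mD : measurable (`[0%R, t] : set (measurableTypeR R)) by [].
have mf : measurable_fun (`[0%R, t] : set (measurableTypeR R)) (\1_A : measurableTypeR R -> R).
  by apply: measurable_funTS; exact: measurable_indic.
apply: (integrable_le mD mf _ h1).
by move=> u _; rewrite indicE; case: (_ \in _); rewrite ?normr0 ?normr1.
Qed.

(** Evaluation at [x] has norm at most [1 + sqrt x] on E and commutes exactly with integrals of
    simple functions, so it passes through the defining limit. *)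
Lemma bochner_eval t (f : R -> R -> R) (I : R -> R) x : 0 <= t -> 0 <= x ->
  is_bochner_integral w t f I ->
  mu.-integrable `[0, t] (EFin \o (fun u => f u x)) /\ I x = \int[mu]_(u in `[0, t]) f u x.
Proof.
move=> t0 x0 [mf EI [s [sE is_ cs cI]]].
have mD : measurable (`[0%R, t] : set (measurableTypeR R)) by [].
have mfx : measurable_fun (`[0%R, t] : set (measurableTypeR R)) (fun u => f u x).
  exact: (measurable_eval hw mD x0 mf).
have Ef u : u \in `[0, t] -> spaceE w (f u) by case: mf => + _; apply.
pose K := 1 + Num.sqrt x.
have K0 : 0 <= K by rewrite addr_ge0// sqrtr_ge0.
have Es n u : spaceE w (simple_fun (s n) u).
  by apply: (spaceE_sum hw E0 (fun p => \1_(p.1) u)) => p ps; case: (sE n p ps).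
have Esi n : spaceE w (simple_integral t (s n)).
  by apply: (spaceE_sum hw E0 (fun p => fine (mu (p.1 `&` `[0, t])))) => p ps; case: (sE n p ps).
have isx n : mu.-integrable `[0, t] (EFin \o (fun u => simple_fun (s n) u x)) /\
    \int[mu]_(u in `[0, t]) simple_fun (s n) u x = simple_integral t (s n) x.
  have hp p : p \in s n -> mu.-integrable `[0, t] (EFin \o (fun u => p.2 x * \1_(p.1) u)).
    move=> ps; have [mp _] := sE n p ps; apply: integrable_scale => //.
    exact: integrable_indic_itv.
  have [i1 i2] := Rintegral_bigsum mD hp.
  have E : (fun u => simple_fun (s n) u x) = (fun u => \sum_(p <- s n) p.2 x * \1_(p.1) u).
    by apply/funext => u; apply: eq_bigr => p _; rewrite mulrC.
  rewrite E; split => //; rewrite i2; apply: eq_big_seq => p ps.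
  have [mp _] := sE n p ps.
  rewrite RintegralZl//; last exact: integrable_indic_itv.
  by rewrite mulrC; congr (_ * _); rewrite /Rintegral integral_indic.
have bnd n u : u \in `[0, t] -> `|f u x - simple_fun (s n) u x| <= K * normE w (f u \- simple_fun (s n) u).
  by move=> ut; exact: (spaceE_eval hw (spaceEB hw (Ef u ut) (Es n u)) x0).
have iK n : mu.-integrable `[0, t] (EFin \o (fun u => K * normE w (f u \- simple_fun (s n) u))).
  exact: (@integrable_scale _ _ R mu _ (fun u => normE w (f u \- simple_fun (s n) u)) K mD (is_ n)).
have idf n : mu.-integrable `[0, t] (EFin \o (fun u => f u x - simple_fun (s n) u x)).
  have mfs : measurable_fun (`[0%R, t] : set (measurableTypeR R)) (fun u => f u x - simple_fun (s n) u x).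
    by apply: measurable_funB => //; exact: integrable_measurable (isx n).1.
  exact: (integrable_le mD mfs (bnd n) (iK n)).
have ifx : mu.-integrable `[0, t] (EFin \o (fun u => f u x)).
  have := integrable_add mD (idf 0%N) (isx 0%N).1.
  by apply: eq_integrable => // u _ /=; rewrite subrK.
split => //.
have key n : `|I x - \int[mu]_(u in `[0, t]) f u x| <=
    K * normE w (I \- simple_integral t (s n)) + K * \int[mu]_(u in `[0, t]) normE w (f u \- simple_fun (s n) u).
  have -> : I x - \int[mu]_(u in `[0, t]) f u x =
     (I \- simple_integral t (s n)) x - \int[mu]_(u in `[0, t]) (f u x - simple_fun (s n) u x).
    rewrite RintegralB ?(isx n).2//; last exact: (isx n).1.
    by rewrite /=; ring.
  apply: le_trans (ler_normB _ _) _; apply: lerD; first exact: (spaceE_eval hw (spaceEB hw EI (Esi n)) x0).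
  apply: le_trans (le_normr_Rintegral mD (idf n)) _.
  have hK : \int[mu]_(u in `[0, t]) (K * normE w (f u \- simple_fun (s n) u)) =
      K * \int[mu]_(u in `[0, t]) normE w (f u \- simple_fun (s n) u).
    by apply: RintegralZl => //; exact: is_.
  by rewrite -hK; exact: (le_Rintegral mD (integrable_norm (idf n)) (iK n) (bnd n)).
have lim0 : (fun n => K * normE w (I \- simple_integral t (s n)) + K * \int[mu]_(u in `[0, t]) normE w (f u \- simple_fun (s n) u)) @ \oo --> (0 : R).
  have gen (a b : nat -> R) : a @ \oo --> (0 : R) -> b @ \oo --> (0 : R) ->
      (fun n => K * a n + K * b n) @ \oo --> (0 : R).
    move=> ca cb; rewrite -[X in _ --> X](_ : K * 0 + K * 0 = 0); last by rewrite mulr0 addr0.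
    by apply: cvgD; apply: cvgM => //; exact: cvg_cst.
  exact: gen.
apply/eqP; rewrite -subr_eq0 -normr_le0; apply/ler_addgt0Pr => e e0; rewrite add0r.
have /cvgrPdist_le/(_ _ e0)[n _ /(_ n (leqnn n))] := lim0.
rewrite sub0r normrN => h; apply: le_trans (key n) _; apply: le_trans h; exact: ler_norm.
Qed.

End bochner.

Section weighted_average.
Context dd (X : measurableType dd) (R : realType) (mu : {measure set X -> \bar R}).

Lemma weighted_average_dist (D : set X) (f p : X -> R) (c e : R) : measurable D ->
  mu.-integrable D (EFin \o p) -> (forall u, D u -> 0 <= p u) ->
  measurable_fun D f -> (forall u, D u -> `|f u - c| <= e) ->
  `|\int[mu]_(u in D) (f u * p u) - c * \int[mu]_(u in D) p u| <= e * \int[mu]_(u in D) p u.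
Proof.
move=> mD ip p0 mf fe.
have mfc : measurable_fun D (fun u => f u - c) by apply: measurable_funB.
have i1 : mu.-integrable D (EFin \o (fun u => p u * (f u - c))).
  exact: (integrable_mul_bounded mD ip mfc fe).
have i2 : mu.-integrable D (EFin \o (fun u => f u * p u)).
  have := integrable_add mD i1 (integrable_scale c mD ip).
  by apply: eq_integrable => // u _ /=; congr EFin; ring.
rewrite -RintegralZl// -RintegralB//; last exact: integrable_scale.
apply: le_trans (le_normr_Rintegral mD _) _.
  by apply: integrable_sub => //; exact: integrable_scale.
rewrite -RintegralZl//; apply: le_Rintegral => //.
- have := integrable_norm (integrable_sub mD i2 (integrable_scale c mD ip)); exact.
- exact: integrable_scale.
- move=> u Du; rewrite -mulrBl normrM (ger0_norm (p0 u Du)).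
  by apply: ler_wpM2r; [exact: p0|exact: fe].
Qed.

End weighted_average.

(** * Small-time asymptotics of the no-arbitrage drift *)

Section drift.
Context {R : realType} (H : R) (hH : 2^-1 < H < 1) (d : nat) (sg : 'I_d -> R -> R)
  (csg : forall j, {within `[0, +oo[, continuous (sg j)}).
Implicit Types (s t x y z e : R) (j : 'I_d).
Notation mu := (@lebesgue_measure R).

Let H0 : 0 < H. Proof. by case/andP: hH => ? _; lra. Qed.
Let e_gt0 : 0 < 2 * H - 1. Proof. by case/andP: hH => ? _; lra. Qed.

Definition vol_prim j x := \int[mu]_(y in `[0, x]) sg j y.

Definition quad_drift x := \sum_(j < d) sg j x * vol_prim j x.

Lemma measurable_reflect (f : R -> R) (a : R) (D : set (measurableTypeR R)) : {within `[0, +oo[, continuous f} ->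
  measurable D -> (forall u, D u -> 0 <= a - u) -> measurable_fun D (fun u : measurableTypeR R => f (a - u)).
Proof.
move=> cf mD h; apply: (@eq_measurable_fun _ _ _ _ D (fun u : measurableTypeR R => f `|a - u|)).
  by move=> u /set_mem Du; rewrite ger0_norm ?h.
apply: measurable_funTS; apply: continuous_measurable_fun => u.
apply: (@continuous_comp R R R (fun u => a - u) (fun v => f `|v|)).
  by apply: cvgB; [exact: cvg_cst|exact: cvg_id].
exact: continuous_norm_extension.
Qed.

Lemma integrable_vol j a b : 0 <= a -> mu.-integrable `[a, b] (EFin \o sg j).
Proof. by move=> a0; apply: L1loc_integrable => //; exact: L1loc_continuous. Qed.

Lemma continuous_vol_prim j : {within `[0, +oo[, continuous (vol_prim j)}.
Proof.
apply/subspace_continuousP => x; rewrite /= in_itv/= andbT => x0.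
have x1 : 0 <= x + 1 by rewrite addr_ge0.
have /subspace_continuousP/(_ x) := @parameterized_integral_continuous R 0 (x + 1) (sg j) x1 (integrable_vol j _ (lexx 0)).
rewrite /= in_itv/= x0 lerDl ler01 => /(_ isT) h A /h.
have : \forall y \near x, y < x + 1 by apply: lt_nbhsl; rewrite ltrDl.
apply: filterS2 => y y1 Py; rewrite /= in_itv/= andbT => y0; apply: Py.
by rewrite /= in_itv/= y0 ltW.
Qed.

(** After the shift by [t - s], all arguments of [sg j] and of its primitive in the drift at time
    [s] lie in [[x, x + t]]. Freezing them at [x] turns each of the two terms into
    [sg j x * vol_prim j x] times the mass [phi_prim H s] of the kernel, whence the factor 2. *)
Lemma drift_dist s t x e : 0 <= x -> 0 <= s -> s <= t -> 0 <= e -> e <= 1 ->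
  (forall j z, x <= z -> z <= x + t -> `|sg j z - sg j x| <= e) ->
  (forall j z, x <= z -> z <= x + t -> `|vol_prim j z - vol_prim j x| <= e) ->
  `|drift H sg s (x + (t - s)) - 2 * quad_drift x * phi_prim H s| <=
  (\sum_(j < d) 2 * (`|sg j x| + `|vol_prim j x| + 1)) * e * phi_prim H s.
Proof.
move=> x0 s0 st e0 e1 h1 h2.
have m0 : 0 <= phi_prim H s by rewrite phi_prim_ge0E// mulr_ge0 ?powR_ge0// ltW.
have mE : \int[mu]_(th in `[0, s]) phiH H (s - th) = phi_prim H s.
  have p00 : phi_prim H 0 = 0 by rewrite phi_prim_ge0E// powR0 ?mulr0 ?gt_eqF.
  by rewrite Rintegral_phiH_shift// subr0 subrr p00 subr0.
have mD : measurable (`[0%R, s] : set (measurableTypeR R)) by [].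
have ip := integrable_phiH_shift hH s 0 s.
have p0 u : `[0, s]%classic u -> 0 <= phiH H (s - u) by move=> _; exact: phiH_ge0.
rewrite /drift /quad_drift mulrAC mulr_sumr -sumrB !mulr_suml.
apply: le_trans (ler_norm_sum _ _ _) _; apply: ler_sum => j _.
set y := x + (t - s).
have yx : x <= y by rewrite lerDl subr_ge0.
have yt : y <= x + t by rewrite lerD2l lerBlDr lerDl.
(* The shift compensates the time argument: the inner points no longer depend on [s]. *)
have ys u : y + s - u = x + t - u by rewrite /y; ring.
have D0 u : `[0, s]%classic u -> x <= x + t - u /\ x + t - u <= x + t.
  rewrite /= in_itv/= => /andP[u0 us]; split; last by rewrite lerBlDr lerDl.
  by rewrite -addrA lerDl subr_ge0 (le_trans us).
have D1 u : `[0, s]%classic u -> 0 <= x + t - u by move=> /D0[+ _]; exact: le_trans.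
have A1 := @weighted_average_dist _ (measurableTypeR R) R mu `[0, s] (fun th => vol_prim j (x + t - th)) (fun th => phiH H (s - th))
  (vol_prim j x) e mD ip p0 (measurable_reflect (@continuous_vol_prim j) mD D1) (fun u Du => h2 j _ (D0 u Du).1 (D0 u Du).2).
have A2 := @weighted_average_dist _ (measurableTypeR R) R mu `[0, s] (fun th => sg j (x + t - th)) (fun th => phiH H (s - th))
  (sg j x) e mD ip p0 (measurable_reflect (@csg j) mD D1) (fun u Du => h1 j _ (D0 u Du).1 (D0 u Du).2).
rewrite mE in A1 A2.
have B1 := h1 j y yx yt; have B2 := h2 j y yx yt.
have -> : \int[mu]_(th in `[0, s]) (\int[mu]_(y0 in `[0, y + s - th]) sg j y0 * phiH H (s - th)) =
    \int[mu]_(th in `[0, s]) (vol_prim j (x + t - th) * phiH H (s - th)).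
  by apply: eq_Rintegral => th _; rewrite ys.
have -> : \int[mu]_(th in `[0, s]) (sg j (y + s - th) * phiH H (s - th)) =
    \int[mu]_(th in `[0, s]) (sg j (x + t - th) * phiH H (s - th)).
  by apply: eq_Rintegral => th _; rewrite ys.
rewrite -/(vol_prim j y) -/(vol_prim j x).
move: A1 A2 B1 B2; move: (\int[mu]_(th in _) _) (\int[mu]_(th in _) _) (phi_prim H s) m0.
move: (sg j y) (vol_prim j y) (sg j x) (vol_prim j x) => a b a0 b0 P1 P2 m m0 A1 A2 B1 B2.
have prod (u v u0 v0 : R) : `|u - u0| <= e -> `|v - v0 * m| <= e * m ->
    `|u * v - u0 * (v0 * m)| <= (`|u0| + 1) * (e * m) + e * (`|v0| * m).
  move=> hu hv; have -> : u * v - u0 * (v0 * m) = u * (v - v0 * m) + (u - u0) * (v0 * m) by ring.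
  apply: le_trans (ler_normD _ _) _; rewrite !normrM (ger0_norm m0); apply: lerD.
    apply: ler_pM => //; have := ler_normD (u - u0) u0; rewrite subrK; lra.
  by apply: ler_wpM2r => //; rewrite mulr_ge0.
have C1 := prod _ _ _ _ B1 A1; have C2 := prod _ _ _ _ B2 A2.
have -> : a * P2 + b * P1 - 2 * m * (a0 * b0) =
   (a * P2 - a0 * (b0 * m)) + (b * P1 - b0 * (a0 * m)) by ring.
apply: le_trans (ler_normD _ _) _; apply: le_trans (lerD C1 C2) _.
by rewrite le_eqVlt; apply/orP; left; apply/eqP; ring.
Qed.

Lemma bochner_drift_dist w t x e (I : R -> R) : admissible_weight w -> spaceE w (fun=> 0) ->
  0 < t -> 0 <= x -> 0 <= e -> e <= 1 ->
  (forall j z, x <= z -> z <= x + t -> `|sg j z - sg j x| <= e) ->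
  (forall j z, x <= z -> z <= x + t -> `|vol_prim j z - vol_prim j x| <= e) ->
  is_bochner_integral w t (fun s => right_shift (t - s) (drift H sg s)) I ->
  `|I x - t `^ (2 * H) * quad_drift x| <=
  (\sum_(j < d) 2 * (`|sg j x| + `|vol_prim j x| + 1)) * e * t `^ (2 * H).
Proof.
move=> hw E0 t0 x0 e0 e1 h1 h2 hI.
have [iI ->] := bochner_eval hw E0 (ltW t0) x0 hI.
set C := \sum_(j < d) _.
have C0 : 0 <= C by apply: sumr_ge0 => j _; rewrite mulr_ge0// !addr_ge0.
have mD : measurable (`[0%R, t] : set (measurableTypeR R)) by [].
have cp : {within `[0, t], continuous (phi_prim H)}.
  by apply: continuous_subspaceT => u; exact: continuous_phi_prim.
have ip : mu.-integrable `[0, t] (EFin \o phi_prim H).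
  by apply: continuous_compact_integrable => //; exact: segment_compact.
have Ip : \int[mu]_(u in `[0, t]) phi_prim H u = t `^ (2 * H) / 2.
  have cF : {within `[0, t], continuous (phi_prim2 H)}.
    apply: continuous_subspaceT => u; apply: differentiable_continuous; apply/derivable1_diffP.
    exact: (@ex_derive _ _ _ _ _ _ _ (is_derive_phi_prim2 hH u)).
  rewrite (Rintegral_FTC2 (ltW t0) cp cF (fun u _ => is_derive_phi_prim2 hH u)).
  by rewrite /phi_prim2 normr0 powR0 ?gt_eqF ?mulr_gt0// mul0r subr0 ger0_norm// ltW.
have -> : t `^ (2 * H) * quad_drift x = 2 * quad_drift x * \int[mu]_(u in `[0, t]) phi_prim H u.
  by rewrite Ip; field.
rewrite -RintegralZl// -RintegralB//; last exact: integrable_scale.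
have isub := integrable_sub mD iI (integrable_scale (2 * quad_drift x) mD ip).
apply: le_trans (le_normr_Rintegral mD isub) _.
apply: (@le_trans _ _ (\int[mu]_(u in `[0, t]) (C * e * phi_prim H u))).
  apply: le_Rintegral => //.
  - by have := integrable_norm isub.
  - exact: integrable_scale.
  - move=> u; rewrite /= in_itv/= => /andP[u0 ut].
    by have := drift_dist x0 u0 ut e0 e1 h1 h2; rewrite /right_shift [t - u + x]addrC.
rewrite RintegralZl// Ip; apply: ler_wpM2l; first by rewrite mulr_ge0.
by rewrite ler_pdivrMr// ler_peMr ?powR_ge0// ler1n.
Qed.

End drift.

(** * Sampling forward curves at small times *)

Section sampling.
Context {R : realType} (disp : measure_display) (Omega : measurableType disp) (P : probability Omega R).

(** If no such outcome existed, [D] would be at least [L] almost everywhere on [A] and its mean at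
    least [L * p > M]. The outcome produced also satisfies the almost sure property [Q]. *)
Lemma markov_existence (A : set Omega) (D : Omega -> R) (Q : Omega -> Prop) (p M L : R) :
  measurable A -> (p%:E <= P A)%E -> measurable_fun setT D -> (forall om, 0 <= D om) ->
  (\int[P]_om (D om)%:E <= M%:E)%E -> 0 <= L -> M < L * p ->
  {ae P, forall om, Q om} -> exists om, [/\ A om, Q om & D om <= L].
Proof.
move=> mA pA mD D0 IM L0 ML aeQ; apply: contrapT => nex.
have ael : {ae P, forall om, A om -> L <= D om}.
  apply: aeS aeQ => om Qom Aom; rewrite leNgt; apply/negP => lt.
  by apply: nex; exists om; split => //; exact: ltW.
have : (L%:E * P A <= M%:E)%E.
  apply: le_trans IM.
  apply: (@le_trans _ _ (\int[P]_(om in A) (D om)%:E)%E).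
    have mDA : measurable_fun A (fun om => (D om)%:E) by apply/measurable_EFinP; exact: measurable_funTS.
    have L0E om : A om -> (0 <= cst L%:E om)%E by move=> _; rewrite lee_fin.
    have D0E om : A om -> (0 <= (D om)%:E)%E by move=> _; rewrite lee_fin.
    have aeE : {ae P, forall om, A om -> (cst L%:E om <= (D om)%:E)%E}.
      by apply: aeS ael => om h Aom; rewrite lee_fin; exact: h.
    rewrite -integral_cst//.
    exact: (ae_ge0_le_integral mA L0E (@measurable_cst _ _ _ _ _ _) D0E mDA aeE).
  apply: ge0_subset_integral => //; first exact/measurable_EFinP.
  by move=> om _; rewrite lee_fin.
move=> h; have : (L%:E * p%:E <= M%:E)%E.
  by apply: le_trans h; apply: lee_wpmul2l.
by rewrite -EFinM lee_fin leNgt ML.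
Qed.

Context (w : R -> R) (hw : admissible_weight w) (T H : R) (d : nat)
  (beta : 'I_d -> R -> Omega -> R) (hT : 0 < T) (hH : 2^-1 < H < 1)
  (hb : is_fbm P T H beta) (E0 : spaceE w (fun=> 0)).
Context (sg : 'I_d -> R -> R) (Esg : forall j, spaceE w (sg j)).
Context (r : R -> Omega -> R -> R)
  (hr : is_mild_solution P w T H beta sg (fun=> 0) r)
  (M : set (R -> R)) (hM : \forall om \ae P, forall t, t \in `[0, T] -> M (r t om)).

(** Randomness ends here. The order of quantifiers matters: [m] precedes the centre [c], so a large
    centre makes the uncertainty of [z] relatively small, and [C] depends on [c] and [N] through a
    probability bound that is uniform in [t]. *)
Lemma forward_curve_sampling : exists m : R, 0 < m /\ forall (c : 'I_d -> R) (N : nat),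
  exists C : R, 0 < C /\ forall (t : R) (X : seq R) (e : R), 0 < t -> t <= T -> 0 < e ->
  (size X <= N)%N -> {in X, forall x, 0 <= x} ->
  (forall x j s, x \in X -> 0 <= s -> s <= t -> `|sg j (x + s) - sg j x| <= e) ->
  exists (z : 'I_d -> R) (h I : R -> R),
  [/\ forall j, `|z j - c j| <= m, M h, spaceE w h,
      is_bochner_integral w t (fun s => right_shift (t - s) (drift H sg s)) I &
      {in X, forall x, `|h x - I x - t `^ H * \sum_(j < d) sg j x * z j| <= C * e * t `^ H}].
Proof.
have [m [m0 hm]] := fbm_support hT hb; exists m; split => // c N.
have [p [p0 hp]] := hm c.
(* Each of at most [d * N] deviations has mean square at most [3 * (e * t ^ H) ^ 2]; the added 1
   gives the strict inequality that [markov_existence] asks for. *)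
pose C2 : R := (d%:R * N%:R * 3 + 1) / p.
have C20 : 0 < C2 by rewrite divr_gt0// ltr_wpDl// mulr_ge0// mulr_ge0.
exists (d%:R * Num.sqrt C2 + 1); split; first by rewrite ltr_wpDl// mulr_ge0// sqrtr_ge0.
move=> t X e t0 tT e0 sX X0 hX.
have [A mA [pA hA]] := hp t t0 tT.
have tI : t \in `[0, T] by rewrite in_itv/= ltW.
have OI : (0 : R) \in `[0, T] by rewrite in_itv/= lexx ltW.
case: hr => mr _ /(_ t tI)[I [Y [hI hY rE]]].
pose dev (q : 'I_d * R) om := Y q.1 om q.2 - sg q.1 q.2 * (beta q.1 t om - beta q.1 0 om).
have mdev q : q.2 \in X -> measurable_fun setT (dev q).
  move=> qX; have q0 := X0 _ qX.
  have [_ _ mY _] := hY q.1.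
  apply: measurable_funB; first exact: (measurable_eval hw measurableT q0 mY).
  apply: measurable_funM; first exact: measurable_cst.
  by apply: measurable_funB; exact: (measurable_fbm hb).
pose r0 := [seq (j, x) | j <- enum 'I_d, x <- X].
have r0P q : q \in r0 -> q.2 \in X by move=> /allpairsP[[j x] [_ xX ->]].
have r0I j x : x \in X -> (j, x) \in r0.
  by move=> xX; apply/allpairsP; exists (j, x); split => //=; rewrite mem_enum.
pose D om := \sum_(q <- r0) dev q om ^+ 2.
have D0 om : 0 <= D om by apply: sumr_ge0 => q _; exact: sqr_ge0.
have mD : measurable_fun setT D.
  by apply: measurable_bigsum => q qr; apply: measurable_funX; exact/mdev/r0P.
have Idev q : q \in r0 -> (\int[P]_om (dev q om ^+ 2)%:E <= (3 * (e ^+ 2 * t `^ (2 * H)))%:E)%E.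
  move=> /r0P qX.
  (* That the shifted volatility lies in E is read off from the integrand of the Paley-Wiener
     integral at time [t - s]. *)
  have Esh s : 0 <= s -> s <= t -> spaceE w (right_shift s (sg q.1)).
    move=> s0 st; have [[+ _] _ _ _] := hY q.1.
    move=> /(_ (t - s)); rewrite (_ : t - (t - s) = s); last by ring.
    apply.
    by rewrite /= in_itv/= subr_ge0 st lerBlDr lerDl.
  exact: (pw_integral_dev hw hT hH hb E0 t0 (Esg q.1) Esh tT (X0 _ qX) (ltW e0)
    (fun s s0 st => hX _ _ _ qX s0 st) (hY q.1)).
have ID : (\int[P]_om (D om)%:E <= (d%:R * N%:R * (3 * (e ^+ 2 * t `^ (2 * H))))%:E)%E.
  have sumE : forall r1 : seq ('I_d * R), {subset r1 <= r0} ->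
      (\int[P]_om (\sum_(q <- r1) dev q om ^+ 2)%:E <= ((size r1)%:R * (3 * (e ^+ 2 * t `^ (2 * H))))%:E)%E.
    elim=> [|q r1 IH] sub.
      rewrite mul0r; under eq_integral do rewrite big_nil.
      by rewrite integral0.
    have sub1 : {subset r1 <= r0} by move=> y yr; apply: sub; rewrite in_cons yr orbT.
    have qr : q \in r0 by apply: sub; rewrite mem_head.
    under eq_integral do rewrite big_cons EFinD.
    have g1 om : setT om -> (0 <= (dev q om ^+ 2)%:E)%E by move=> _; rewrite lee_fin sqr_ge0.
    have g2 om : setT om -> (0 <= (\sum_(q <- r1) dev q om ^+ 2)%:E)%E.
      by move=> _; rewrite lee_fin sumr_ge0// => y _; exact: sqr_ge0.
    have g3 : measurable_fun setT (fun om => (dev q om ^+ 2)%:E).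
      by apply/measurable_EFinP; apply: measurable_funX; exact/mdev/r0P.
    have g4 : measurable_fun setT (fun om => (\sum_(q <- r1) dev q om ^+ 2)%:E).
      apply/measurable_EFinP; apply: measurable_bigsum => y yr; apply: measurable_funX.
      exact/mdev/r0P/sub1.
    rewrite (ge0_integralD _ measurableT g1 g3 g2 g4) /= -(@natr1 _ (size r1)) (mulrDl _ 1) mul1r EFinD [leRHS]addeC.
    by apply: leeD; [exact: Idev|exact: (IH sub1)].
  apply: le_trans (sumE r0 (fun=> id)) _; rewrite lee_fin; apply: ler_wpM2r.
    by rewrite mulr_ge0// mulr_ge0 ?sqr_ge0 ?powR_ge0.
  by rewrite size_allpairs size_enum_ord natrM ler_wpM2l// ler_nat.
have tH0 : 0 < t `^ H by rewrite powR_gt0.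
have t2H : t `^ (2 * H) = t `^ H ^+ 2 by rewrite [2 * H]mulrC powRrM powR_mulrn ?powR_ge0.
pose L := C2 * (e * t `^ H) ^+ 2.
have L0 : 0 <= L by rewrite mulr_ge0 ?sqr_ge0// ltW.
have ML : d%:R * N%:R * (3 * (e ^+ 2 * t `^ (2 * H))) < L * p.
  rewrite t2H /L /C2 exprMn; have p1 : p != 0 by rewrite gt_eqF.
  have et : 0 < e ^+ 2 * t `^ H ^+ 2 by rewrite mulr_gt0 ?exprn_gt0.
  move: (e ^+ 2 * t `^ H ^+ 2) et => y y0; have -> : (d%:R * N%:R * 3 + 1) / p * y * p = d%:R * N%:R * (3 * y) + y by field.
  by rewrite ltrDl.
case: (hb) => _ _ b0 _.
pose Q om := [/\ (forall t, t \in `[0, T] -> M (r t om)), (forall j, beta j 0 om = 0) &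
  forall x, 0 <= x -> r t om x = right_shift t (fun=> 0) x + I x + \sum_(j < d) Y j om x].
have aeQ : {ae P, forall om, Q om}.
  have F := ae_filter_ringOfSetsType P.
  exact: (@filterS3 _ _ F _ _ _ _ (fun om q1 q2 q3 => And3 q1 q2 q3) hM b0 rE).
have [om [Aom [Q1 Q2 Q3] Dom]] := markov_existence mA pA mD D0 ID L0 ML aeQ.
have zc j : `|beta j t om / t `^ H - c j| <= m by exact: hA.
have Er : spaceE w (r t om) := (mr t tI).1 om Logic.I.
exists (fun j => beta j t om / t `^ H), (r t om), I; apply: (And5 zc (Q1 t tI) Er hI).
move=> x xX; have x0 := X0 x xX.
rewrite (Q3 x x0) /right_shift add0r [I x + _]addrC addrK.
rewrite mulr_sumr -sumrB.
have -> : \sum_(j < d) (Y j om x - t `^ H * (sg j x * (beta j t om / t `^ H))) = \sum_(j < d) dev (j, x) om.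
  apply: eq_bigr => j _; rewrite /dev/= Q2 subr0; congr (_ - _).
  by field; rewrite gt_eqF.
apply: le_trans (ler_norm_sum _ _ _) _.
have dj j : `|dev (j, x) om| <= Num.sqrt C2 * (e * t `^ H).
  have et : 0 <= e * t `^ H by rewrite mulr_ge0// ltW.
  rewrite -(ger0_norm et) -(sqrtr_sqr (e * _)) -sqrtrM ?(ltW C20)// -sqrtr_sqr.
  apply: ler_wsqrtr; apply: le_trans Dom; rewrite /D.
  have gen : forall r1 : seq ('I_d * R), (j, x) \in r1 -> dev (j, x) om ^+ 2 <= \sum_(q <- r1) dev q om ^+ 2.
    elim=> [//|q r1 IH]; rewrite in_cons big_cons => /predU1P[<-|/IH h].
      by rewrite lerDl sumr_ge0// => y _; exact: sqr_ge0.
    by apply: le_trans h _; rewrite lerDr sqr_ge0.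
  exact/gen/r0I.
apply: (@le_trans _ _ (\sum_(j < d) Num.sqrt C2 * (e * t `^ H))).
  by apply: ler_sum => j _; exact: dj.
have -> : \sum_(j < d) Num.sqrt C2 * (e * t `^ H) = d%:R * Num.sqrt C2 * (e * t `^ H).
  by rewrite sumr_const card_ord -(mulr_natl (Num.sqrt C2 * (e * t `^ H)) d) mulrA.
rewrite -[leRHS]mulrA; apply: ler_wpM2r.
  by rewrite mulr_ge0// ltW.
by rewrite lerDl.
Qed.

End sampling.

(** * Exponential polynomials and limits of Nelson-Siegel curves *)

Section exponential_polynomials.
Context {R : realType}.
Implicit Types (q r x y : R) (f g : nat -> R) (h : R -> R).

Definition shift_diff q f : nat -> R := fun n => f n.+1 - q * f n.

Definition exp_poly (a b c r : R) : nat -> R := fun n => (a + b * n%:R + c * n%:R ^+ 2) * r ^+ n.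

(** Triangular in the coefficients, with diagonal [r - q]: injective on these sequences for
    [r != q], and lowering the degree for [r = q]. *)
Lemma shift_diff_exp_poly q a b c r :
  shift_diff q (exp_poly a b c r) =
  exp_poly ((r - q) * a + r * (b + c)) ((r - q) * b + 2 * r * c) ((r - q) * c) r.
Proof. by apply/funext => n; rewrite /shift_diff /exp_poly (exprS r n) -natr1; ring. Qed.

Lemma exp_poly_eq0 a b c r : r != 0 -> (forall n, (n <= 2)%N -> exp_poly a b c r n = 0) ->
  [/\ a = 0, b = 0 & c = 0].
Proof.
move=> r0 h; have := h 0%N isT; have := h 1%N isT; have := h 2%N isT.
rewrite /exp_poly !expr0 !expr1 => /eqP; rewrite mulf_eq0 expf_eq0 (negPf r0) andbF orbF => /eqP h2.
move=> /eqP; rewrite mulf_eq0 (negPf r0) orbF => /eqP h1 h0.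
have a0 : a = 0 by lra.
have b0 : b = 0 by lra.
by split => //; lra.
Qed.

Lemma shift_diff_coef_eq0 q a b c r : r != q ->
  (r - q) * a + r * (b + c) = 0 -> (r - q) * b + 2 * r * c = 0 -> (r - q) * c = 0 ->
  [/\ a = 0, b = 0 & c = 0].
Proof.
rewrite -subr_eq0 => rq ha hb /eqP; rewrite mulf_eq0 (negPf rq) => /eqP c0.
move: hb; rewrite c0 mulr0 addr0 => /eqP; rewrite mulf_eq0 (negPf rq) => /eqP b0.
move: ha; rewrite c0 b0 addr0 mulr0 addr0 => /eqP; rewrite mulf_eq0 (negPf rq) => /eqP a0.
by split.
Qed.

Lemma exp_poly0 r n : exp_poly 0 0 0 r n = 0.
Proof. by rewrite /exp_poly !mul0r !addr0 mul0r. Qed.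

Definition curve_seq (a b c q : R) : nat -> R := fun n => a + exp_poly b c 0 q n.

Definition shift_diff2 q f := shift_diff q (shift_diff q f).

Lemma shift_diff_exp_poly1 q b c r :
  shift_diff q (exp_poly b c 0 r) = exp_poly ((r - q) * b + r * c) ((r - q) * c) 0 r.
Proof. by apply/funext => n; rewrite /shift_diff /exp_poly (exprS r n) -natr1; ring. Qed.

Lemma shift_diff2_exp_poly1 b c q : shift_diff2 q (exp_poly b c 0 q) = fun=> 0.
Proof.
apply/funext => n; rewrite /shift_diff2 !shift_diff_exp_poly1 subrr !mul0r !add0r mulr0.
exact: exp_poly0.
Qed.

Lemma shift_diff_coef1_eq0 q b c r : r != q ->
  (r - q) * b + r * c = 0 -> (r - q) * c = 0 -> b = 0 /\ c = 0.
Proof.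
rewrite -subr_eq0 => rq hb /eqP; rewrite mulf_eq0 (negPf rq) => /eqP c0.
by move: hb; rewrite c0 mulr0 addr0 => /eqP; rewrite mulf_eq0 (negPf rq) => /eqP b0.
Qed.

Lemma shift_diff_curve a b c q :
  shift_diff 1 (curve_seq a b c q) = shift_diff 1 (exp_poly b c 0 q).
Proof. by apply/funext => n; rewrite /curve_seq /shift_diff; ring. Qed.

(** The operator with simple root 1 and double roots [q2] and [q3] kills the last two curves. As
    [q1] is none of its roots, it is injective on the exponential part of the first one. *)
Lemma exponent_independence a1 b1 c1 q1 a2 b2 c2 q2 a3 b3 c3 q3 :
  0 < q1 -> q1 < 1 -> q1 != q2 -> q1 != q3 ->
  (forall n, curve_seq a1 b1 c1 q1 n + curve_seq a2 b2 c2 q2 n = curve_seq a3 b3 c3 q3 n) ->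
  b1 = 0 /\ c1 = 0.
Proof.
move=> q10 q11 q12 q13 E.
pose O f := shift_diff2 q2 (shift_diff2 q3 (shift_diff 1 f)).
have OD f g n : O (fun n => f n + g n) n = O f n + O g n.
  by rewrite /O /shift_diff2 /shift_diff; ring.
have O2 n : O (curve_seq a2 b2 c2 q2) n = 0.
  rewrite /O shift_diff_curve shift_diff_exp_poly1 [shift_diff2 q3 _]/shift_diff2 !shift_diff_exp_poly1.
  by rewrite shift_diff2_exp_poly1.
have O3 n : O (curve_seq a3 b3 c3 q3) n = 0.
  rewrite /O shift_diff_curve shift_diff_exp_poly1 shift_diff2_exp_poly1.
  by rewrite /shift_diff2 /shift_diff; ring.
have O1 n : O (curve_seq a1 b1 c1 q1) n = 0.
  by have := O3 n; rewrite -(funext E) OD O2 addr0.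
have q1n0 : q1 != 0 by rewrite gt_eqF.
have q1n1 : q1 != 1 by rewrite lt_eqF.
have := fun n => O1 n; rewrite /O shift_diff_curve /shift_diff2 !shift_diff_exp_poly1.
move=> h; have [hb hc _] := exp_poly_eq0 q1n0 (fun n _ => h n).
have [hb4 hc4] := shift_diff_coef1_eq0 q12 hb hc.
have [hb3 hc3] := shift_diff_coef1_eq0 q12 hb4 hc4.
have [hb2 hc2] := shift_diff_coef1_eq0 q13 hb3 hc3.
have [hb1 hc1] := shift_diff_coef1_eq0 q13 hb2 hc2.
exact: shift_diff_coef1_eq0 q1n1 hb1 hc1.
Qed.

Lemma shift_diff2_exp_poly2 a b c q : shift_diff2 q (shift_diff2 q (exp_poly a b c q)) = fun=> 0.
Proof.
apply/funext => n; rewrite /shift_diff2 !shift_diff_exp_poly subrr !mul0r !add0r !mulr0 addr0 mulr0.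
exact: exp_poly0.
Qed.

(** For [0 < q < 1] the bases 1, [q] and [q ^ 2] are distinct, so an operator with roots 1 and [q]
    leaves nothing of the first two parts and is injective on the third. *)
Lemma square_exponent_independence q x0 x1 y0 y1 y2 z0 z1 z2 (G : nat -> R) : 0 < q -> q < 1 ->
  (forall n, G n = exp_poly x0 x1 0 1 n + (exp_poly y0 y1 y2 q n + exp_poly z0 z1 z2 (q ^+ 2) n)) ->
  (forall n, shift_diff2 q (shift_diff2 q (shift_diff 1 G)) n = 0) ->
  [/\ z0 = 0, z1 = 0 & z2 = 0].
Proof.
move=> q0 q1 GE hG.
(* One factor at 1 more than in the hypothesis, because the part with base 1 has degree 1 in [n]. *)
pose O f := shift_diff2 q (shift_diff2 q (shift_diff2 1 f)).
have OG n : O G n = 0.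
  transitivity (shift_diff2 q (shift_diff2 q (shift_diff 1 G)) n.+1 -
    shift_diff2 q (shift_diff2 q (shift_diff 1 G)) n); last by rewrite !hG subrr.
  by rewrite /O /shift_diff2 /shift_diff; ring.
have OD f g n : O (fun n => f n + g n) n = O f n + O g n.
  by rewrite /O /shift_diff2 /shift_diff; ring.
have O1 n : O (exp_poly x0 x1 0 1) n = 0.
  by rewrite /O shift_diff2_exp_poly1 /shift_diff2 /shift_diff; ring.
have O2 n : O (exp_poly y0 y1 y2 q) n = 0.
  by rewrite /O [shift_diff2 1 _]/shift_diff2 !shift_diff_exp_poly shift_diff2_exp_poly2.
have O3 n : O (exp_poly z0 z1 z2 (q ^+ 2)) n = 0.
  by have := OG n; rewrite (funext GE) !OD O1 O2 !add0r.
have r0 : q ^+ 2 != 0 by rewrite gt_eqF// exprn_gt0.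
have r1 : q ^+ 2 != 1 by rewrite lt_eqF// exprn_ilt1// ltW.
have rq : q ^+ 2 != q by rewrite lt_eqF// expr2 gtr_pMl.
have := fun n => O3 n; rewrite /O /shift_diff2 !shift_diff_exp_poly => h.
have [a1 b1 c1] := exp_poly_eq0 r0 (fun n _ => h n).
have [a2 b2 c2] := shift_diff_coef_eq0 rq a1 b1 c1.
have [a3 b3 c3] := shift_diff_coef_eq0 rq a2 b2 c2.
have [a4 b4 c4] := shift_diff_coef_eq0 rq a3 b3 c3.
have [a5 b5 c5] := shift_diff_coef_eq0 rq a4 b4 c4.
have [a6 b6 c6] := shift_diff_coef_eq0 r1 a5 b5 c5.
exact: shift_diff_coef_eq0 r1 a6 b6 c6.
Qed.

Lemma shift_diff_curve_coef_eq0 a b c q p : 0 < q -> q < 1 -> q != p ->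
  (forall n, (n <= 2)%N -> shift_diff2 p (shift_diff 1 (curve_seq a b c q)) n = 0) -> b = 0 /\ c = 0.
Proof.
move=> q0 q1 qp; rewrite shift_diff_curve /shift_diff2 !shift_diff_exp_poly1 => h.
have qn0 : q != 0 by rewrite gt_eqF.
have qn1 : q != 1 by rewrite lt_eqF.
have [b1 c1 _] := exp_poly_eq0 qn0 h.
have [b2 c2] := shift_diff_coef1_eq0 qp b1 c1.
have [b3 c3] := shift_diff_coef1_eq0 qp b2 c2.
exact: shift_diff_coef1_eq0 qn1 b3 c3.
Qed.

End exponential_polynomials.

Section nelson_siegel_curves.
Context {R : realType}.
Implicit Types (q r x y : R) (h : R -> R).

Definition ns_curve (a b c q x : R) : R := a + (b + c * x) * q `^ x.

(** The exponent is recorded as [q = expR (- y4)], which ranges over a bounded set and therefore has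
    limit points. *)
Definition decaying_ns h : Prop := exists a b c q,
  [/\ 0 < q, q < 1 & forall x, 0 <= x -> h x = ns_curve a b c q x].

Lemma powR_natr q n : 0 < q -> q `^ n%:R = q ^+ n.
Proof. by move=> q0; rewrite powR_mulrn// ltW. Qed.

Lemma powRD_pos q x y : 0 < q -> q `^ (x + y) = q `^ x * q `^ y.
Proof. by move=> q0; rewrite powRD// (gt_eqF q0) implybT. Qed.

Lemma nonpos_of_scaled_bound (y C : R) : (forall m : nat, y * m.+1%:R <= C) -> y <= 0.
Proof.
move=> h; rewrite leNgt; apply/negP => y0.
have := h (Num.truncn (C / y)); rewrite leNgt => /negP; apply.
by rewrite mulrC -ltr_pdivrMr// truncnS_gt.
Qed.

Lemma eq0_of_scaled_bound (y C : R) : (forall m : nat, `|y| * m.+1%:R <= C) -> y = 0.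
Proof. by move=> /nonpos_of_scaled_bound; rewrite normr_le0 => /eqP. Qed.

Lemma expR_ge_pow4 (y : R) : 0 <= y -> (y / 4) ^+ 4 <= expR y.
Proof.
move=> y0; have -> : expR y = expR (y / 4) ^+ 4 by rewrite -expRM_natl; congr expR; field.
have h := expR_ge1Dx (y / 4); have h0 : 0 <= y / 4 by rewrite divr_ge0.
by rewrite lerXn2r ?nnegrE ?expR_ge0//; lra.
Qed.

(** A positive [y4] is already of the required form. For a negative one, growth like [sqrt x] is
    incompatible with the exponential unless [y2 = y3 = 0]. *)
Lemma ns_sublinear_decaying h N : nelson_siegel h ->
  (forall x, 0 <= x -> `|h x - h 0| <= Num.sqrt x * N) -> 0 <= N -> decaying_ns h.
Proof.
move=> [y1 [y2 [y3 [y4 [y40 hE]]]]] gr N0.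
have [y4p|y4n] := ltP 0 y4.
  exists y1, y2, y3, (expR (- y4)); rewrite expR_gt0 -[X in _ < X](expR0 R) ltr_expR oppr_lt0; split => // x x0.
  rewrite hE// /NScurve /ns_curve /powR (gt_eqF (expR_gt0 _)) expRK [x * _]mulrC.
  by move: (expR _) => E; ring.
have {y4n}y4n : y4 < 0 by rewrite lt_neqAle y40.
pose a := - y4; have a0 : 0 < a by rewrite oppr_gt0.
have h0 : h 0 = y1 + y2 by rewrite hE// /NScurve mulr0 expR0; ring.
pose K := (N + `|y2|) / (a / 4) ^+ 4.
have a4 : 0 < (a / 4) ^+ 4 by rewrite exprn_gt0// divr_gt0.
(* Minorising the exponential by a fourth power shows that the affine factor decays like [x ^ -3],
   which forces both of its coefficients to vanish. *)
have key x : 1 <= x -> `|y2 + y3 * x| * x ^+ 3 <= K.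
  move=> x1; have x0 : 0 < x by exact: lt_le_trans x1.
  have := gr x (ltW x0); rewrite h0 hE ?(ltW x0)// /NScurve -/a => g1.
  have g2 : `|y2 + y3 * x| * expR (a * x) <= x * (N + `|y2|).
    have -> : `|y2 + y3 * x| * expR (a * x) = `|(y2 + y3 * x) * expR (a * x)|.
      by rewrite normrM (ger0_norm (expR_ge0 _)).
    have -> : (y2 + y3 * x) * expR (a * x) =
      (y1 + y2 * expR (a * x) + y3 * x * expR (a * x) - (y1 + y2)) + y2 by ring.
    apply: le_trans (ler_normD _ _) _; rewrite mulrDr; apply: lerD.
      apply: le_trans g1 _; apply: ler_wpM2r => //.
      by rewrite -[leRHS]ger0_norm ?(ltW x0)// -sqrtr_sqr ler_wsqrtr// expr2 ler_peMl// ltW.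
    by rewrite ler_peMl.
  have g3 := expR_ge_pow4 (ltW (mulr_gt0 a0 x0)).
  have g4 : `|y2 + y3 * x| * ((a / 4) ^+ 4 * x ^+ 4) <= x * (N + `|y2|).
    apply: le_trans g2; apply: ler_wpM2l => //; apply: le_trans g3.
    by rewrite -exprMn mulrAC.
  rewrite /K ler_pdivlMr// -(ler_pM2l x0); apply: le_trans g4.
  by rewrite le_eqVlt; apply/orP; left; apply/eqP; ring.
have y20 : y2 = 0.
  apply: (@eq0_of_scaled_bound _ (3 * K)) => m; set x := m.+1%:R.
  have x1 : 1 <= x by rewrite ler1n.
  have k1 := key x x1.
  have k2 := key (2 * x) _; have {}k2 := k2 ltac:(lra).
  (* The values at [x] and [2 * x] eliminate [y3]. *)
  have -> : y2 = 2 * (y2 + y3 * x) - (y2 + y3 * (2 * x)) by ring.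
  have xx : x <= x ^+ 3 by rewrite exprS ler_peMr ?exprn_ege1//; lra.
  have xx2 : x <= (2 * x) ^+ 3.
    rewrite exprMn; have : 0 <= x ^+ 3 by rewrite exprn_ge0//; lra.
    lra.
  apply: (@le_trans _ _ ((2 * `|y2 + y3 * x| + `|y2 + y3 * (2 * x)|) * x)).
    apply: ler_wpM2r; first lra.
    by apply: le_trans (ler_normB _ _) _; rewrite normrM (ger0_norm (_ : 0 <= 2)).
  rewrite mulrDl -mulrA.
  have := ler_wpM2l (normr_ge0 (y2 + y3 * x)) xx.
  have := ler_wpM2l (normr_ge0 (y2 + y3 * (2 * x))) xx2.
  lra.
have y30 : y3 = 0.
  apply: (@eq0_of_scaled_bound _ K) => m; set x := m.+1%:R.
  have x1 : 1 <= x by rewrite ler1n.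
  have := key x x1; rewrite y20 add0r normrM (ger0_norm (_ : 0 <= x)); last lra.
  apply: le_trans; rewrite -mulrA ler_wpM2l// -exprS.
  by rewrite exprS ler_peMr ?exprn_ege1//; lra.
(* The curve is constant, so any exponent in []0, 1[] serves. *)
exists y1, 0, 0, (2^-1); rewrite invr_gt0 ltr0n invf_lt1 ?ltr1n//; split => // x x0.
by rewrite hE// /NScurve /ns_curve y20 y30; ring.
Qed.

Lemma decaying_ns_scale h k : decaying_ns h -> decaying_ns (fun x => k * h x).
Proof.
move=> [a [b [c [q [q0 q1 hE]]]]]; exists (k * a), (k * b), (k * c), q; split => // x x0.
by rewrite hE// /ns_curve; ring.
Qed.

Lemma continuous_ns_curve a b c q : 0 < q -> continuous (ns_curve a b c q).
Proof.
move=> q0 x; rewrite /ns_curve; apply: cvgD; first exact: cvg_cst.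
apply: cvgM; first by apply: cvgD; [exact: cvg_cst|apply: cvgM; [exact: cvg_cst|exact: cvg_id]].
rewrite /powR (gt_eqF q0); apply: (@continuous_comp R R R (fun x => x * ln q) expR); last exact: continuous_expR.
by apply: cvgM; [exact: cvg_id|exact: cvg_cst].
Qed.

(** With step [y], the characteristic roots are 1 once and [q ^ y] twice. The coefficients [a], [b],
    [c] drop out, so the relation passes to limits even when they are unbounded. *)
Lemma ns_curve_recurrence a b c q x y : 0 < q -> let f := ns_curve a b c q in let e := q `^ y in
  (f (x + 3 * y) - f (x + 2 * y)) - 2 * e * (f (x + 2 * y) - f (x + y)) + e ^+ 2 * (f (x + y) - f x) = 0.
Proof.
move=> q0 /=; rewrite /ns_curve.
have -> : x + 3 * y = x + y + y + y by ring. have -> : x + 2 * y = x + y + y by ring.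
by rewrite !powRD_pos//; move: (q `^ x) (q `^ y) => X Y; ring.
Qed.

Lemma nonneg_rational_density h (g : R -> R) :
  {within `[0, +oo[, continuous h} -> {within `[0, +oo[, continuous g} ->
  (forall i j : nat, h (i%:R / j.+1%:R) = g (i%:R / j.+1%:R)) ->
  forall x, 0 <= x -> h x = g x.
Proof.
move=> ch cg E x x0.
pose u n : R := (Num.truncn (x * n.+1%:R))%:R / n.+1%:R.
have u0 n : 0 <= u n by rewrite divr_ge0.
have ux : u @ \oo --> x.
  apply/cvgrPdist_le => e e0.
  have /cvgrPdist_le/(_ _ e0) := @cvg_harmonic R; apply: filterS => n.
  rewrite sub0r normrN => hn; apply: le_trans hn.
  have n0 : 0 < n.+1%:R :> R by [].
  have xn0 : 0 <= x * n.+1%:R by rewrite mulr_ge0.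
  have := truncn_itv xn0 => /andP[l1 l2].
  have -> : x - u n = (x * n.+1%:R - (Num.truncn (x * n.+1%:R))%:R) / n.+1%:R.
    by rewrite /u mulrBl mulfK// gt_eqF.
  rewrite [leRHS]ger0_norm ?harmonic_ge0// /harmonic /= normrM normfV (gtr0_norm n0) ler_piMl ?invr_ge0//.
  by rewrite ger0_norm ?subr_ge0// lerBlDl natr1 ltW.
have c1 := within_cvg_seq ch u0 x0 ux; have c2 := within_cvg_seq cg u0 x0 ux.
have EE : (fun n => h (u n)) = (fun n => g (u n)) by apply/funext => n; exact: E.
by rewrite EE in c1; exact: (cvg_unique _ c1 c2).
Qed.

(** Replaces the successive extraction of subsequences: along one ultrafilter all bounded sequences
    converge at once. *)
Lemma ultra_bounded_cvg (U : set_system nat) (u : nat -> R) (a b : R) : UltraFilter U ->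
  (forall k, a <= u k <= b) -> exists2 l, a <= l <= b & u @ U --> l.
Proof.
move=> UU hu; have ab : (u @ U) `[a, b]%classic.
  by apply: (@filterS _ U _ setT); [move=> k _; rewrite /= in_itv/=|exact: filterT].
have [l [lI lcl]] := @segment_compact R a b (u @ U) _ ab.
exists l; first by move: lI; rewrite /= in_itv.
move=> N Nl; have [//|UN] := in_ultra_setVsetC (u @^-1` N) UU.
have [y [h1 h2]] := lcl (~` N) N UN Nl.
by case: h1.
Qed.

(** The coefficients of the approximants may diverge, but their exponents converge along an
    ultrafilter and the recurrence survives. Limit exponents 0 and 1 are the degenerate cases; they
    yield constants, by continuity at 0 and by the growth bound respectively. *)
Lemma decaying_ns_limit h N : 0 <= N ->
  {within `[0, +oo[, continuous h} ->
  (forall x, 0 <= x -> `|h x - h 0| <= Num.sqrt x * N) ->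
  (forall (X : seq R) e, 0 < e -> {in X, forall x, 0 <= x} ->
    exists2 f, decaying_ns f & {in X, forall x, `|f x - h x| <= e}) ->
  decaying_ns h.
Proof.
move=> N0 ch gr ap.
(* For fixed [j] these points form an arithmetic progression, on which the recurrence lives; all
   together they are dense in the half line. *)
pose pt (i j : nat) : R := i%:R / j.+1%:R.
have pt0 i j : 0 <= pt i j by rewrite divr_ge0.
pose pts k := [seq pt i j | i <- iota 0 k, j <- iota 0 k].
have /choice[p hp] : forall k, exists p : R * R * R * R, [/\ 0 < p.2, p.2 < 1 &
    {in pts k, forall x, `|ns_curve p.1.1.1 p.1.1.2 p.1.2 p.2 x - h x| <= k.+1%:R^-1}].
  move=> k; have [|x|f [a [b [c [q [q0 q1 fE]]]]] hf] := ap (pts k) (k.+1%:R^-1).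
  - by rewrite invr_gt0.
  - by move=> /allpairsP[[i j] [_ _ ->]].
  exists (a, b, c, q); split => //= x xk; rewrite -fE ?hf//.
  by case/allpairsP : xk => -[i j] [_ _ ->].
pose a k := (p k).1.1.1; pose b k := (p k).1.1.2; pose c k := (p k).1.2; pose q k := (p k).2.
pose f k := ns_curve (a k) (b k) (c k) (q k).
have q0 k : 0 < q k by case: (hp k).
have q1 k : q k < 1 by case: (hp k).
have fh0 i j : (fun k => f k (pt i j)) @ \oo --> h (pt i j).
  apply/cvgrPdist_le => e e0; near=> k.
  have kij : pt i j \in pts k.
    apply/allpairsP; exists (i, j); rewrite !mem_iota /= !add0n; split => //; near: k.
      exact: nbhs_infty_gt.
    exact: nbhs_infty_gt.
  rewrite distrC; have [_ _ /(_ _ kij) h1] := hp k; apply: le_trans h1 _.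
  near: k; have /cvgrPdist_le/(_ _ e0) := @cvg_harmonic R; apply: filterS => n.
  by rewrite sub0r normrN /= ger0_norm.
have [U [UU sU]] := ultraFilterLemma (F := \oo) _.
have fh i j : (fun k => f k (pt i j)) @ U --> h (pt i j).
  by move=> A hA; apply: sU; exact: (fh0 i j A hA).
have [qs /andP[qs0 qs1] qcv] : exists2 qs : R, 0 <= qs <= 1 & q @ U --> qs.
  by apply: ultra_bounded_cvg => k; rewrite !ltW.
have powcv x : 0 < x -> (fun k => q k `^ x) @ U --> qs `^ x.
  move=> x0; have := cvg_comp q (fun y : R => `|y| `^ x) qcv (@continuous_norm_powR R x x0 qs).
  rewrite (ger0_norm qs0) (_ : _ \o q = (fun k => q k `^ x))//.
  by apply/funext => k /=; rewrite ger0_norm// ltW.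
have ptD i m j k : pt (i + k * m)%N j = pt i j + k%:R * pt m j.
  by rewrite /pt natrD natrM mulrDl mulrA.
have rec i m j : (0 < m)%N ->
    (h (pt (i + 3 * m)%N j) - h (pt (i + 2 * m)%N j)) - 2 * (qs `^ pt m j) * (h (pt (i + 2 * m)%N j) - h (pt (i + 1 * m)%N j))
     + (qs `^ pt m j) ^+ 2 * (h (pt (i + 1 * m)%N j) - h (pt i j)) = 0.
  move=> m0; have x0 : 0 < pt m j by rewrite divr_gt0// ltr0n.
  pose g k := (f k (pt (i + 3 * m)%N j) - f k (pt (i + 2 * m)%N j)) - 2 * (q k `^ pt m j) * (f k (pt (i + 2 * m)%N j) - f k (pt (i + 1 * m)%N j))
     + (q k `^ pt m j) ^+ 2 * (f k (pt (i + 1 * m)%N j) - f k (pt i j)).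
  have g0 k : g k = 0.
    by rewrite /g !ptD mul1r; exact: ns_curve_recurrence.
  have E := powcv _ x0.
  have gc : g @ U --> (h (pt (i + 3 * m)%N j) - h (pt (i + 2 * m)%N j)) - 2 * (qs `^ pt m j) * (h (pt (i + 2 * m)%N j) - h (pt (i + 1 * m)%N j))
     + (qs `^ pt m j) ^+ 2 * (h (pt (i + 1 * m)%N j) - h (pt i j)).
    apply: cvgD; last by rewrite expr2; apply: cvgM; [exact: cvgM|apply: cvgB; exact: fh].
    apply: cvgB; first by apply: cvgB; exact: fh.
    by apply: cvgM; [apply: cvgM => //; exact: cvg_cst|apply: cvgB; exact: fh].
  have g0c : g @ U --> (0 : R) by rewrite (_ : g = fun=> 0); [exact: cvg_cst|exact/funext].
  exact: (cvg_unique _ gc g0c).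
have cstcase : (forall i j, h (pt i j) = h 0) -> decaying_ns h.
  move=> hc; exists (h 0), 0, 0, 2^-1; rewrite invr_gt0 ltr0n invf_lt1 ?ltr1n//; split => // x x0.
  have -> : ns_curve (h 0) 0 0 2^-1 x = h 0 by rewrite /ns_curve; ring.
  apply: (nonneg_rational_density (g := fun=> h 0) ch _ _ x0) => //.
  by apply: continuous_subspaceT => ?; exact: cvg_cst.
(* Here the recurrence reduces to [h (3 * y) = h (2 * y)]. Iterating, [h x = h ((2 / 3) ^ n * x)],
   which tends to [h 0]. *)
have [qz|qnz] := eqVneq qs 0.
  apply: cstcase => i j.
  have step i' j' : h (pt i' j') = h (pt (2 * i')%N (3 * j' + 2)%N).
    case: i' => [|i']; first by rewrite /pt muln0 !mul0r.
    have -> : pt i'.+1 j' = pt (0 + 3 * i'.+1)%N (3 * j' + 2)%N.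
      rewrite /pt add0n natrM (_ : (3 * j' + 2).+1 = 3 * j'.+1)%N; last by lia.
      by rewrite natrM; field; rewrite ?pnatr_eq0.
    have := rec 0%N i'.+1 (3 * j' + 2)%N isT.
    rewrite qz powR0; last by rewrite /pt mulf_neq0 ?invr_eq0 ?pnatr_eq0.
    by rewrite expr2 !mulr0 !mul0r subr0 addr0 => /eqP; rewrite subr_eq0 => /eqP ->; rewrite add0n.
  have it n i' j' : h (pt i' j') = h ((2 / 3) ^+ n * pt i' j').
    elim: n i' j' => [|n IH] i' j'; first by rewrite mul1r.
    rewrite step IH; congr h; rewrite exprSr -mulrA; congr (_ * _).
    rewrite /pt natrM (_ : (3 * j' + 2).+1 = 3 * j'.+1)%N; last by lia.
    by rewrite natrM; field; rewrite ?pnatr_eq0.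
  have uc : (fun n => (2 / 3) ^+ n * pt i j) @ \oo --> (0 : R).
    rewrite -[X in _ --> X](mul0r (pt i j)); apply: cvgM; last exact: cvg_cst.
    by apply: cvg_expr; rewrite ger0_norm ?divr_ge0// ltr_pdivrMr// mul1r ltr_nat.
  have u0 n : 0 <= (2 / 3) ^+ n * pt i j by rewrite mulr_ge0// exprn_ge0// divr_ge0.
  have := within_cvg_seq ch u0 (lexx 0) uc.
  have -> : (fun n => h ((2 / 3) ^+ n * pt i j)) = fun=> h (pt i j) by apply/funext => n; rewrite -it.
  by move=> cc; apply: (cvg_unique _ (cvg_cst (h (pt i j))) cc).
(* Here third differences vanish: [h] is a quadratic polynomial along each progression, and growth
   like [sqrt x] leaves only the constant. *)
have [qo|qno] := eqVneq qs 1.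
  apply: cstcase => i j.
  pose hh i' := h (pt i' j).
  have rr i' : hh i'.+3 - 3 * hh i'.+2 + 3 * hh i'.+1 - hh i' = 0.
    have := rec i' 1%N j isT; rewrite qo powR1 !muln1 addn1 addn2 addn3 -!/(hh _) => E.
    by rewrite -[RHS]E; ring.
  pose D := hh 1%N - hh 0%N; pose dd := hh 2%N - 2 * hh 1%N + hh 0%N.
  have quad n : 2 * hh n = 2 * hh 0%N + 2 * n%:R * D + n%:R * (n%:R - 1) * dd.
    suff : [/\ 2 * hh n = 2 * hh 0%N + 2 * n%:R * D + n%:R * (n%:R - 1) * dd,
       2 * hh n.+1 = 2 * hh 0%N + 2 * n.+1%:R * D + n.+1%:R * (n.+1%:R - 1) * dd &
       2 * hh n.+2 = 2 * hh 0%N + 2 * n.+2%:R * D + n.+2%:R * (n.+2%:R - 1) * dd] by case.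
    elim: n => [|n [h1 h2 h3]]; first by rewrite /D /dd; split; ring.
    split => //.
    have E : 2 * hh n.+3 = 3 * (2 * hh n.+2) - 3 * (2 * hh n.+1) + 2 * hh n.
      by have := rr n; lra.
    by rewrite E h1 h2 h3 -!natr1; ring.
  have hh0 : hh 0%N = h 0 by rewrite /hh /pt mul0r.
  (* The index is a perfect square, so that the square root in the growth bound is at most
     [m.+1]. *)
  have key m : `|D + ((m.+1%:R ^+ 2 - 1) / 2) * dd| * m.+1%:R <= N.
    have := gr (pt (m.+1 ^ 2)%N j) (pt0 _ _); rewrite -/(hh _).
    have -> : hh (m.+1 ^ 2)%N - h 0 = m.+1%:R ^+ 2 * (D + ((m.+1%:R ^+ 2 - 1) / 2) * dd).
      have := quad (m.+1 ^ 2)%N; rewrite natrX hh0 => q2.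
      have -> : hh (m.+1 ^ 2)%N = (2 * hh (m.+1 ^ 2)%N) / 2 by field.
      by rewrite q2; field.
    rewrite normrM ger0_norm ?sqr_ge0// => h1.
    have m0 : 0 < m.+1%:R :> R by [].
    have h2 : Num.sqrt (pt (m.+1 ^ 2)%N j) <= m.+1%:R.
      rewrite -[leRHS]ger0_norm// -sqrtr_sqr ler_wsqrtr// /pt natrX ler_pdivrMr//.
      by rewrite ler_peMr ?sqr_ge0// ler1n.
    rewrite -(ler_pM2l m0); apply: le_trans (le_trans h1 (ler_wpM2r N0 h2)).
    by rewrite le_eqVlt; apply/orP; left; apply/eqP; ring.
  have dd0 : dd = 0.
    apply: (@eq0_of_scaled_bound _ N) => m.
    (* The bounds at [x = m.+1] and at [2 * x]; their difference eliminates [D]. *)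
    have k1 := key m; have k2 := key (2 * m + 1)%N.
    rewrite (_ : (2 * m + 1).+1 = 2 * m.+1)%N in k2; last by lia.
    rewrite natrM in k2; set x := m.+1%:R in k1 k2 *.
    have x1 : 1 <= x by rewrite ler1n.
    have x2 : 1 <= x ^+ 2 by rewrite exprn_ege1.
    have E : 3 * x ^+ 2 / 2 * dd = (D + ((2 * x) ^+ 2 - 1) / 2 * dd) - (D + (x ^+ 2 - 1) / 2 * dd).
      by field.
    have tri := ler_normB (D + ((2 * x) ^+ 2 - 1) / 2 * dd) (D + (x ^+ 2 - 1) / 2 * dd).
    rewrite -E normrM ger0_norm in tri; last by rewrite divr_ge0// mulr_ge0// ltW// exprn_gt0// (lt_le_trans _ x1).
    have x0 : 0 <= x by rewrite (le_trans _ x1).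
    have t1 := ler_wpM2r x0 tri; rewrite mulrDl in t1.
    have t2 : `|D + ((2 * x) ^+ 2 - 1) / 2 * dd| * x <= N / 2 by lra.
    have t3 : 3 * x ^+ 2 / 2 * `|dd| * x <= 3 / 2 * N by lra.
    have t4 : `|dd| * x <= x ^+ 2 * (`|dd| * x) by rewrite ler_peMl// mulr_ge0.
    lra.
  have D0 : D = 0.
    apply: (@eq0_of_scaled_bound _ N) => m; have := key m.
    by rewrite dd0 mulr0 addr0.
  have := quad i; rewrite D0 dd0 !mulr0 !addr0 hh0 /hh => /mulfI; apply.
  by rewrite pnatr_eq0.
(* In the interior case [a], [b], [c] are rational functions of [q k] and of the values at 0, 1, 2,
   with denominators that stay away from 0, so they converge as well. *)
have qp : 0 < qs by rewrite lt_neqAle eq_sym qnz.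
have ql : qs < 1 by rewrite lt_neqAle qno.
have F0 k : f k (pt 0 0) = a k + b k.
  by rewrite /f /ns_curve /pt mul0r powRr0; ring.
have F1 k : f k (pt 1 0) = a k + (b k + c k) * q k.
  by rewrite /f /ns_curve /pt divr1 powRr1 ?(ltW (q0 k))//; ring.
have F2 k : f k (pt 2 0) = a k + (b k + 2 * c k) * q k ^+ 2.
  by rewrite /f /ns_curve /pt divr1 powR_natr//; ring.
pose d0 (u : nat -> R) := u 1%N - u 0%N; pose d1 (u : nat -> R) := u 2%N - u 1%N.
pose uk k i := f k (pt i 0); pose us i := h (pt i 0).
have ucv i : (fun k => uk k i) @ U --> us i by exact: fh.
have d0c : (fun k => d0 (uk k)) @ U --> d0 us by apply: cvgB; exact: ucv.
have d1c : (fun k => d1 (uk k)) @ U --> d1 us by apply: cvgB; exact: ucv.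
have qm1 k : q k - 1 != 0 by rewrite subr_eq0 lt_eqF.
have qn0 k : q k != 0 by rewrite gt_eqF.
have qsm1 : qs - 1 != 0 by rewrite subr_eq0.
have qm1c : (fun k => q k - 1) @ U --> qs - 1 by apply: cvgB => //; exact: cvg_cst.
have cE k : c k = (d1 (uk k) - q k * d0 (uk k)) * (q k * (q k - 1))^-1.
  by rewrite /d0 /d1 /uk F0 F1 F2; field; rewrite qn0 qm1.
have ccv : c @ U --> (d1 us - qs * d0 us) * (qs * (qs - 1))^-1.
  rewrite (funext cE); apply: cvgM; first by apply: cvgB => //; exact: cvgM.
  by apply: cvgV; [exact: mulf_neq0|exact: cvgM].
set cs := (X in _ --> X) in ccv.
have bE k : b k = (d0 (uk k) - c k * q k) * (q k - 1)^-1.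
  by rewrite /d0 /uk F0 F1; field; rewrite qm1.
have bcv : b @ U --> (d0 us - cs * qs) * (qs - 1)^-1.
  rewrite (funext bE); apply: cvgM; first by apply: cvgB => //; exact: cvgM.
  exact: cvgV.
set bs := (X in _ --> X) in bcv.
have aE k : a k = uk k 0%N - b k by rewrite /uk F0; ring.
have acv : a @ U --> us 0%N - bs by rewrite (funext aE); apply: cvgB.
exists (us 0%N - bs), bs, cs, qs; split => // x x0.
apply: (nonneg_rational_density ch _ _ x0).
  by apply: continuous_subspaceT => ?; exact: continuous_ns_curve.
move=> i j.
have gcv : (fun k => f k (pt i j)) @ U --> ns_curve (us 0%N - bs) bs cs qs (pt i j); last first.
  exact: (cvg_unique _ (fh i j) gcv).
rewrite /f /ns_curve; apply: cvgD => //; apply: cvgM.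
  by apply: cvgD => //; apply: cvgM => //; exact: cvg_cst.
case: i => [|i]; last by apply: powcv; rewrite divr_gt0.
rewrite /pt mul0r powRr0; under eq_fun do rewrite powRr0; exact: cvg_cst.
Unshelve. all: by end_near. Qed.

End nelson_siegel_curves.

(** * Determination of the volatility *)

Section volatility.
Context {R : realType}.
Implicit Types (t x y z e q : R).
Notation mu := (@lebesgue_measure R).

Lemma exists_common_radius (I : eqType) (r : seq I) (Q : I -> R -> Prop) :
  (forall i, i \in r -> exists2 t0 : R, 0 < t0 & forall t, t <= t0 -> Q i t) ->
  exists2 t0 : R, 0 < t0 & forall i, i \in r -> forall t, t <= t0 -> Q i t.
Proof.
elim: r => [|i r IH] h; first by exists 1.
have [t1 t10 h1] := h i (mem_head _ _).
have [|t2 t20 h2] := IH; first by move=> j jr; apply: h; rewrite in_cons jr orbT.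
exists (Num.min t1 t2); first by rewrite lt_min t10.
move=> j; rewrite in_cons => /predU1P[->|jr] t; rewrite le_min => /andP[a1 a2].
  exact: h1.
exact: h2.
Qed.

Lemma within_modulus (f : R -> R) x e : {within `[0, +oo[, continuous f} -> 0 <= x -> 0 < e ->
  exists2 t0 : R, 0 < t0 & forall t, t <= t0 -> forall z, x <= z -> z <= x + t -> `|f z - f x| <= e.
Proof.
move=> cf x0 e0; have /cvgrPdist_le/(_ _ e0) := continuous_norm_extension cf (x := x).
move=> [t0 /= t00 h]; exists (t0 / 2); first by rewrite divr_gt0.
move=> t tt z xz zt; have z0 : 0 <= z by exact: le_trans xz.
have := h z; rewrite /= (ger0_norm x0) (ger0_norm z0) distrC [X in _ -> is_true (X <= _)]distrC; apply.
rewrite ger0_norm ?subr_ge0//; apply: (@le_lt_trans _ _ (t0 / 2)).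
  by rewrite lerBlDl (le_trans zt)// lerD2l.
by rewrite ltr_pdivrMr// ltr_pMr// ltr1n.
Qed.

Lemma is_derive_powR_exponent q x : 0 < q -> is_derive x 1 (fun x => q `^ x) (ln q * q `^ x).
Proof.
move=> q0; have -> : (fun x => q `^ x) = (fun x => expR (x * ln q)).
  by apply/funext => y; rewrite /powR (gt_eqF q0).
have D : is_derive x 1 (fun x => x * ln q) (ln q).
  by apply: is_derive_eq; rewrite /GRing.scale/= mulr0 add0r mulr1.
have := @is_derive1_comp R expR (fun x => x * ln q) x _ _ (is_derive_expR _) D.
by rewrite mulrC /powR (gt_eqF q0).
Qed.

Lemma integral_ns_curve a b c q x : 0 < q -> q < 1 -> 0 <= x ->
  let l := - ln q in let Q := - c / l in let p := - (b / l + c / l ^+ 2) in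
  \int[mu]_(y in `[0, x]) ns_curve a b c q y = a * x + (p + Q * x) * q `^ x - p.
Proof.
move=> q0 q1 x0 l Q p; have l0 : l != 0 by rewrite gt_eqF// oppr_gt0 ln_lt0// q0.
pose F y := a * y + (p + Q * y) * q `^ y.
have D y : is_derive y 1 F (ns_curve a b c q y).
  have D1 := is_derive_powR_exponent y q0.
  apply: is_derive_eq; rewrite /GRing.scale/= /ns_curve.
  have -> : ln q = - l by rewrite /l opprK.
  by rewrite /p /Q; move: (q `^ y) => E; field.
have cF : {within `[0, x], continuous F}.
  apply: continuous_subspaceT => y; apply: differentiable_continuous; apply/derivable1_diffP.
  exact: (@ex_derive _ _ _ _ _ _ _ (D y)).
have cn : {within `[0, x], continuous (ns_curve a b c q)}.
  by apply: continuous_subspaceT => y; exact: continuous_ns_curve.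
rewrite (Rintegral_FTC2 x0 cn cF (fun y _ => D y)) /F powRr0; ring.
Qed.

Lemma ns_curve_lipschitz a b c q x s : 0 < q -> q < 1 -> 0 <= x -> 0 <= s ->
  `|ns_curve a b c q (x + s) - ns_curve a b c q x| <= (`|b + c * x| * (- ln q) + `|c|) * s.
Proof.
move=> q0 q1 x0 s0; have l0 : 0 < - ln q by rewrite oppr_gt0 ln_lt0// q0.
have pw y : 0 <= y -> 1 - (- ln q) * y <= q `^ y /\ q `^ y <= 1.
  move=> y0; rewrite /powR (gt_eqF q0); split.
    by have := expR_ge1Dx (y * ln q); rewrite mulNr opprK mulrC.
  by rewrite -[leRHS]expR0 ler_expR -oppr_ge0 -mulrN mulr_ge0// ltW.
have [_ X1] := pw x x0; have [S1 S2] := pw s s0.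
have X0 : 0 <= q `^ x by exact: powR_ge0.
have S0 : 0 <= q `^ s by exact: powR_ge0.
rewrite /ns_curve powRD_pos//; move: (- ln q) l0 S1 => l l0 S1.
move: (q `^ x) (q `^ s) X0 X1 S0 S1 S2 => X Y X0 X1 Y0 Y1 Y2.
have -> : a + (b + c * (x + s)) * (X * Y) - (a + (b + c * x) * X) =
   X * ((b + c * x) * (Y - 1) + c * s * Y) by ring.
rewrite normrM (ger0_norm X0); apply: (@le_trans _ _ (1 * ((`|b + c * x| * l + `|c|) * s))); last by rewrite mul1r.
have h1 : `|(b + c * x) * (Y - 1)| <= `|b + c * x| * l * s.
  by rewrite normrM -mulrA; apply: ler_wpM2l => //; rewrite ler0_norm ?subr_le0// opprB; lra.
have h2 : `|c * s * Y| <= `|c| * s.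
  by rewrite !normrM (ger0_norm s0) (ger0_norm Y0) ler_piMr// mulr_ge0.
apply: ler_pM => //; apply: le_trans (ler_normD _ _) _.
by apply: le_trans (lerD h1 h2) _; rewrite [leRHS]mulrDl.
Qed.

Lemma shift_diff_cvg (U : set_system nat) (p : nat -> R) (p' : R) (u : nat -> nat -> R) (u' : nat -> R) :
  Filter U -> p @ U --> p' -> (forall i, (fun k => u k i) @ U --> u' i) ->
  forall i, (fun k => shift_diff (p k) (u k) i) @ U --> shift_diff p' u' i.
Proof. by move=> FU cp cu i; apply: cvgB; [exact: cu|apply: cvgM; [exact: cp|exact: cu]]. Qed.

(** The curves behave like [tau * s + tau ^ 2 * G] on longer and longer initial segments of the
    integers, with [s] of exponent [q] in a bounded family kept away from the constants by the
    disjunction. Order [tau] determines the limit of their exponents; order [tau ^ 2] then hands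
    their recurrence over to [G]. *)
Lemma second_order_recurrence (d : nat) (a b c : 'I_d -> R) (q m : R) (z0 : 'I_d -> R) (G : nat -> R) :
  0 < q -> q < 1 ->
  (forall z : 'I_d -> R, (forall j, `|z j - z0 j| <= m) -> 1 <= \sum_(j < d) b j * z j) \/
  (forall z : 'I_d -> R, (forall j, `|z j - z0 j| <= m) -> 1 <= \sum_(j < d) c j * z j) ->
  (forall k : nat, exists (tau : R) (z : 'I_d -> R) (h : R -> R),
    [/\ 0 < tau, tau <= k.+1%:R^-1, forall j, `|z j - z0 j| <= m, decaying_ns h &
    forall i, (i <= k)%N -> `|h i%:R - tau ^+ 2 * G i -
      tau * \sum_(j < d) ns_curve (a j) (b j) (c j) q i%:R * z j| <= k.+1%:R^-1 * tau ^+ 2]) ->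
  forall n, shift_diff2 q (shift_diff2 q (shift_diff 1 G)) n = 0.
Proof.
move=> q0 q1 lower hk.
have {hk}/choice[f hf] : forall k : nat, exists f : R * ('I_d -> R) * (R * R * R * R),
    [/\ 0 < f.1.1, f.1.1 <= k.+1%:R^-1, forall j, `|f.1.2 j - z0 j| <= m,
      0 < f.2.2 /\ f.2.2 < 1 &
    forall i, (i <= k)%N -> `|curve_seq f.2.1.1.1 f.2.1.1.2 f.2.1.2 f.2.2 i - f.1.1 ^+ 2 * G i -
      f.1.1 * curve_seq (\sum_(j < d) a j * f.1.2 j) (\sum_(j < d) b j * f.1.2 j)
        (\sum_(j < d) c j * f.1.2 j) q i| <= k.+1%:R^-1 * f.1.1 ^+ 2].
  move=> k; have [tau [z [h [t0 tk zm [A [B [C [p [p0 p1 hE]]]]] hi]]]] := hk k.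
  exists (tau, z, (A, B, C, p)); split => //= i /hi.
  have cE a' b' c' r : 0 < r -> curve_seq a' b' c' r i = ns_curve a' b' c' r i%:R.
    by move=> r0; rewrite /curve_seq /exp_poly /ns_curve powR_natr// mul0r addr0.
  rewrite hE// -cE//; congr (is_true (`|_ - _ * _| <= _)).
  rewrite /curve_seq /exp_poly mul0r addr0 !mulr_suml -big_split/= !mulr_suml -big_split/=.
  by apply: eq_bigr => j _; rewrite -cE// /curve_seq /exp_poly; ring.
pose tau k := (f k).1.1; pose z k := (f k).1.2; pose p k := (f k).2.2.
pose S (x : 'I_d -> R) k := \sum_(j < d) x j * z k j.
pose v k i := curve_seq (f k).2.1.1.1 (f k).2.1.1.2 (f k).2.1.2 (p k) i.
pose s k i := curve_seq (S a k) (S b k) (S c k) q i.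
have tau0 k : 0 < tau k by case: (hf k).
have zm k : forall j, `|z k j - z0 j| <= m by case: (hf k).
(* The rescaled second-order remainder, which converges to [G] at each integer. *)
pose g k i := (tau k)^-1 ^+ 2 * v k i + - (tau k)^-1 * s k i.
have [U [UU sU]] := ultraFilterLemma (F := \oo) _.
have FU : Filter U by typeclasses eauto.
have hcv : (fun k : nat => k.+1%:R^-1 : R) @ U --> (0 : R).
  by apply: cvg_trans (@cvg_harmonic R); exact: cvg_app.
have gcv i : (fun k => g k i) @ U --> G i.
  suff : (fun k => g k i) @ \oo --> G i by apply: cvg_trans; exact: cvg_app.
  apply/cvgrPdist_le => e e0; near=> k.
  have ik : (i <= k)%N by near: k; exact: nbhs_infty_ge.
  apply: (@le_trans _ _ (k.+1%:R^-1)); last first.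
    near: k; have /cvgrPdist_le/(_ _ e0) := @cvg_harmonic R; apply: filterS => k.
    by rewrite sub0r normrN ger0_norm ?harmonic_ge0.
  have [t0 _ _ _ /(_ i ik)] := hf k; rewrite -/(tau k) -/(z k) in t0 *.
  rewrite -/(p k) -/(v k i) -/(S a k) -/(S b k) -/(S c k) -/(s k i) => hi.
  rewrite distrC; have -> : g k i - G i = (tau k)^-1 ^+ 2 * (v k i - tau k ^+ 2 * G i - tau k * s k i).
    by rewrite /g; field; rewrite gt_eqF.
  rewrite normrM ger0_norm ?sqr_ge0// exprVn mulrC ler_pdivrMr ?exprn_gt0//.
have taucv : tau @ U --> (0 : R).
  apply: (@squeeze_cvgr _ _ _ _ (fun=> 0) (fun k : nat => k.+1%:R^-1)) => //; last exact: cvg_cst.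
  by apply: nearW => k; rewrite (ltW (tau0 k))/=; case: (hf k).
have Scv (x : 'I_d -> R) : exists l : R, S x @ U --> l.
  have [|l _ cl] := @ultra_bounded_cvg R U (S x) (- \sum_(j < d) `|x j| * (`|z0 j| + m)) (\sum_(j < d) `|x j| * (`|z0 j| + m)) UU; last by exists l.
  move=> k; rewrite -ler_norml; apply: le_trans (ler_norm_sum _ _ _) _; apply: ler_sum => j _.
  rewrite normrM; apply: ler_wpM2l => //.
  by rewrite -[z k j](subrK (z0 j)) addrC; apply: le_trans (ler_normD _ _) _; rewrite lerD2l.
have [a' ac] := Scv a; have [b' bc] := Scv b; have [c' cc] := Scv c.
have [|p' _ pc] := @ultra_bounded_cvg R U p 0 1 UU.
  by move=> k; have [_ _ _ [p0 p1] _] := hf k; rewrite !ltW.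
have scv i : (fun k => s k i) @ U --> curve_seq a' b' c' q i.
  rewrite /s /curve_seq /exp_poly; apply: cvgD => //; apply: cvgM; last exact: cvg_cst.
  apply: cvgD; last exact: cvg_cst; apply: cvgD => //; apply: cvgM => //; exact: cvg_cst.
have vcv i : (fun k => (tau k)^-1 * v k i) @ U --> curve_seq a' b' c' q i.
  have -> : (fun k => (tau k)^-1 * v k i) = (fun k => tau k * g k i + s k i).
    by apply/funext => k; have t0 := tau0 k; rewrite /g; move: (v k i) (s k i) => V S'; field; rewrite gt_eqF.
  by rewrite -[X in _ --> X]add0r -(mul0r (G i)); apply: cvgD => //; exact: cvgM.
have c1 : (fun=> 1 : R) @ U --> (1 : R) by exact: cvg_cst.
have cq : (fun=> q : R) @ U --> (q : R) by exact: cvg_cst.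
(* After division by [tau k] the curves have the same limit as [s k], and that limit inherits the
   recurrence with roots 1 and [p']. If [p'] differed from [q], both its exponential coefficients
   would vanish, although one of them is at least 1 by [lower]. *)
have pq : p' = q.
  have O1 n : shift_diff2 p' (shift_diff 1 (curve_seq a' b' c' q)) n = 0.
    have := shift_diff_cvg FU pc (shift_diff_cvg FU pc (shift_diff_cvg FU c1 vcv)) (i := n).
    rewrite (_ : (fun k => _) = fun=> 0); last first.
      apply/funext => k; rewrite -[LHS]/(shift_diff2 (p k) (shift_diff 1 (fun i => (tau k)^-1 * v k i)) n).
      have -> : shift_diff2 (p k) (shift_diff 1 (fun i => (tau k)^-1 * v k i)) n =
        (tau k)^-1 * shift_diff2 (p k) (shift_diff 1 (v k)) n.
        by rewrite /shift_diff2 /shift_diff; ring.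
      by rewrite shift_diff_curve shift_diff_exp_poly1 shift_diff2_exp_poly1 mulr0.
    by move=> h; exact: (cvg_unique _ h (cvg_cst _)).
  apply/eqP; rewrite eq_sym; apply/negPn/negP => qp.
  have [b0 c0] := shift_diff_curve_coef_eq0 q0 q1 qp (fun n _ => O1 n).
  have ge1 (x : 'I_d -> R) x' : S x @ U --> x' -> (forall k, 1 <= S x k) -> 1 <= x'.
    by move=> xc x1; apply: (ler_cvg_to c1 xc); exact: nearW.
  by case: lower => lw; [have := ge1 _ _ bc (fun k => lw _ (zm k)); rewrite b0
    |have := ge1 _ _ cc (fun k => lw _ (zm k)); rewrite c0]; rewrite ler10.
(* The operator with root 1 and double roots [q] and [p k] annihilates [g k] exactly: the factors at
   [q] remove [s k] and those at [p k] remove [v k]. In the limit [p k] becomes [q]. *)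
move=> n; rewrite pq in pc.
have := shift_diff_cvg FU pc (shift_diff_cvg FU pc (shift_diff_cvg FU cq (shift_diff_cvg FU cq
  (shift_diff_cvg FU c1 gcv)))) (i := n).
rewrite (_ : (fun k => _) = fun=> 0); last first.
  apply/funext => k; pose O u := shift_diff2 (p k) (shift_diff2 q (shift_diff 1 u)) n.
  have OD x y u u' : O (fun i => x * u i + y * u' i) = x * O u + y * O u'.
    by rewrite /O /shift_diff2 /shift_diff; ring.
  rewrite -[LHS]/(O (fun i => (tau k)^-1 ^+ 2 * v k i + - (tau k)^-1 * s k i)) OD.
  have -> : O (v k) = 0.
    rewrite /O shift_diff_curve shift_diff_exp_poly1 [shift_diff2 q _]/shift_diff2 !shift_diff_exp_poly1.
    by rewrite shift_diff2_exp_poly1.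
  have -> : O (s k) = 0.
    rewrite /O shift_diff_curve shift_diff_exp_poly1 shift_diff2_exp_poly1.
    by rewrite /shift_diff2 /shift_diff; ring.
  by rewrite !mulr0 addr0.
by move=> h; exact: (cvg_unique _ h (cvg_cst _)).
Unshelve. all: by end_near. Qed.

(** The centre is the multiple of [f] whose pairing with [f] is [m * N + 1], with [N] the sum of the
    [|f i|]; moving each coordinate by at most [m] changes the pairing by at most [m * N]. *)
Lemma dominating_center (d : nat) (f : 'I_d -> R) (m : R) : 0 <= m -> (exists j, f j != 0) ->
  exists z0 : 'I_d -> R, forall z : 'I_d -> R, (forall j, `|z j - z0 j| <= m) -> 1 <= \sum_(j < d) f j * z j.
Proof.
move=> m0 [j fj]; pose F := \sum_(i < d) f i ^+ 2; pose N := \sum_(i < d) `|f i|.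
have F0 : 0 < F.
  rewrite /F (bigD1 j)//= ltr_pwDl//; first by rewrite exprn_even_gt0.
  by apply: sumr_ge0 => i _; exact: sqr_ge0.
exists (fun i => (m * N + 1) / F * f i) => z hz.
have zE : \sum_(i < d) f i * z i = m * N + 1 + \sum_(i < d) f i * (z i - (m * N + 1) / F * f i).
  have {1}-> : m * N + 1 = \sum_(i < d) f i * ((m * N + 1) / F * f i).
    transitivity ((m * N + 1) / F * F); first by rewrite divfK// gt_eqF.
    by rewrite {2}/F mulr_sumr; apply: eq_bigr => i _; ring.
  by rewrite -big_split/=; apply: eq_bigr => i _; ring.
have : `|\sum_(i < d) f i * (z i - (m * N + 1) / F * f i)| <= m * N.
  apply: le_trans (ler_norm_sum _ _ _) _; rewrite [leRHS]mulr_sumr; apply: ler_sum => i _.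
  by rewrite normrM mulrC; apply: ler_wpM2r.
by rewrite zE ler_norml => /andP[h _]; lra.
Qed.

Lemma sum_exp_poly (d : nat) (x y z : 'I_d -> R) r n :
  exp_poly (\sum_(j < d) x j) (\sum_(j < d) y j) (\sum_(j < d) z j) r n =
  \sum_(j < d) exp_poly (x j) (y j) (z j) r n.
Proof. by rewrite /exp_poly !mulr_suml -!big_split/= mulr_suml. Qed.

Lemma sum_sqr_eq0 (d : nat) (f : 'I_d -> R) : \sum_(j < d) f j ^+ 2 = 0 -> forall j, f j = 0.
Proof.
move=> S0 j; have /psumr_eq0P : forall i, true -> 0 <= f i ^+ 2 by move=> i _; exact: sqr_ge0.
by move=> /(_ S0 j isT)/eqP; rewrite sqrf_eq0 => /eqP.
Qed.

End volatility.

(** * From consistency to the vanishing of the volatility *)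

Section consistency.
Context {R : realType} (disp : measure_display) (Omega : measurableType disp) (P : probability Omega R).
Context (w : R -> R) (hw : admissible_weight w) (T H : R) (d : nat)
  (beta : 'I_d -> R -> Omega -> R) (hT : 0 < T) (hH : 2^-1 < H < 1)
  (hb : is_fbm P T H beta) (E0 : spaceE w (fun=> 0)).
Context (sg : 'I_d -> R -> R) (Esg : forall j, spaceE w (sg j))
  (Edrift : spaceE w (drift H sg T)).
Context (r : R -> Omega -> R -> R)
  (hr : is_mild_solution P w T H beta sg (fun=> 0) r)
  (hM : \forall om \ae P, forall t, t \in `[0, T] -> @nelson_siegel R (r t om)).
Implicit Types (t x y z e q : R) (j : 'I_d).
Notation mu := (@lebesgue_measure R).

Let H0 : 0 < H. Proof. by case/andP: hH => ? _; lra. Qed.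
Let H1 : 0 < 1 - H. Proof. by case/andP: hH => _ ?; lra. Qed.

Let csg j : {within `[0, +oo[, continuous (sg j)}.
Proof. exact: spaceE_continuous (Esg j). Qed.

Lemma vol_modulus (X : seq R) e : 0 < e -> {in X, forall x, 0 <= x} ->
  exists2 t0 : R, 0 < t0 & forall x, x \in X -> forall t, t <= t0 -> forall j z, x <= z -> z <= x + t ->
    `|sg j z - sg j x| <= e /\ `|vol_prim sg j z - vol_prim sg j x| <= e.
Proof.
move=> e0 X0; apply: exists_common_radius => x /X0 x0.
have [|t0 t00 h] := @exists_common_radius R 'I_d (enum 'I_d) (fun j t => forall z, x <= z -> z <= x + t ->
    `|sg j z - sg j x| <= e /\ `|vol_prim sg j z - vol_prim sg j x| <= e).
  move=> j _; have [t1 t10 h1] := within_modulus (@csg j) x0 e0.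
  have [t2 t20 h2] := within_modulus (@continuous_vol_prim R d sg csg j) x0 e0.
  exists (Num.min t1 t2); first by rewrite lt_min t10.
  move=> t; rewrite le_min => /andP[a1 a2] z xz zt.
  by split; [exact: (h1 t a1)|exact: (h2 t a2)].
by exists t0 => // t tt0 j; apply: h => //; rewrite mem_enum.
Qed.

(** Two moduli are kept apart: [e] governs the stochastic integral and must later be small compared
    with [t ^ H], whereas [e'] governs the drift and only has to be small. *)
Lemma forward_curve_expansion : exists m : R, 0 < m /\ forall (c : 'I_d -> R) (X : seq R),
  {in X, forall x, 0 <= x} -> exists C : R, 0 < C /\ forall (t e e' : R), 0 < t -> t <= T -> 0 < e ->
  0 < e' -> e' <= 1 ->
  (forall x j s, x \in X -> 0 <= s -> s <= t -> `|sg j (x + s) - sg j x| <= e) ->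
  (forall x j z, x \in X -> x <= z -> z <= x + t ->
    `|sg j z - sg j x| <= e' /\ `|vol_prim sg j z - vol_prim sg j x| <= e') ->
  exists (z : 'I_d -> R) (h : R -> R), [/\ forall j, `|z j - c j| <= m, decaying_ns h &
    forall x, x \in X ->
    `|h x - t `^ (2 * H) * quad_drift sg x - t `^ H * \sum_(j < d) sg j x * z j| <=
      C * (e * t `^ H + e' * t `^ (2 * H))].
Proof.
have [m [m0 hm]] := forward_curve_sampling hw hT hH hb E0 Esg hr hM.
exists m; split => // c X X0; have [C1 [C10 hC1]] := hm c (size X).
pose Cx x := \sum_(j < d) 2 * (`|sg j x| + `|vol_prim sg j x| + 1).
have Cx0 x : 0 <= Cx x by apply: sumr_ge0 => j _; rewrite mulr_ge0// !addr_ge0.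
exists (C1 + \sum_(x <- X) Cx x); split; first by rewrite ltr_wpDr// sumr_ge0.
move=> t e e' t0 tT e0 e'0 e'1 he he'.
have [z [h [I [zc Mh Eh hI hX]]]] := hC1 t X e t0 tT e0 (leqnn _) X0 he.
exists z, h; split => //.
  exact: (ns_sublinear_decaying Mh (fun x => spaceE_growth hw Eh (x := x)) (normE_ge0 w h)).
move=> x xX; have x0 := X0 x xX.
have hd := bochner_drift_dist hH csg hw E0 t0 x0 (ltW e'0) e'1
  (fun j z xz zt => (he' x j z xX xz zt).1) (fun j z xz zt => (he' x j z xX xz zt).2) hI.
have hx := hX x xX.
have -> : h x - t `^ (2 * H) * quad_drift sg x - t `^ H * (\sum_(j < d) sg j x * z j) =
  (h x - I x - t `^ H * (\sum_(j < d) sg j x * z j)) + (I x - t `^ (2 * H) * quad_drift sg x) by ring.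
apply: le_trans (ler_normD _ _) _; apply: le_trans (lerD hx hd) _.
have p1 : 0 <= t `^ H by exact: powR_ge0.
have p2 : 0 <= t `^ (2 * H) by exact: powR_ge0.
have S0 : 0 <= \sum_(x <- X) Cx x by apply: sumr_ge0.
have Sx : Cx x <= \sum_(x <- X) Cx x.
  move: xX; clear -Cx0; elim: X => [//|y X IH]; rewrite in_cons big_cons => /predU1P[->|/IH h].
    by rewrite lerDl sumr_ge0.
  by apply: le_trans h _; rewrite lerDr.
rewrite -/(Cx x) mulrDr -!mulrA; apply: lerD.
  by apply: ler_wpM2r; [rewrite mulr_ge0// ltW|rewrite lerDl].
by apply: ler_wpM2r; [rewrite mulr_ge0// ltW|apply: le_trans Sx _; rewrite lerDr ltW].
Qed.

Lemma powR_small (p e : R) : 0 < p -> 0 < e -> exists2 t0 : R, 0 < t0 & forall t, 0 < t -> t <= t0 -> t `^ p <= e.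
Proof.
move=> p0 e0; exists (e `^ (p^-1)); first by rewrite powR_gt0.
move=> t t0 tle; have := @ge0_ler_powR R p (ltW p0) t (e `^ p^-1).
rewrite !nnegrE (ltW t0) powR_ge0 -powRrM mulVf ?gt_eqF// powRr1 ?(ltW e0)//.
by apply.
Qed.

(** The sampled curves for the centre [k * z0] are divided by [k * t ^ H], so the fixed uncertainty
    [m] in [z] counts only for [m / k]; plain continuity of the volatility is enough at this
    order. *)
Lemma volatility_span_decaying (z0 : 'I_d -> R) : decaying_ns (fun x => \sum_(j < d) sg j x * z0 j).
Proof.
have Ez : spaceE w (fun x => \sum_(j < d) sg j x * z0 j).
  have := spaceE_sum hw E0 z0 (r := enum 'I_d) (f := sg) (fun j _ => Esg j).
  by congr spaceE; apply/funext => x; rewrite big_enum/=; apply: eq_bigr => j _; rewrite mulrC.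
apply: (decaying_ns_limit (normE_ge0 w _) (spaceE_continuous Ez)).
  by move=> x x0; exact: (spaceE_growth hw Ez x0).
move=> X eps eps0 X0.
have [m [m0 hm]] := forward_curve_expansion.
pose S := \sum_(x <- X) \sum_(j < d) `|sg j x|.
have S0 : 0 <= S by apply: sumr_ge0 => x _; exact: sumr_ge0.
(* Gives [m * S / k <= eps / 3]; the summand 1 ensures [k >= 1], so that dividing by [k] does not
   enlarge the other two errors. *)
pose k : R := 3 * m * S / eps + 1.
have k1 : 1 <= k by rewrite lerDr !mulr_ge0 ?invr_ge0// ltW.
have k0 : 0 < k by exact: lt_le_trans k1.
have [C [C0 hC]] := hm (fun j => k * z0 j) X X0.
pose G := \sum_(x <- X) `|quad_drift sg x|.
have G0 : 0 <= G by exact: sumr_ge0.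
pose e := Num.min 1 (eps / (6 * C)).
have e0 : 0 < e by rewrite lt_min ltr01 divr_gt0// mulr_gt0.
have e1 : e <= 1 by rewrite ge_min lexx.
have eC : e <= eps / (6 * C) by rewrite ge_min lexx orbT.
have [t1 t10 h1] := vol_modulus e0 X0.
have q0 : 0 < Num.min 1 (eps / (3 * (G + 1))).
  by rewrite lt_min ltr01 divr_gt0// mulr_gt0// ltr_wpDl.
have [t2 t20 h2] := powR_small H0 q0.
pose t := Num.min T (Num.min t1 t2).
have t0 : 0 < t by rewrite !lt_min hT t10.
have tT : t <= T by rewrite ge_min lexx.
have tt1 : t <= t1 by rewrite !ge_min lexx !orbT.
have tt2 : t <= t2 by rewrite !ge_min lexx !orbT.
have he x j s : x \in X -> 0 <= s -> s <= t -> `|sg j (x + s) - sg j x| <= e.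
  by move=> xX s0 st; apply: (h1 x xX t tt1 j (x + s) _ _).1; rewrite ?lerDl// lerD2l.
have [z [h [zc dh hx]]] := hC t e e t0 tT e0 e0 e1 he (fun x j z xX => h1 x xX t tt1 j z).
have tau := h2 t t0 tt2; rewrite le_min in tau; case/andP: tau => tau1 tauG.
set tH := t `^ H in hx tau1 tauG.
have tH0 : 0 < tH by rewrite powR_gt0.
have t2H : t `^ (2 * H) = tH * tH by rewrite [2 * H]mulrC powRrM powR_mulrn ?powR_ge0.
exists (fun x => (k * tH)^-1 * h x); first exact: decaying_ns_scale.
move=> x xX; have := hx x xX; rewrite t2H.
have Gx : `|quad_drift sg x| <= G.
  rewrite /G; move: xX; clear; elim: X => [//|y X IH]; rewrite in_cons big_cons => /predU1P[->|/IH h].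
    by rewrite lerDl sumr_ge0.
  by apply: le_trans h _; rewrite lerDr.
have Sx : \sum_(j < d) `|sg j x| <= S.
  rewrite /S; move: xX; clear; elim: X => [//|y X IH]; rewrite in_cons big_cons => /predU1P[->|/IH h].
    by rewrite lerDl sumr_ge0// => ? _; exact: sumr_ge0.
  by apply: le_trans h _; rewrite lerDr; exact: sumr_ge0.
have zS : `|\sum_(j < d) sg j x * z j - k * \sum_(j < d) sg j x * z0 j| <= m * S.
  rewrite mulr_sumr -sumrB; apply: le_trans (ler_norm_sum _ _ _) _.
  apply: (@le_trans _ _ (\sum_(j < d) m * `|sg j x|)).
    apply: ler_sum => j _; have -> : sg j x * z j - k * (sg j x * z0 j) = sg j x * (z j - k * z0 j) by ring.
    by rewrite normrM mulrC; apply: ler_wpM2r.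
  by rewrite -mulr_sumr; apply: ler_wpM2l => //; exact: ltW.
move: (\sum_(j < d) sg j x * z j) (\sum_(j < d) sg j x * z0 j) zS => A B zS hA.
have kt0 : 0 < k * tH by rewrite mulr_gt0.
have -> : (k * tH)^-1 * h x - B = (k * tH)^-1 * (h x - tH * (k * B)) by field; rewrite !gt_eqF.
rewrite normrM ger0_norm ?invr_ge0 ?(ltW kt0)// mulrC ler_pdivrMr//.
have -> : h x - tH * (k * B) = (h x - tH * tH * quad_drift sg x - tH * A) + (tH * tH * quad_drift sg x + tH * (A - k * B)) by ring.
apply: le_trans (ler_normD _ _) _; apply: le_trans (lerD hA (ler_normD _ _)) _.
rewrite !normrM (ger0_norm (ltW tH0)).
have b1 : C * (e * tH + e * (tH * tH)) <= eps / 3 * tH.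
  have c1 : C * e <= eps / 6.
    have := ler_wpM2l (ltW C0) eC; have -> : C * (eps / (6 * C)) = eps / 6 by field; rewrite gt_eqF.
    by [].
  have c2 : e * (tH * tH) <= e * tH by rewrite ler_wpM2l ?(ltW e0)// ger_pMl.
  have c3 := ler_wpM2l (ltW C0) c2; have c4 := ler_wpM2r (ltW tH0) c1; lra.
have b2 : tH * tH * `|quad_drift sg x| <= eps / 3 * tH.
  have c1 := ler_wpM2l (ltW tH0) Gx.
  have c2 : tH * G <= eps / 3.
    have G1 : 0 < G + 1 by rewrite ltr_wpDl.
    have := ler_wpM2r (ltW G1) tauG.
    have -> : eps / (3 * (G + 1)) * (G + 1) = eps / 3 by field; rewrite gt_eqF.
    by apply: le_trans; rewrite ler_wpM2l ?(ltW tH0)// lerDl.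
  have c3 := ler_wpM2l (ltW tH0) (le_trans c1 c2); lra.
have b3 : tH * `|A - k * B| <= eps / 3 * (k - 1) * tH.
  have -> : eps / 3 * (k - 1) * tH = tH * (m * S) by rewrite /k; field; rewrite gt_eqF.
  by apply: ler_wpM2l => //; exact: ltW.
have : eps / 3 * tH <= eps / 3 * tH * k by rewrite ler_peMr// mulr_ge0 ?(ltW tH0)// divr_ge0// ltW.
have : 0 <= eps * (k * tH) by rewrite mulr_ge0 ?(ltW eps0)// ltW.
move=> p1 p2; apply: le_trans (lerD b1 (lerD b2 b3)) _; rewrite -subr_ge0.
have -> : eps * (k * tH) - (eps / 3 * tH + (eps / 3 * tH + eps / 3 * (k - 1) * tH)) =
   3^-1 * (eps * (k * tH)) + (eps / 3 * tH * k - eps / 3 * tH) by field.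
by apply: addr_ge0; [exact: mulr_ge0|rewrite subr_ge0].
Qed.

(** A nonconstant [sg j0] fixes [q]. If another [sg j] has a different exponent, the sum of the two
    still has a single one; by independence that one must be [q], and then [sg j] is constant and
    can be rewritten with [q]. *)
Lemma volatility_common_exponent : exists q (a b c : 'I_d -> R),
  [/\ 0 < q, q < 1 & forall j x, 0 <= x -> sg j x = ns_curve (a j) (b j) (c j) q x].
Proof.
have dec j : decaying_ns (sg j).
  have := volatility_span_decaying (fun i => (i == j)%:R); congr decaying_ns; apply/funext => x.
  by rewrite (bigD1 j)//= eqxx mulr1 big1 ?addr0// => i ij; rewrite (negPf ij) mulr0.
(* Nonconstancy is asked of every representation, since a constant curve can be written with any
   exponent. *)
have [[j0 nc]|cst] := pselect (exists j, forall a b c q, 0 < q -> q < 1 ->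
    (forall x, 0 <= x -> sg j x = ns_curve a b c q x) -> ~ (b = 0 /\ c = 0)).
  have [a0 [b0 [c0 [q [q0 q1 E]]]]] := dec j0.
  have nz := nc _ _ _ _ q0 q1 E.
  have /choice[p hp] : forall j, exists p : R * R * R, forall x, 0 <= x -> sg j x = ns_curve p.1.1 p.1.2 p.2 q x.
    move=> j; have [->|jj0] := eqVneq j j0; first by exists (a0, b0, c0).
    have [a1 [b1 [c1 [q' [q'0 q'1 E1]]]]] := dec j.
    have [qq|qq'] := eqVneq q q'; first by exists (a1, b1, c1); rewrite qq.
    have [a2 [b2 [c2 [q2 [q20 q21 E2]]]]] := volatility_span_decaying (fun i => ((i == j0) || (i == j))%:R).
    have sE n : curve_seq a0 b0 c0 q n + curve_seq a1 b1 c1 q' n = curve_seq a2 b2 c2 q2 n.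
      have cE a b c p : 0 < p -> curve_seq a b c p n = ns_curve a b c p n%:R.
        by move=> p0; rewrite /curve_seq /exp_poly /ns_curve powR_natr// mul0r addr0.
      rewrite !cE// -E// -E1// -E2// (bigD1 j0)//= eqxx mulr1 (bigD1 j)//= eqxx orbT mulr1.
      rewrite big1 ?addr0// => i /andP[i1 i2]; by rewrite (negPf i1) (negPf i2) mulr0.
    have [q2q|q2q] := eqVneq q q2; last first.
      by case: nz; exact: (exponent_independence q0 q1 qq' q2q sE).
    have q'q2 : q' != q2 by rewrite -q2q eq_sym.
    have sE' n : curve_seq a1 b1 c1 q' n + curve_seq a0 b0 c0 q n = curve_seq a2 b2 c2 q2 n.
      by rewrite addrC.
    have q'q : q' != q by rewrite eq_sym.
    have [z1 z2] := exponent_independence q'0 q'1 q'q q'q2 sE'.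
    exists (a1, 0, 0) => x x0; rewrite E1// z1 z2 /ns_curve /=; ring.
  by exists q, (fun j => (p j).1.1), (fun j => (p j).1.2), (fun j => (p j).2); split.
exists 2^-1.
have /choice[a ha] : forall j, exists a, forall x, 0 <= x -> sg j x = a.
  move=> j; have /existsNP[a /existsNP[b /existsNP[c /existsNP[q]]]] : ~ forall a b c q, 0 < q -> q < 1 ->
    (forall x, 0 <= x -> sg j x = ns_curve a b c q x) -> ~ (b = 0 /\ c = 0) by move=> h; apply: cst; exists j.
  move=> /not_implyP[_ /not_implyP[_ /not_implyP[E /contrapT[b0 c0]]]].
  by exists a => x x0; rewrite E// b0 c0 /ns_curve; ring.
exists a, (fun=> 0), (fun=> 0); rewrite invr_gt0 ltr0n invf_lt1 ?ltr1n//; split => // j x x0.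
by rewrite (ha j x x0) /ns_curve; ring.
Qed.

Lemma constant_volatility_eq0 (a : 'I_d -> R) : (forall j x, 0 <= x -> sg j x = a j) ->
  forall j, a j = 0.
Proof.
move=> hc.
have vp j x : 0 <= x -> \int[mu]_(y in `[0, x]) sg j y = a j * x.
  move=> x0; transitivity (\int[mu]_(y in `[0, x]) a j); last by rewrite Rintegral_cst_itv// subr0.
  by apply: eq_Rintegral => y /set_mem; rewrite /= in_itv/= => /andP[y0 _]; exact: hc.
pose mT := phi_prim H T.
have mT0 : 0 < mT by rewrite /mT phi_prim_ge0E ?(ltW hT)// mulr_gt0 ?powR_gt0.
have mE : \int[mu]_(th in `[0, T]) phiH H (T - th) = mT.
  have p00 : phi_prim H 0 = 0.
    by rewrite phi_prim_ge0E// powR0 ?mulr0// gt_eqF//; case/andP: hH => ? _; lra.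
  by rewrite Rintegral_phiH_shift ?(ltW hT)// subr0 subrr p00 subr0.
have mD : measurable (`[0%R, T] : set (measurableTypeR R)) by [].
have ip := integrable_phiH_shift hH T 0 T.
have mTth : measurable_fun (`[0%R, T] : set (measurableTypeR R)) (fun th : measurableTypeR R => T - th).
  by apply: measurable_funB => //; exact: measurable_cst.
have bTth (th : R) : `[0, T]%classic th -> `|T - th| <= T.
  by rewrite /= in_itv/= => /andP[h1 h2]; rewrite ger0_norm ?subr_ge0// lerBlDr lerDl.
have ik := integrable_mul_bounded mD ip mTth bTth.
pose K0 := \int[mu]_(th in `[0, T]) (phiH H (T - th) * (T - th)).
pose S := \sum_(j < d) a j ^+ 2.
have dE x : 0 <= x -> drift H sg T x = S * (2 * mT * x + K0).
  move=> x0; rewrite /drift /S mulr_suml; apply: eq_bigr => j _.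
  have arg (th : R) : `[0, T]%classic th -> 0 <= x + T - th.
    by rewrite /= in_itv/= => /andP[h1 h2]; rewrite subr_ge0 (le_trans h2)// lerDr.
  have -> : \int[mu]_(th in `[0, T]) (\int[mu]_(y in `[0, x + T - th]) sg j y * phiH H (T - th)) =
      a j * (x * mT + K0).
    rewrite -mE /K0; transitivity (\int[mu]_(th in `[0, T]) ((a j * x) * phiH H (T - th) + a j * (phiH H (T - th) * (T - th)))).
      by apply: eq_Rintegral => th /set_mem Dth; rewrite (vp j _ (arg _ Dth)); ring.
    by rewrite (Rintegral_lin _ _ mD ip ik) mulrDr mulrA.
  have -> : \int[mu]_(th in `[0, T]) (sg j (x + T - th) * phiH H (T - th)) = a j * mT.
    rewrite -mE -RintegralZl//; apply: eq_Rintegral => th /set_mem Dth.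
    by rewrite (hc j _ (arg _ Dth)).
  by rewrite (hc j x x0) (vp j x x0); move: K0 mT {mT0 mE} => k m; ring.
(* At the perfect squares [m.+1 ^ 2] the growth bound becomes a multiple of [m.+1], so the slope
   times [m.+1] stays bounded. *)
have SmT : S * (2 * mT) = 0.
  apply: (@eq0_of_scaled_bound _ _ (normE w (drift H sg T))) => m.
  have m0 : 0 < m.+1%:R :> R by [].
  have x0 : 0 <= m.+1%:R ^+ 2 :> R by exact: sqr_ge0.
  have := spaceE_growth hw Edrift x0; rewrite !dE// sqrtr_sqr (ger0_norm (ltW m0)).
  move: (normE _ _) => N; have -> : S * (2 * mT * m.+1%:R ^+ 2 + K0) - S * (2 * mT * 0 + K0) = m.+1%:R * (S * (2 * mT) * m.+1%:R) by ring.
  by rewrite normrM (ger0_norm (ltW m0)) ler_pM2l// normrM (ger0_norm (ltW m0)).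
have S0 : S = 0 by move/eqP: SmT; rewrite mulf_eq0 (gt_eqF (mulr_gt0 _ mT0))// orbF => /eqP.
exact: sum_sqr_eq0 S0.
Qed.

Section nonconstant_volatility.
Context (q : R) (a b c : 'I_d -> R) (q0 : 0 < q) (q1 : q < 1)
  (sgE : forall j x, 0 <= x -> sg j x = ns_curve (a j) (b j) (c j) q x).

Let l : R := - ln q.
Let l0 : 0 < l. Proof. by rewrite oppr_gt0 ln_lt0// q0. Qed.

(** Here [tau = t ^ H]. The explicit form of the volatility allows [e = K * t], and
    [t * t ^ H = t ^ (1 - H) * tau ^ 2] makes the stochastic error negligible against [tau ^ 2]. *)
Lemma fine_expansion : exists m : R, 0 < m /\ forall (z0 : 'I_d -> R) (X : seq R),
  {in X, forall x, 0 <= x} -> forall eps, 0 < eps -> exists (tau : R) (z : 'I_d -> R) (h : R -> R),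
  [/\ 0 < tau, tau <= eps, forall j, `|z j - z0 j| <= m, decaying_ns h &
    forall x, x \in X ->
    `|h x - tau ^+ 2 * quad_drift sg x - tau * \sum_(j < d) sg j x * z j| <= eps * tau ^+ 2].
Proof.
have [m [m0 hm]] := forward_curve_expansion; exists m; split => // z0 X X0 eps eps0.
have [C [C0 hC]] := hm z0 X X0.
pose lipK x := \sum_(j < d) (`|b j + c j * x| * l + `|c j|).
have lipK0 x : 0 <= lipK x by apply: sumr_ge0 => j _; rewrite addr_ge0// mulr_ge0// ltW.
pose K := \sum_(x <- X) lipK x + 1.
have K0 : 0 < K by rewrite ltr_wpDl// sumr_ge0.
have lipj x j : x \in X -> `|b j + c j * x| * l + `|c j| <= K.
  move=> xX; apply: (@le_trans _ _ (lipK x)).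
    rewrite /lipK (bigD1 j)//= lerDl; apply: sumr_ge0 => i _.
    by rewrite addr_ge0// mulr_ge0// ltW.
  rewrite /K ler_wpDr//; move: xX; clear -lipK0; elim: X => [//|y X IH].
  rewrite in_cons big_cons => /predU1P[->|/IH h]; first by rewrite lerDl sumr_ge0.
  by apply: le_trans h _; rewrite lerDr.
pose e' := Num.min 1 (eps / (2 * C)).
have e'0 : 0 < e' by rewrite lt_min ltr01 divr_gt0// mulr_gt0.
have e'1 : e' <= 1 by rewrite ge_min lexx.
have e'C : e' <= eps / (2 * C) by rewrite ge_min lexx orbT.
have [t1 t10 h1] := vol_modulus e'0 X0.
have [t2 t20 h2] := powR_small H0 eps0.
have q3 : 0 < eps / (2 * C * K) by rewrite divr_gt0// !mulr_gt0.
have [t3 t30 h3] := powR_small H1 q3.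
pose t := Num.min (Num.min T 1) (Num.min t1 (Num.min t2 t3)).
have t0 : 0 < t by rewrite !lt_min hT ltr01 t10 t20.
have tT : t <= T by rewrite !ge_min lexx.
have tt1 : t <= t1 by rewrite !ge_min lexx !orbT.
have tt2 : t <= t2 by rewrite !ge_min lexx !orbT.
have tt3 : t <= t3 by rewrite !ge_min lexx !orbT.
have he x j s : x \in X -> 0 <= s -> s <= t -> `|sg j (x + s) - sg j x| <= K * t.
  move=> xX s0 st; have x0 := X0 x xX; rewrite !sgE ?addr_ge0//.
  apply: le_trans (ns_curve_lipschitz _ _ _ q0 q1 x0 s0) _.
  by apply: ler_pM => //; [rewrite addr_ge0// mulr_ge0// ltW|exact: lipj].
have [z [h [zc dh hx]]] := hC t (K * t) e' t0 tT (mulr_gt0 K0 t0) e'0 e'1 he (fun x j z xX => h1 x xX t tt1 j z).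
exists (t `^ H), z, h; split => //; [by rewrite powR_gt0|exact: h2|].
move=> x xX; have := hx x xX.
have t2H : t `^ (2 * H) = t `^ H ^+ 2 by rewrite [2 * H]mulrC powRrM powR_mulrn ?powR_ge0.
rewrite t2H => /le_trans; apply.
have tE : t * t `^ H = t `^ (1 - H) * t `^ H ^+ 2.
  rewrite -t2H -powRD_pos// (_ : 1 - H + 2 * H = 1 + H); last by ring.
  by rewrite powRD_pos// powRr1// ltW.
have p2 : 0 <= t `^ H ^+ 2 by exact: sqr_ge0.
have u1 := h3 t t0 tt3.
have -> : C * (K * t * t `^ H + e' * t `^ H ^+ 2) = (C * K * t `^ (1 - H) + C * e') * t `^ H ^+ 2.
  by rewrite -mulrA tE; ring.
apply: ler_wpM2r => //.
have v1 : C * K * t `^ (1 - H) <= eps / 2.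
  have := ler_wpM2l (ltW (mulr_gt0 C0 K0)) u1.
  by rewrite (_ : C * K * (eps / (2 * C * K)) = eps / 2)//; field; rewrite !gt_eqF.
have v2 : C * e' <= eps / 2.
  have := ler_wpM2l (ltW C0) e'C.
  by rewrite (_ : C * (eps / (2 * C)) = eps / 2)//; field; rewrite gt_eqF.
lra.
Qed.

(** The contradiction hypothesis has one purpose: a nonzero vector [b] or [c] provides the centre
    [z0] that keeps the leading curve away from the constants. *)
Lemma nonconstant_coef_eq0 : (forall j, c j = 0) /\ (forall j, b j = 0).
Proof.
apply: contrapT => nz; have [m [m0 hm]] := fine_expansion.
have [z0 lower] : exists z0 : 'I_d -> R,
    (forall z : 'I_d -> R, (forall j, `|z j - z0 j| <= m) -> 1 <= \sum_(j < d) b j * z j) \/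
    (forall z : 'I_d -> R, (forall j, `|z j - z0 j| <= m) -> 1 <= \sum_(j < d) c j * z j).
  have [cn|c0] := pselect (exists j, c j != 0).
    by have [z0 h] := dominating_center (ltW m0) cn; exists z0; right.
  have [bn|b0] := pselect (exists j, b j != 0).
    by have [z0 h] := dominating_center (ltW m0) bn; exists z0; left.
  by case: nz; split => j; apply/eqP/negPn/negP => ?; [apply: c0|apply: b0]; exists j.
have hG n : shift_diff2 q (shift_diff2 q (shift_diff 1 (fun n => quad_drift sg n%:R))) n = 0.
  apply: (second_order_recurrence q0 q1 lower) => k.
  have [||tau [z [h [t0 tk zm dh hi]]]] := hm z0 [seq i%:R | i <- iota 0 k.+1] _ k.+1%:R^-1 _.
  - by move=> x /mapP[i _ ->].
  - by rewrite invr_gt0.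
  exists tau, z, h; split => // i ik.
  have := hi i%:R (map_f _ _); rewrite mem_iota/= add0n ltnS ik => /(_ isT).
  by congr (is_true (`|_ - _ * _| <= _)); apply: eq_bigr => j _; rewrite sgE.
(* [(p j + Q j * x) * q ^ x] is the decaying part of the primitive of [sg j]. Its product with the
   decaying part of [sg j] is what creates the base [q ^ 2]. *)
pose p j := - (b j / l + c j / l ^+ 2); pose Q j := - c j / l.
have vpE j (n : nat) : vol_prim sg j n%:R = a j * n%:R + (p j + Q j * n%:R) * q ^+ n - p j.
  rewrite -powR_natr// -integral_ns_curve//; apply: eq_Rintegral => y /set_mem.
  by rewrite /= in_itv/= => /andP[y0 _]; exact: sgE.
have GE n : quad_drift sg n%:R =
  exp_poly (\sum_(j < d) - (a j * p j)) (\sum_(j < d) a j ^+ 2) 0 1 n +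
  (exp_poly (\sum_(j < d) (a j * p j - b j * p j)) (\sum_(j < d) (a j * Q j + a j * b j - c j * p j))
     (\sum_(j < d) a j * c j) q n +
   exp_poly (\sum_(j < d) b j * p j) (\sum_(j < d) (b j * Q j + c j * p j)) (\sum_(j < d) c j * Q j) (q ^+ 2) n).
  have s1 := sum_exp_poly (fun j => - (a j * p j)) (fun j => a j ^+ 2) (fun=> 0) 1 n.
  rewrite big1_eq in s1; rewrite s1 !sum_exp_poly -!big_split /quad_drift /=; apply: eq_bigr => j _.
  rewrite sgE// vpE /exp_poly /ns_curve powR_natr// expr1n -exprM mulnC exprM.
  by move: (q ^+ n) (p j) (Q j) => E pj Qj; ring.
have [zb _ zc] := square_exponent_independence q0 q1 GE hG.
(* The order matters: [p j] contains [c j], so the constant coefficient at [q ^ 2] is a multiple of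
   a sum of squares only once [c] vanishes. *)
have c0 j : c j = 0.
  apply: sum_sqr_eq0; transitivity (- l * \sum_(i < d) c i * Q i); last by rewrite zc mulr0.
  rewrite mulr_sumr; apply: eq_bigr => i _.
  by rewrite /Q; field; rewrite gt_eqF.
apply: nz; split => // j.
apply: sum_sqr_eq0; transitivity (- l * \sum_(i < d) b i * p i); last by rewrite zb mulr0.
  rewrite mulr_sumr; apply: eq_bigr => i _.
by rewrite /p c0; field; rewrite gt_eqF.
Qed.

End nonconstant_volatility.

Lemma volatility_eq0 j x : 0 <= x -> sg j x = 0.
Proof.
move=> x0; have [q [a [b [c [q0 q1 E]]]]] := volatility_common_exponent.
have [c0 b0] := nonconstant_coef_eq0 q0 q1 E.
have Ea i y : 0 <= y -> sg i y = a i by move=> y0; rewrite E// /ns_curve c0 b0; ring.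
by rewrite Ea// (constant_volatility_eq0 Ea).
Qed.

End consistency.

Theorem proposition5p1 (R : realType) (T H : R) (w : R -> R)
    (disp : measure_display) (Omega : measurableType disp)
    (P : probability Omega R) (d : nat) (beta : 'I_d -> R -> Omega -> R)
    (U : vectType R) (dotU : {dot U for (@idfun R)}) (e : 'I_d -> U)
    (sigma : U -> R -> R) (r : (R -> R) -> R -> Omega -> R -> R)
    (hT : 0 < T) (hH : 2^-1 < H < 1)
    (hw : admissible_weight w)
    (hbeta : is_fbm P T H beta)
    (he : orthonormal_basis dotU e)
    (hsigma : bounded_operator w dotU sigma)
    (hreg : regular_volatility w T H (fun j => sigma (e j)))
    (hr : forall x0, spaceE w x0 ->
            is_mild_solution P w T H beta (fun j => sigma (e j)) x0 (r x0))
    (hcons : consistent P w T r (@nelson_siegel R)) :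
  forall (u : U) (x : R), 0 <= x -> sigma u x = 0.

Proof.
have [Es slin _] := hsigma; have [_ hspan] := he.
(* The zero curve is reached as a trivial combination of the element [sigma 0] of E. *)
have E0 : spaceE w (fun=> 0).
  have := spaceE_lin hw 0 0 (Es 0) (Es 0).
  by congr spaceE; apply/funext => x; rewrite !mul0r addr0.
(* The exponent 1 is an arbitrary nonzero choice. Being in the family and in E, the zero curve is a
   legitimate initial curve. *)
have M0 : @nelson_siegel R (fun=> 0).
  by exists 0, 0, 0, 1; rewrite oner_neq0; split => // x _; rewrite /NScurve !mul0r !addr0.
have Edrift : spaceE w (drift H (fun j => sigma (e j)) T).
  by apply: hreg.1; rewrite in_itv/= lexx (ltW hT).
have se0 := volatility_eq0 hw hT hH hbeta E0 (fun j => Es (e j)) Edrift (hr _ E0) (hcons _ M0 E0).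
move=> u x x0; have s00 : sigma 0 x = 0.
  by have := slin 1 0 0 x x0; rewrite scale1r addr0 mul1r => /eqP; rewrite -subr_eq subrr eq_sym => /eqP.
(* Linearity of [sigma] is known only at points [x >= 0], so the expansion of [u] over the basis is
   carried through at the fixed [x]. *)
have lin0 (I : Type) (s : seq I) (k : I -> R) (v : I -> U) : (forall i, sigma (v i) x = 0) ->
    sigma (\sum_(i <- s) k i *: v i) x = 0.
  by move=> v0; elim: s => [|i s IH]; rewrite ?big_nil// big_cons slin// v0 IH mulr0 addr0.
have : u \in <<[seq e j | j : 'I_d]>>%VS by rewrite hspan memvf.
pose X := [tuple of [seq e j | j : 'I_d]].
move=> /(@coord_span _ _ _ X) ->; apply: lin0 => i.
have /mapP[j _ ->] : X`_i \in [seq e j | j : 'I_d] by apply: mem_nth; rewrite size_tuple.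
exact: se0.
Qed.
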